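(* Let $1\le N\le11$ and let $u$ be a smooth semi-stable solution of $-\Delta u=\frac{\lambda}{(1-u)^2}$ in $B$, $u=0$ on $\partial B$, where $B$ is the unit ball in $\mathbb{R}^N$. Then for every $t$ with $\max\left\{0,\frac{N-3}{2}\right\}<t<2+\sqrt6$, $$\int_0^1\frac{R^{N-1}\,dR}{\left(1-\|u\|_{L^\infty}+\frac{4\lambda_1(B)\,\gamma(t+\frac32,N)}{27}\left(\frac{4(2t+1)}{4t+2-t^2}\right)^{\frac2t}R^{\frac{4t+6-2N}{2t+3}}\right)^{2t+3}}\ \le\ \frac1N\left(\frac{4(2t+1)}{4t+2-t^2}\right)^{\frac{2t+3}{t}}.$$
   Context: Here $\lambda>0$. A solution $u$ (with $0\le u<1$) is semi-stable if $\int_B|\nabla\psi|^2dx\ge\lambda\int_B\frac{2}{(1-u)^3}\psi^2dx$ for all $\psi\in H_0^1(B)$. $\lambda_1(B)$ is the first eigenvalue of $-\Delta$ in $H_0^1(B)$. The constant $\gamma(\tau,N)$ is defined by $$\gamma(\tau,N):=\begin{cases}\dfrac{\tau}{2\tau-1}, & N=1,\\[2mm] \dfrac{\tau}{4(\tau-1)}, & N=2,\\[2mm] \dfrac{(\tau-1)^{\frac{\tau-1}{\tau}}}{(N-2)\,N^{\frac1\tau}\,(2\tau-N)^{\frac{\tau-1}{\tau}}}, & N\ge3.\end{cases}$$ *)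

(* Defs.v *)
From HB Require Import structures.
From mathcomp Require Import all_boot all_order all_algebra.
From mathcomp Require Import all_classical all_reals all_analysis.
Set Implicit Arguments.
Unset Strict Implicit.
Unset Printing Implicit Defensive.
Import Order.TTheory GRing.Theory Num.Theory.
Import numFieldNormedType.Exports.
Local Open Scope classical_set_scope.
Local Open Scope ring_scope.

(* The library has the Lebesgue measure on R only.  'rV[R]_n receives the
   sigma-algebra generated by the coordinates (i.e. the Borel sets) and the
   measure lebRn n, the n-fold product of lebesgue_measure; lebRn_box below
   characterizes it. *)

Definition rV_display : measure_display -> measure_display.
Proof. exact. Qed.

Section rV_measurable.
Context {R : realType} (n : nat).

Definition rV_coor (i : 'I_n) (x : 'rV[R]_n) : R := x ord0 i.

Let rV_set0 : g_sigma_preimage rV_coor set0.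
Proof. exact: sigma_algebra0. Qed.

Let rV_setC A : g_sigma_preimage rV_coor A -> g_sigma_preimage rV_coor (~` A).
Proof. exact: sigma_algebraC. Qed.

Let rV_bigcup (F : (set 'rV[R]_n)^nat) :
  (forall i, g_sigma_preimage rV_coor (F i)) ->
  g_sigma_preimage rV_coor (\bigcup_i (F i)).
Proof. exact: sigma_algebra_bigcup. Qed.

HB.instance Definition _ :=
  @isMeasurable.Build (rV_display default_measure_display) 'rV[R]_n
    (g_sigma_preimage rV_coor) rV_set0 rV_setC rV_bigcup.

Lemma measurable_rV_coor (i : 'I_n) : measurable_fun [set: 'rV[R]_n] (rV_coor i).
Proof.
move=> _ Y mY; rewrite setTI; apply: sub_sigma_algebra => /=.
rewrite -bigcup_seq/=; exists i => /=; first by rewrite mem_index_enum.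
by exists Y => //; rewrite setTI.
Qed.

Lemma measurable_fun_rVP d (T : measurableType d) (f : T -> 'rV[R]_n) :
  (forall i, measurable_fun [set: T] (fun t => f t ord0 i)) ->
  measurable_fun [set: T] f.
Proof.
move=> mf _ A mA; rewrite setTI.
suff: g_sigma_preimage (fun i => rV_coor i \o f) `<=` measurable.
  apply; rewrite g_sigma_preimage_comp; exists A => //.
  by rewrite setTI.
apply: smallest_sub; first exact: sigma_algebra_measurable.
rewrite -bigcup_seq => B [i _ [C mC <-]].
exact: mf.
Qed.

End rV_measurable.

Section lebRn.
Context {R : realType}.

Definition rV_cons n (p : R * 'rV[R]_n) : 'rV[R]_n.+1 :=
  \row_i (if unlift ord0 i is Some j then p.2 ord0 j else p.1).

Lemma measurable_rV_cons n :
  measurable_fun [set: R * 'rV[R]_n] (@rV_cons n).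
Proof.
apply: measurable_fun_rVP => i.
case: (unliftP ord0 i) => [j ->|->].
- rewrite (_ : (fun _ => _) = rV_coor j \o snd).
    exact: measurableT_comp (measurable_rV_coor j) measurable_snd.
  by apply/funext => -[a v]; rewrite /rV_cons mxE liftK.
- rewrite (_ : (fun _ => _) = fst); first exact: measurable_fst.
  by apply/funext => -[a v]; rewrite /rV_cons mxE unlift_none.
Qed.

Section step.
Local Open Scope ereal_scope.
Variables (n : nat) (m : {sigma_finite_measure set 'rV[R]_n -> \bar R}).

Definition leb_step : set 'rV[R]_n.+1 -> \bar R :=
  pushforward (@lebesgue_measure R \x m) (@rV_cons n).

Let mpre A : measurable A -> measurable (@rV_cons n @^-1` A).
Proof.
by move=> mA; rewrite -[X in measurable X]setTI; exact: measurable_rV_cons.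
Qed.

Let leb_step0 : leb_step set0 = 0.
Proof. by rewrite /leb_step /pushforward preimage_set0 measure0. Qed.

Let leb_step_ge0 A : 0 <= leb_step A.
Proof. by rewrite /leb_step /pushforward; exact: measure_ge0. Qed.

Let leb_step_sigma_additive : semi_sigma_additive leb_step.
Proof.
move=> F mF tF mUF; rewrite /leb_step /pushforward preimage_bigcup.
apply: measure_semi_sigma_additive.
- by move=> k; exact: mpre.
- apply/trivIsetP => /= i j _ _ ij; rewrite -preimage_setI.
  by move/trivIsetP : tF => /(_ _ _ _ _ ij) ->//; rewrite preimage_set0.
- by rewrite -preimage_bigcup; exact: mpre.
Qed.

HB.instance Definition _ := isMeasure.Build _ _ _ leb_step
  leb_step0 leb_step_ge0 leb_step_sigma_additive.

Let uncons (x : 'rV[R]_n.+1) : R * 'rV[R]_n :=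
  (x ord0 ord0, \row_j x ord0 (lift ord0 j)).

Let muncons : measurable_fun setT uncons.
Proof.
apply: measurable_fun_pair; first exact: (measurable_rV_coor ord0).
apply: measurable_fun_rVP => j.
rewrite (_ : (fun _ => _) = rV_coor (lift ord0 j)).
  exact: measurable_rV_coor.
by apply/funext => x; rewrite mxE.
Qed.

Let consK : cancel (@rV_cons n) uncons.
Proof.
move=> [a v]; rewrite /uncons /rV_cons mxE unlift_none /=; congr pair.
by apply/rowP => j; rewrite !mxE liftK.
Qed.

Let leb_step_sigma_finite : sigma_finite setT leb_step.
Proof.
have /sigma_finiteP[F [TF ndF Foo]] := sigma_finiteT (@lebesgue_measure R).
have /sigma_finiteP[G [TG ndG Goo]] := sigma_finiteT m.
exists (fun k => uncons @^-1` (F k `*` G k)).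
  apply/esym; rewrite -subTset => x _.
  have [i _ Fi] : (\bigcup_k F k) (uncons x).1 by rewrite -TF.
  have [j _ Gj] : (\bigcup_k G k) (uncons x).2 by rewrite -TG.
  exists (maxn i j) => //; split.
    by move: Fi; exact/subsetPset/ndF/leq_maxl.
  by move: Gj; exact/subsetPset/ndG/leq_maxr.
move=> k; have [mF Fk] := Foo k; have [mG Gk] := Goo k; split.
  by rewrite -[X in measurable X]setTI; apply: muncons => //; exact: measurableX.
rewrite /leb_step /pushforward (_ : _ @^-1` _ = F k `*` G k).
  by rewrite product_measure1E// lte_mul_pinfty// ge0_fin_numE.
by apply/funext => p; rewrite /preimage /mkset consK.
Qed.

HB.instance Definition _ := Measure_isSigmaFinite.Build _ _ _ leb_step
  leb_step_sigma_finite.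

End step.

Fixpoint lebRn (n : nat) : {sigma_finite_measure set 'rV[R]_n -> \bar R} :=
  match n with
  | 0 => \d_(0 : 'rV[R]_0)
  | n'.+1 => leb_step (lebRn n')
  end.

Lemma lebRn_box n (A : 'I_n -> set R) : (forall i, measurable (A i)) ->
  lebRn n [set x : 'rV[R]_n | forall i, A i (x ord0 i)] =
  (\prod_(i < n) lebesgue_measure (A i))%E.
Proof.
elim: n A => [|n IH] A mA.
  rewrite big_ord0 /= diracE mem_set//.
  by case.
rewrite big_ord_recl -IH //= /leb_step /pushforward.
set S := (X in (_ \x _)%E X); set A' := (X in lebRn n X).
have -> : S = A ord0 `*` A'.
  apply/seteqP; split => -[a v] /=.
    move=> h; split => [|i].
      by have := h ord0; rewrite /rV_cons mxE unlift_none.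
    by have := h (lift ord0 i); rewrite /rV_cons mxE liftK.
  move=> [h0 h] i; rewrite /rV_cons mxE.
  by case: (unliftP ord0 i) => [j ->|->]; [exact: h|].
rewrite product_measure1E//; first exact: (mA ord0).
rewrite (_ : A' = \big[setI/setT]_(i < n) (rV_coor i @^-1` A (lift ord0 i))).
  apply: bigsetI_measurable => i _.
  by rewrite -[X in measurable X]setTI; exact: measurable_rV_coor.
rewrite -bigcap_seq; apply/seteqP; split => v /= h i.
  by move=> _; exact: h.
by apply: (h i); rewrite /= mem_index_enum.
Qed.

End lebRn.

Section calculus.
Context {R : realType} {N : nat}.
Implicit Types (f phi psi : 'rV[R]_N -> R) (g h : 'I_N -> 'rV[R]_N -> R).
Implicit Type D : set 'rV[R]_N.

Definition partial (i : 'I_N) f : 'rV[R]_N -> R :=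
  fun x => 'D_(delta_mx ord0 i) f x.

Definition iter_partial (s : seq 'I_N) f : 'rV[R]_N -> R :=
  foldr partial f s.

(* C^oo on the open set D: the partial derivatives of all orders exist and are
   continuous at every point of D. *)
Definition smooth_on D f := forall (s : seq 'I_N) x, D x ->
  {for x, continuous (iter_partial s f)} /\
  forall i, derivable (iter_partial s f) x (delta_mx ord0 i).

Definition laplacian f x : R := \sum_(i < N) partial i (partial i f) x.

(* C_c^oo(D) *)
Definition test_fun D phi := smooth_on setT phi /\
  exists K : set 'rV[R]_N,
    [/\ compact K, K `<=` D & forall x, ~ K x -> phi x = 0].

Definition square_integrable_on D f := measurable_fun D f /\
  (\int[lebRn N]_(x in D) (f x ^+ 2)%:E < +oo)%E.

Definition weak_gradient D psi g := forall i eta, test_fun D eta ->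
  (\int[lebRn N]_(x in D) (psi x * partial i eta x)%:E =
   - \int[lebRn N]_(x in D) (g i x * eta x)%:E)%E.

(* psi is in H^1(D), with weak gradient g *)
Definition H1 D psi g :=
  [/\ square_integrable_on D psi,
      forall i, square_integrable_on D (g i) &
      weak_gradient D psi g].

(* psi is in H_0^1(D), the closure of C_c^oo(D) in H^1(D), with weak gradient
   g: as g is unique up to a null set, carrying it along replaces the notation
   "nabla psi". *)
Definition H01 D psi g := H1 D psi g /\
  exists phi : ('rV[R]_N -> R)^nat,
    [/\ forall k, test_fun D (phi k),
        (\int[lebRn N]_(x in D) ((phi k x - psi x) ^+ 2)%:E)%E
          @[k --> \oo] --> 0%E &
        forall i,
        (\int[lebRn N]_(x in D) ((partial i (phi k) x - g i x) ^+ 2)%:E)%E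
          @[k --> \oo] --> 0%E].

(* Eigenvalues of -Delta in H_0^1(D), in the weak sense. *)
Definition dirichlet_eigenvalue D (nu : R) := exists phi g,
  [/\ H01 D phi g,
      ~ {ae lebRn N, forall x, D x -> phi x = 0} &
      forall psi h, H01 D psi h ->
        (\int[lebRn N]_(x in D) (\sum_(i < N) g i x * h i x)%:E =
         nu%:E * \int[lebRn N]_(x in D) (phi x * psi x)%:E)%E].

Definition first_dirichlet_eigenvalue D (nu : R) :=
  dirichlet_eigenvalue D nu /\
  forall nu', dirichlet_eigenvalue D nu' -> nu <= nu'.

(* Extending f by 0 outside D does not change its essential supremum norm. *)
Definition Linfty_norm D f : R := fine ('N[lebRn N]_+oo[EFin \o (f \_ D)])%E.

(* The norm of 'rV[R]_N is the max norm, so Euclidean balls are spelled out. *)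
Definition unit_ball : set 'rV[R]_N := [set x | \sum_(i < N) x ord0 i ^+ 2 < 1].
Definition closed_unit_ball : set 'rV[R]_N :=
  [set x | \sum_(i < N) x ord0 i ^+ 2 <= 1].
Definition unit_sphere : set 'rV[R]_N :=
  [set x | \sum_(i < N) x ord0 i ^+ 2 = 1].

(* A smooth solution with values in [0, 1[ of
   - Delta u = lambda / (1 - u)^2 in B,  u = 0 on the boundary of B. *)
Definition smooth_solution (lambda : R) (u : 'rV[R]_N -> R) :=
  [/\ smooth_on unit_ball u,
      {within closed_unit_ball, continuous u},
      forall x, unit_ball x -> 0 <= u x < 1,
      forall x, unit_ball x -> - laplacian u x = lambda / (1 - u x) ^+ 2 &
      forall x, unit_sphere x -> u x = 0].

Definition semi_stable (lambda : R) (u : 'rV[R]_N -> R) :=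
  forall psi g, H01 unit_ball psi g ->
  (\int[lebRn N]_(x in unit_ball) (\sum_(i < N) g i x ^+ 2)%:E >=
   lambda%:E * \int[lebRn N]_(x in unit_ball)
                 (2 / (1 - u x) ^+ 3 * psi x ^+ 2)%:E)%E.

End calculus.
Arguments unit_ball : clear implicits.

Definition gamma {R : realType} (tau : R) (N : nat) : R :=
  match N with
  | 1 => tau / (2 * tau - 1)
  | 2 => tau / (4 * (tau - 1))
  | _ => (tau - 1) `^ ((tau - 1) / tau) /
         ((N%:R - 2) * N%:R `^ (1 / tau) *
          (2 * tau - N%:R) `^ ((tau - 1) / tau))
  end.

(* Main.v *)
Require Import Defs.
From mathcomp Require Import all_boot all_order all_algebra.
From mathcomp Require Import all_classical all_reals all_analysis.
From mathcomp Require Import measurable_realfun ess_sup_inf ring lra.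
Set Implicit Arguments.
Unset Strict Implicit.
Unset Printing Implicit Defensive.
Import Order.TTheory GRing.Theory Num.Theory.
Import numFieldNormedType.Exports.
Local Open Scope classical_set_scope.
Local Open Scope ring_scope.

(** Why the theorem holds. Write B for the unit ball, f(s) = (1 - s)^-2,
    tau = t + 3/2, A = 4 (2t + 1) / (4t + 2 - t^2) and K = A^((2t + 3)/t);
    A is positive because t < 2 + sqrt 6.

    Energy. Stability is tested with (1 - u)^-t - 1 and the equation with a
    multiple of (1 - u)^-(2t + 1) - 1, chosen so that the gradient terms cancel.
    Young's inequality absorbs what remains, and the integral of (1 - u)^-(2t + 3)
    over B is at most K |B| (energy_estimate).

    Symmetry. For a reflection sigma, the function v = u o sigma solves the same
    equation. Stability of u, tested with the positive part of u - v, contradicts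
    the strict convexity of f unless u <= v (semi_stable_reflection). As
    reflections exchange any two points of the same norm, u(x) = U(|x|)
    (semi_stable_radial), where - (r^(N - 1) U')' = lambda r^(N - 1) f(U). In
    particular U is nonincreasing, and in polar coordinates the energy estimate
    bounds the integral of r^(N - 1) (1 - U)^-(2 tau) over [0, 1] by K / N
    (radial_energy).

    Growth. Integrating the radial equation and applying Hoelder's inequality with
    exponent tau to f(U) yields
    U(0) - U(r) <= lambda gamma(tau, N) K^(1/tau) r^(2 - N/tau) (profile_growth).

    Eigenvalue. Since s (1 - s)^2 <= 4/27 on [0, 1], the equation gives
    - Laplacian u >= (27 lambda / 4) u, and by Picone's identity every Dirichlet
    eigenvalue nu satisfies 27 lambda / 4 <= nu (eigenvalue_lower_bound).

    Conclusion. The norm of u in L^oo is at most U(0). Therefore the quantity in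
    the denominator of the theorem is at least
    1 - U(0) + lambda gamma K^(1/tau) r^(2 - N/tau) >= 1 - U(r), so that the
    integrand is at most r^(N - 1) (1 - U)^-(2t + 3), whose integral is known to
    be at most K / N.

    Test functions have to be smooth with compact support. They are obtained by
    composition with a smooth truncation that vanishes below a level d > 0; the
    estimates are uniform in d, which then tends to 0. *)

(** * Directional derivatives *)

Lemma is_deriveP {R : realType} {V : normedModType R} (f : V -> R) x v (l : R) :
  is_derive x v f l <-> h^-1 *: (f (h *: v + x) - f x) @[h --> 0^'] --> l.
Proof.
split=> [[dv <-]|h]; first exact: dv.
by apply: DeriveDef; [apply/cvg_ex; exists l|exact: cvg_lim].
Qed.

Section directional.
Context {R : realType} {V : normedModType R}.
Implicit Types (f w : V -> R) (x v e : V).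

(** Along a line a directional derivative is an ordinary derivative, which
    gives access to the calculus of functions of one real variable. *)
Lemma is_derive_lineP f x v (s l : R) :
  is_derive (s *: v + x) v f l <-> is_derive s 1 (fun h : R => f (h *: v + x)) l.
Proof.
suff e : (fun h : R => h^-1 *: (f (h *: v + (s *: v + x)) - f (s *: v + x)))
  = (fun h : R => h^-1 *: (f ((h *: (1 : R) + s) *: v + x) - f (s *: v + x))).
  by split => /is_deriveP; [rewrite e|rewrite -e] => h; exact/is_deriveP.
by apply/funext => h; rewrite [h *: 1]mulr1 scalerDl addrA.
Qed.

Lemma is_derive_line0P f x v (l : R) :
  is_derive x v f l <-> is_derive (0 : R) 1 (fun h : R => f (h *: v + x)) l.
Proof. by rewrite -is_derive_lineP scale0r add0r. Qed.

Lemma is_derive_comp_real (F : R -> R) (dF : R) w (dw : R) x v :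
  is_derive (w x) 1 F dF -> is_derive x v w dw ->
  is_derive x v (F \o w) (dF * dw).
Proof.
move=> hF /is_derive_line0P hw; apply/is_derive_line0P.
apply: (@is_derive1_comp R F (fun h => w (h *: v + x))) => //.
by rewrite scale0r add0r.
Qed.

Lemma is_derive_scale_dir f x v (l k : R) :
  is_derive x v f l -> is_derive x (k *: v) f (k * l).
Proof.
move=> /is_derive_line0P h; apply/is_derive_line0P.
have hk : is_derive (0 : R) 1 (fun t : R => t * k) k.
  have := @is_deriveM R R id (cst k) 0 1 1 0 _ _.
  by move=> /(_ _ _)/is_derive_eq; apply; rewrite scaler0 add0r [_ *: _]mulr1.
have := @is_derive1_comp R (fun h => f (h *: v + x)) (fun t => t * k) 0 l k.
rewrite mul0r => /(_ h hk); rewrite mulrC => /= h'.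
by rewrite (_ : (fun t => _) = (fun h0 => f (h0 *: v + x)) \o (fun t => t * k)) //;
  apply/funext => t /=; rewrite scalerA.
Qed.

Lemma is_derive1_continuous (f : R -> R) (s l : R) :
  is_derive s 1 f l -> {for s, continuous f}.
Proof. by move=> [d _]; exact/differentiable_continuous/derivable1_diffP. Qed.

(** The increment of f is a step along v followed by a step along e. The mean
    value theorem evaluates the second one at a nearby point, where the
    derivative along e is close to its value at x by continuity. *)
Lemma is_derive_add_dir f (df : V -> R) x v e (l s : R) :
  (\forall y \near x, is_derive y e f (df y)) ->
  {for x, continuous df} -> is_derive x v f l ->
  is_derive x (v + s *: e) f (l + s * df x).
Proof.
move=> hdf cdf /is_deriveP hv; apply/is_deriveP.
rewrite (_ : (fun h => _) = fun h : R => h^-1 *: (f (h *: v + x) - f x) +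
    h^-1 *: (f ((h * s) *: e + (h *: v + x)) - f (h *: v + x))); last first.
  apply/funext => h; rewrite -scalerDr; congr (_ *: _).
  rewrite scalerDr scalerA [_ *: v + _ *: e]addrC -addrA.
  by rewrite [RHS]addrC subrKA.
apply: cvgD => //; apply/cvgrPdist_le => eps eps0.
have es0 : 0 < eps / (1 + `|s|) by rewrite divr_gt0 // ltr_pwDl.
have : \forall y \near x, is_derive y e f (df y) /\ `|df x - df y| <= eps / (1 + `|s|).
  by apply: filterI => //; move/cvgrPdist_le : cdf; apply.
move=> /nbhs_ballP[r /= r0 hr].
near=> h.
have hn0 : h != 0 by near: h; exact: nbhs_dnbhs_neq.
have hh (th : R) : 0 <= th <= 1 -> ball x r (th *: ((h * s) *: e) + (h *: v + x)).
  move=> /andP[t0 t1]; rewrite -ball_normE /ball_ /= addrA opprD addrCA subrr addr0.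
  rewrite normrN (le_lt_trans (ler_normD _ _)) // normrZ (ger0_norm t0).
  have : `|h| * (1 + `|s| * `|e| + `|v|) < r.
    rewrite -ltr_pdivlMr; last by rewrite -addrA ltr_pwDl // addr_ge0 // mulr_ge0.
    near: h; apply: dnbhs0_lt; rewrite divr_gt0 //.
  apply: le_lt_trans; rewrite !normrZ.
  have : th * (`|h| * `|s| * `|e|) <= `|h| * `|s| * `|e|.
    by rewrite ler_piMl // !mulr_ge0.
  have := normr_ge0 h; nra.
pose phi (th : R) := f (th *: ((h * s) *: e) + (h *: v + x)).
have dphi (th : R) : 0 <= th <= 1 ->
    is_derive th 1 phi (h * s * df (th *: ((h * s) *: e) + (h *: v + x))).
  move=> th01; apply/is_derive_lineP/is_derive_scale_dir.
  by have [h1 _] := hr _ (hh _ th01).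
have [||c c01] := @MVT_segment R phi
  (fun th => h * s * df (th *: ((h * s) *: e) + (h *: v + x))) 0 1 ler01.
- by move=> y; rewrite in_itv /= => /andP[y0 y1]; apply: dphi; rewrite !ltW.
- apply: continuous_in_subspaceT => y; rewrite inE /= in_itv /= => y01.
  exact: is_derive1_continuous (dphi _ y01).
rewrite /phi scale1r scale0r add0r subr0 mulr1 => ->.
rewrite in_itv /= in c01; have [_ hc] := hr _ (hh _ c01).
rewrite [_ *: _]mulrA mulrA mulVf // mul1r -mulrBr normrM.
apply: (@le_trans _ _ (`|s| * (eps / (1 + `|s|)))); first by rewrite ler_wpM2l.
by rewrite mulrCA ler_piMr ?(ltW eps0) // ler_pdivrMr ?mul1r ?lerDr // ltr_pwDl.
Unshelve. all: by end_near. Qed.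

End directional.

(** * Functions of class C^k *)

Lemma continuous_near_eq {T U : topologicalType} (f g : T -> U) (x : T) :
  (\near x, f x = g x) -> {for x, continuous f} -> {for x, continuous g}.
Proof.
move=> fg cf; rewrite /prop_for /continuous_at -(nbhs_singleton fg).
by apply: cvg_trans cf; exact: near_eq_cvg.
Qed.

Section continuous_at.
Context {R : realType} {T : topologicalType}.
Implicit Types (f g : T -> R) (x : T).

Lemma continuous_atD f g x : {for x, continuous f} -> {for x, continuous g} ->
  {for x, continuous (f \+ g)}.
Proof. by move=> cf cg; apply: cvgD. Qed.

Lemma continuous_atB f g x : {for x, continuous f} -> {for x, continuous g} ->
  {for x, continuous (f \- g)}.
Proof. by move=> cf cg; apply: cvgB. Qed.

Lemma continuous_atM f g x : {for x, continuous f} -> {for x, continuous g} ->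
  {for x, continuous (f \* g)}.
Proof. by move=> cf cg; apply: cvgM. Qed.

Lemma continuous_at_sum (I : Type) (r : seq I) (P : pred I) (f : I -> T -> R) x :
  (forall i, P i -> {for x, continuous (f i)}) ->
  {for x, continuous (fun y => \sum_(i <- r | P i) f i y)}.
Proof.
move=> cf; rewrite (_ : (fun y => _) = \big[(fun f g => f \+ g)/cst 0]_(i <- r | P i) f i).
  elim/big_ind : _ => // [|f1 f2]; first exact: cst_continuous.
  exact: continuous_atD.
by apply/funext => y; elim/big_rec2 : _ => // i a b Pi ->.
Qed.

End continuous_at.

Section Ck.
Context {R : realType} {N : nat}.
Implicit Types (f g w : 'rV[R]_N -> R) (D : set 'rV[R]_N) (x v : 'rV[R]_N).

(** Recursion on the order makes the closure properties below provable by
    induction; smooth_onP relates these classes to smoothness. *)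
Fixpoint Ck_on (k : nat) D f : Prop :=
  (forall x, D x -> {for x, continuous f}) /\
  match k with
  | 0 => True
  | k'.+1 => forall i, (forall x, D x -> derivable f x (delta_mx ord0 i)) /\
                       Ck_on k' D (partial i f)
  end.

Lemma Ck_on_continuous k D f x : Ck_on k D f -> D x -> {for x, continuous f}.
Proof. by case: k => [|k] [cf _] Dx; exact: cf. Qed.

Lemma Ck_on_partial k D f i : Ck_on k.+1 D f -> Ck_on k D (partial i f).
Proof. by move=> [_ /(_ i)[]]. Qed.

Lemma Ck_on_is_derive k D f i x : Ck_on k.+1 D f -> D x ->
  is_derive x (delta_mx ord0 i) f (partial i f x).
Proof. by move=> [_ /(_ i)[df _]] Dx; exact/derivableP/df. Qed.

Lemma Ck_onW k D f : Ck_on k.+1 D f -> Ck_on k D f.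
Proof.
elim: k f => [|k ih] f [cf df]; split => // i.
by have [? /ih ?] := df i.
Qed.

Lemma Ck_on_sub k D D' f : D' `<=` D -> Ck_on k D f -> Ck_on k D' f.
Proof.
move=> sub; elim: k f => [|k ih] f [cf df]; split => //.
- by move=> x /sub; exact: cf.
- by move=> x /sub; exact: cf.
- by move=> i; have [dfi /ih ?] := df i; split => // x /sub; exact: dfi.
Qed.

Lemma Ck_onU k D D' f : Ck_on k D f -> Ck_on k D' f -> Ck_on k (D `|` D') f.
Proof.
elim: k f => [|k ih] f [cf df] [cf' df']; split => //.
- by move=> x [/cf|/cf'].
- by move=> x [/cf|/cf'].
- move=> i; have [dfi h] := df i; have [dfi' h'] := df' i; split; last exact: ih.
  by move=> x [/dfi|/dfi'].
Qed.

Lemma smooth_onP D f : smooth_on D f <-> forall k, Ck_on k D f.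
Proof.
split=> [sf k|Ckf s].
  elim: k f sf => [|k ih] f sf.
    by split => // x /(sf [::]) [].
  split => [x /(sf [::]) []//|i]; split=> [x /(sf [::]) [_]//|].
  apply: ih => s x /(sf (rcons s i)).
  by rewrite /iter_partial -cats1 foldr_cat.
elim/last_ind: s f Ckf => [|s i ih] f Ckf x Dx.
  have [cf df] := Ckf 1; split; first exact: cf.
  by move=> i; have [h _] := df i; exact: h.
rewrite /iter_partial -cats1 foldr_cat /=; apply: ih => // k.
exact: Ck_on_partial (Ckf k.+1).
Qed.

(** On an open set, derivatives only depend on the values there. *)
Lemma Ck_on_eq k D f g : open D -> (forall x, D x -> f x = g x) ->
  Ck_on k D f -> Ck_on k D g.
Proof.
move=> oD; elim: k f g => [|k ih] f g fg [cf df].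
all: have nfg x : D x -> \near x, f x = g x by
  (move=> Dx; apply: filterS (open_nbhs_nbhs (conj oD Dx)) => y /fg).
all: have cg x : D x -> {for x, continuous g} by
  (move=> Dx; apply: continuous_near_eq (nfg _ Dx) (cf _ Dx)).
  by [].
split => //; move=> i; have [dfi h] := df i.
have dg x (Dx : D x) : is_derive x (delta_mx ord0 i) g (partial i f x).
  by apply: near_eq_is_derive (nfg _ Dx) _; exact/derivableP/dfi.
split => [x /dg []//|]; apply: ih h => x Dx.
by have := dg _ Dx; rewrite /partial => -[_ ->].
Qed.

Lemma Ck_on_build k D f (df : 'I_N -> 'rV[R]_N -> R) : open D ->
  (forall x i, D x -> is_derive x (delta_mx ord0 i) f (df i x)) ->
  (forall x, D x -> {for x, continuous f}) ->
  (forall i, Ck_on k D (df i)) -> Ck_on k.+1 D f.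
Proof.
move=> oD hdf cf Cdf; split => // i; split=> [x Dx|].
  by have [] := hdf x i Dx.
by apply: Ck_on_eq (Cdf i) => // x Dx; have [_] := hdf x i Dx.
Qed.

Lemma Ck_on_cst k D (c : R) : open D -> Ck_on k D (cst c).
Proof.
move=> oD; elim: k c => [|k ih] c.
  by split=> // x _; exact: cst_continuous.
apply: (@Ck_on_build _ _ _ (fun=> cst 0)) => // x _; exact: cst_continuous.
Qed.

Lemma Ck_onD k D f g : open D -> Ck_on k D f -> Ck_on k D g ->
  Ck_on k D (f \+ g).
Proof.
move=> oD; elim: k f g => [|k ih] f g Cf Cg.
all: have cfg x : D x -> {for x, continuous (f \+ g)} by
  (move=> Dx; apply: continuous_atD; [exact: Ck_on_continuous Cf Dx|exact: Ck_on_continuous Cg Dx]).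
  by [].
apply: (@Ck_on_build _ _ _ (fun i => partial i f \+ partial i g)) => // [x i Dx|i].
- by apply: is_deriveD; [exact: Ck_on_is_derive Cf Dx|exact: Ck_on_is_derive Cg Dx].
- by apply: ih; exact: Ck_on_partial.
Qed.

Lemma Ck_onM k D f g : open D -> Ck_on k D f -> Ck_on k D g ->
  Ck_on k D (f \* g).
Proof.
move=> oD; elim: k f g => [|k ih] f g Cf Cg.
all: have cfg x : D x -> {for x, continuous (f \* g)} by
  (move=> Dx; apply: continuous_atM; [exact: Ck_on_continuous Cf Dx|exact: Ck_on_continuous Cg Dx]).
  by [].
apply: (@Ck_on_build _ _ _ (fun i => (f \* partial i g) \+ (g \* partial i f))) => // [x i Dx|i].
- by apply: is_deriveM; [exact: Ck_on_is_derive Cf Dx|exact: Ck_on_is_derive Cg Dx].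
- by apply: Ck_onD => //; apply: ih; first [exact: Ck_onW|exact: Ck_on_partial].
Qed.

Lemma Ck_on_scale k D f (c : R) : open D -> Ck_on k D f ->
  Ck_on k D (fun x => c * f x).
Proof. by move=> oD Cf; apply: (@Ck_onM _ _ (cst c)) => //; exact: Ck_on_cst. Qed.

Lemma Ck_onB k D f g : open D -> Ck_on k D f -> Ck_on k D g ->
  Ck_on k D (f \- g).
Proof.
move=> oD Cf Cg; rewrite (_ : f \- g = f \+ (fun x => -1 * g x)).
  by apply: Ck_onD => //; exact: Ck_on_scale.
by apply/funext => x /=; rewrite mulN1r.
Qed.

Lemma Ck_on_sum k D n (f : 'I_n -> 'rV[R]_N -> R) : open D ->
  (forall i, Ck_on k D (f i)) -> Ck_on k D (fun x => \sum_i f i x).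
Proof.
move=> oD; elim: n f => [|n ih] f Cf.
  rewrite (_ : (fun _ => _) = cst 0); first exact: Ck_on_cst.
  by apply/funext => x; rewrite big_ord0.
rewrite (_ : (fun _ => _) = f ord0 \+ (fun x => \sum_(i < n) f (lift ord0 i) x)).
  by apply: Ck_onD => //; exact: ih.
by apply/funext => x; rewrite big_ord_recl.
Qed.

(** F k stands for the k-th derivative of F 0 on I. Giving the derivatives as a
    sequence of explicit functions keeps the chain rule free of iterated
    derivatives. *)
Definition smooth_family (I : set R) (F : nat -> R -> R) :=
  forall k s, I s -> is_derive s 1 (F k) (F k.+1 s).

(** The i-th partial derivative of F j \o w is (F j.+1 \o w) times that of w,
    hence an induction on k for all members of the family at once. *)
Lemma Ck_on_comp k D (I : set R) F w j : open D -> smooth_family I F ->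
  Ck_on k D w -> (forall x, D x -> I (w x)) -> Ck_on k D (F j \o w).
Proof.
move=> oD sF; elim: k w j => [|k ih] w j Cw Iw.
all: have cFw x : D x -> {for x, continuous (F j \o w)} by
  (move=> Dx; apply: continuous_comp; [exact: Ck_on_continuous Cw Dx|
   apply: is_derive1_continuous; apply: sF; exact: Iw]).
  by [].
apply: (@Ck_on_build _ _ _ (fun i => (F j.+1 \o w) \* partial i w)) => // [x i Dx|i].
- apply: is_derive_comp_real; first by apply: sF; exact: Iw.
  exact: Ck_on_is_derive Cw Dx.
- apply: Ck_onM => //; first by apply: ih => //; exact: Ck_onW.
  exact: Ck_on_partial.
Qed.

(** Continuity of the partial derivatives is what allows the coordinates of v to
    be added one at a time. *)
Lemma Ck_on_is_derive_dir D f x v : open D -> Ck_on 1 D f -> D x ->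
  is_derive x v f (\sum_j v ord0 j * partial j f x).
Proof.
move=> oD Cf Dx; rewrite {1}(row_sum_delta v).
elim: (index_enum _) => [|i r ih].
  by rewrite !big_nil; exact: is_derive0.
rewrite !big_cons addrC [X in is_derive _ _ _ X]addrC.
apply: is_derive_add_dir ih; last first.
  exact: Ck_on_continuous (Ck_on_partial i Cf) Dx.
by apply: filterS (open_nbhs_nbhs (conj oD Dx)) => y Dy; exact: Ck_on_is_derive Cf Dy.
Qed.

End Ck.

(** * Linear changes of variables *)

Lemma continuous_rV {R : realType} {T : topologicalType} n (f : T -> 'rV[R]_n) t :
  (forall i, {for t, continuous (fun s => f s ord0 i)}) -> {for t, continuous f}.
Proof.
move=> cf; apply/cvgrPdist_le => e e0; near=> s.
rewrite /Num.Def.normr/= mx_normrE (bigmax_le _ (ltW e0))//= => -[i j] _.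
rewrite !mxE/= ord1; move: j; near: s; apply: filter_forall => /= j.
by move/cvgrPdist_le: (cf j); apply.
Unshelve. all: by end_near. Qed.

Lemma is_derive_scalef {R : realType} {V : normedModType R} (f : V -> R) x v
    (c df : R) :
  is_derive x v f df -> is_derive x v (fun y => c * f y) (c * df).
Proof. exact: (@is_deriveZ R V R f c x v df). Qed.

Lemma is_derive_mulf {R : realType} {V : normedModType R} (f g : V -> R) x v
    (df dg : R) :
  is_derive x v f df -> is_derive x v g dg ->
  is_derive x v (fun y => f y * g y) (f x * dg + g x * df).
Proof. exact: (@is_deriveM R V f g x v df dg). Qed.

Lemma is_derive_addf {R : realType} {V : normedModType R} (f g : V -> R) x v
    (df dg : R) :
  is_derive x v f df -> is_derive x v g dg ->
  is_derive x v (fun y => f y + g y) (df + dg).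
Proof. exact: (@is_deriveD R V R f g x v df dg). Qed.

Lemma is_derive_subf {R : realType} {V : normedModType R} (f g : V -> R) x v
    (df dg : R) :
  is_derive x v f df -> is_derive x v g dg ->
  is_derive x v (fun y => f y - g y) (df - dg).
Proof. exact: (@is_deriveB R V R f g x v df dg). Qed.

Lemma is_derive_oppf {R : realType} {V : normedModType R} (f : V -> R) x v (df : R) :
  is_derive x v f df -> is_derive x v (fun y => - f y) (- df).
Proof. exact: (@is_deriveN R V R f x v df). Qed.

Lemma is_derive_sumf {R : realType} {V : normedModType R} n
    (f : 'I_n -> V -> R) (df : 'I_n -> R) x v :
  (forall i, is_derive x v (f i) (df i)) ->
  is_derive x v (fun y => \sum_i f i y) (\sum_i df i).
Proof.
move=> h; rewrite (_ : (fun y => _) = \sum_i f i); first exact: is_derive_sum.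
by apply/funext => y; rewrite fct_sumE.
Qed.

(** The invariance of the trace, tr (A H A^T) = tr H, in the form in which the
    second derivatives of a composite with A present it. *)
Lemma sum_orthogonal {R : realType} n (A : 'M[R]_n) (H : 'I_n -> 'I_n -> R) :
  A^T *m A = 1%:M ->
  \sum_i \sum_j A i j * (\sum_k A i k * H k j) = \sum_i H i i.
Proof.
move=> AA; have AAE j k : \sum_i A i j * A i k = (j == k)%:R.
  have /matrixP/(_ j k) := AA; rewrite !mxE => <-.
  by apply: eq_bigr => i _; rewrite mxE.
rewrite exchange_big /=; apply: eq_bigr => j _.
transitivity (\sum_k (\sum_i A i j * A i k) * H k j).
  under [RHS]eq_bigr do rewrite mulr_suml.
  rewrite [RHS]exchange_big /=; apply: eq_bigr => i _.
  by rewrite mulr_sumr; apply: eq_bigr => k _; rewrite mulrA.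
rewrite (bigD1 j) //= AAE eqxx mul1r big1 ?addr0 // => k kj.
by rewrite AAE eq_sym (negbTE kj) mul0r.
Qed.

Section linear_change.
Context {R : realType} {N : nat}.
Implicit Types (f g w : 'rV[R]_N -> R) (D : set 'rV[R]_N) (x v : 'rV[R]_N).

Lemma mulmxr_continuous (A : 'M[R]_N) : continuous (fun x : 'rV[R]_N => x *m A).
Proof.
move=> x; apply: continuous_rV => i.
rewrite (_ : (fun _ => _) = fun y : 'rV[R]_N => \sum_j y ord0 j * A j i); last first.
  by apply/funext => y; rewrite mxE.
apply: continuous_at_sum => j _.
apply: continuous_atM; first exact: coord_continuous.
exact: cst_continuous.
Qed.

Lemma is_derive_mulmxr (A : 'M[R]_N) D f i x : open D -> Ck_on 1 D f ->
  D (x *m A) ->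
  is_derive x (delta_mx ord0 i) (fun y => f (y *m A))
    (\sum_j A i j * partial j f (x *m A)).
Proof.
move=> oD Cf Dx; apply/is_derive_line0P.
have := Ck_on_is_derive_dir (row i A) oD Cf Dx.
under eq_bigr do rewrite mxE.
move=> /is_derive_line0P.
rewrite (_ : (fun h : R => _) = (fun h : R => f ((h *: delta_mx ord0 i + x) *m A))) //.
by apply/funext => h; rewrite mulmxDl -scalemxAl -rowE.
Qed.

Lemma Ck_on_mulmxr k (A : 'M[R]_N) D E f : open D -> open E ->
  (forall x, D x -> E (x *m A)) -> Ck_on k E f ->
  Ck_on k D (fun x => f (x *m A)).
Proof.
move=> oD oE DE; elim: k f => [|k ih] f Cf.
all: have cfA x : D x -> {for x, continuous (fun x => f (x *m A))} by
  (move=> Dx; apply: (@continuous_comp _ _ _ (fun x => x *m A) f);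
  [exact: mulmxr_continuous|exact: Ck_on_continuous Cf (DE _ Dx)]).
  by [].
have C1f : Ck_on 1 E f by elim: k Cf {ih} => // k ih /Ck_onW.
apply: (@Ck_on_build _ _ _ _ _
  (fun i x => \sum_j A i j * partial j f (x *m A))) => // [x i Dx|i].
  exact: is_derive_mulmxr C1f (DE _ Dx).
apply: Ck_on_sum => // j; apply: Ck_on_scale => //.
by apply: ih; exact: Ck_on_partial.
Qed.

(** If H is the Hessian of f at x A, then that of y |-> f (y A) at x is A H A^T,
    which has the same trace. *)
Lemma laplacian_mulmxr (A : 'M[R]_N) D f x : A^T *m A = 1%:M ->
  open D -> Ck_on 2 D f -> D (x *m A) ->
  laplacian (fun y => f (y *m A)) x = laplacian f (x *m A).
Proof.
move=> AA oD Cf Dx.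
have oD' : open ((fun y : 'rV[R]_N => y *m A) @^-1` D).
  by apply: open_comp => // y _; exact: mulmxr_continuous.
have d1 i y : D (y *m A) -> partial i (fun y => f (y *m A)) y =
    \sum_j A i j * partial j f (y *m A).
  by move=> Dy; have [_] := is_derive_mulmxr i oD (Ck_onW Cf) Dy.
have d2 i : partial i (partial i (fun y => f (y *m A))) x =
    \sum_j A i j * \sum_k A i k * partial k (partial j f) (x *m A).
  suff [_] : is_derive x (delta_mx ord0 i) (partial i (fun y => f (y *m A)))
    (\sum_j A i j * \sum_k A i k * partial k (partial j f) (x *m A)) by [].
  apply: (@near_eq_is_derive _ _ _ (fun y => \sum_j A i j * partial j f (y *m A))).
    by apply: filterS (open_nbhs_nbhs (conj oD' Dx)) => y Dy; rewrite d1.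
  apply: is_derive_sumf => j; apply: is_derive_scalef.
  exact: is_derive_mulmxr oD (Ck_on_partial j Cf) Dx.
transitivity (\sum_i \sum_j A i j * \sum_k A i k * partial k (partial j f) (x *m A)).
  by apply: eq_bigr => i _; exact: d2.
exact: (sum_orthogonal _ AA).
Qed.

Definition sqnorm x : R := \sum_(i < N) x ord0 i ^+ 2.

Lemma sqnormE x : sqnorm x = (x *m x^T) ord0 ord0.
Proof. by rewrite mxE; apply: eq_bigr => i _; rewrite mxE expr2. Qed.

Lemma sqnorm_ge0 x : 0 <= sqnorm x.
Proof. by apply: sumr_ge0 => i _; exact: sqr_ge0. Qed.

Lemma sqnorm_eq0 x : (sqnorm x == 0) = (x == 0).
Proof.
apply/eqP/eqP => [/eqP|->]; last by rewrite /sqnorm big1 // => i _; rewrite mxE expr0n.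
rewrite psumr_eq0 => [|i _]; last exact: sqr_ge0.
move=> /allP h; apply/rowP => i; rewrite mxE.
by have /implyP/(_ isT) := h i (mem_index_enum _); rewrite sqrf_eq0 => /eqP.
Qed.

Lemma sqnorm_continuous : continuous sqnorm.
Proof.
move=> x; apply: continuous_at_sum => i _.
rewrite (_ : (fun _ => _) = (fun y : 'rV[R]_N => y ord0 i) \* (fun y => y ord0 i)).
  by apply: continuous_atM; exact: coord_continuous.
by apply/funext => y /=; rewrite expr2.
Qed.

Lemma coord_le_sqnorm x i : `|x ord0 i| ^+ 2 <= sqnorm x.
Proof.
rewrite real_normK ?num_real // /sqnorm (bigD1 i) //= lerDl.
by apply: sumr_ge0 => j _; exact: sqr_ge0.
Qed.

Lemma open_unit_ball : open (unit_ball R N).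
Proof.
rewrite (_ : unit_ball R N = sqnorm @^-1` [set y | y < 1]) //.
by apply: open_comp; [move=> x _; exact: sqnorm_continuous|exact: open_lt].
Qed.

(** The Householder reflection in the hyperplane orthogonal to x - y, or the
    identity if x = y. *)
Lemma exists_reflection x y : sqnorm x = sqnorm y -> exists A : 'M[R]_N,
  [/\ A^T *m A = 1%:M, x *m A = y & forall z, sqnorm (z *m A) = sqnorm z].
Proof.
move=> xy; pose e := x - y.
have [e0|en0] := eqVneq (sqnorm e) 0.
  exists 1%:M; split=> [||z]; rewrite ?trmx1 ?mulmx1 //.
  by move/eqP : e0; rewrite sqnorm_eq0 subr_eq0 => /eqP.
pose A : 'M[R]_N := 1%:M - (2 / sqnorm e) *: (e^T *m e).
have AT : A^T = A by rewrite /A linearB /= trmx1 linearZ /= trmx_mul trmxK.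
have ee : e *m e^T = (sqnorm e)%:M by rewrite [LHS]mx11_scalar -sqnormE.
have PP : (e^T *m e) *m (e^T *m e) = sqnorm e *: (e^T *m e).
  by rewrite mulmxA -[e^T *m e *m e^T]mulmxA ee mul_mx_scalar -scalemxAl.
have AA : A *m A = 1%:M.
  rewrite /A mulmxBr mulmx1 mulmxBl mul1mx -scalemxAl -scalemxAr PP !scalerA.
  rewrite (_ : _ * sqnorm e = 2 / sqnorm e + 2 / sqnorm e); last by field.
  rewrite scalerDl; set B := _ *: _.
  by rewrite opprB addrK subrK.
exists A; split; first by rewrite AT.
  rewrite /A mulmxBr mulmx1 -scalemxAr mulmxA [x *m e^T]mx11_scalar mul_scalar_mx scalerA.
  rewrite (_ : _ * _ = 1) ?scale1r ?subKr //.
  suff h : sqnorm e = 2 * (x *m e^T) ord0 ord0.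
    by rewrite mulrAC -h mulfV.
  have hs : (y *m x^T) ord0 ord0 = (x *m y^T) ord0 ord0.
    by rewrite -[y *m x^T]trmxK trmx_mul trmxK mxE.
  move: xy; rewrite !sqnormE /e linearB /= !mulmxBr !mulmxBl !mxE -/(_ *m _).
  move: hs; rewrite !mxE => hs; lra.
move=> z; rewrite !sqnormE trmx_mul AT mulmxA -[z *m A *m A]mulmxA AA mulmx1 //.
Qed.

End linear_change.

(** * Borel sets of R^n and the integral of a partial derivative *)

Section rV_borel.
Context {R : realType}.

Lemma rV_box_measurable n (A : 'I_n -> set R) : (forall i, measurable (A i)) ->
  measurable [set x : 'rV[R]_n | forall i, A i (x ord0 i)].
Proof.
move=> mA; rewrite (_ : mkset _ = \big[setI/setT]_(i < n) (rV_coor i @^-1` A i)).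
  apply: bigsetI_measurable => i _.
  by rewrite -[X in measurable X]setTI; exact: measurable_rV_coor.
rewrite -bigcap_seq; apply/seteqP; split => v /= h i.
  by move=> _; exact: h.
by apply: (h i); rewrite /= mem_index_enum.
Qed.

(** An open set is the union of the boxes with rational corners that it
    contains, and there are countably many of them. *)
Lemma open_measurable_rV n (U : set 'rV[R]_n) : open U -> measurable U.
Proof.
move=> oU.
pose box (ab : 'rV[rat]_n * 'rV[rat]_n) :=
  [set x : 'rV[R]_n | forall i, [set` `]ratr (ab.1 ord0 i), ratr (ab.2 ord0 i)[%R] (x ord0 i)].
pose F ab := if pselect (box ab `<=` U) then box ab else set0.
rewrite (_ : U = \bigcup_ab F ab).
  apply: countable_bigcupT_measurable; first exact: countableP.
  move=> ab; rewrite /F; case: pselect => //= _.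
  apply: (@rV_box_measurable n
    (fun i => [set` `]ratr (ab.1 ord0 i), ratr (ab.2 ord0 i)[%R])) => i.
  exact: measurable_itv.
apply/seteqP; split => [x Ux|x [ab _]]; last by rewrite /F; case: pselect => //= h /h.
have [e /= e0 he] : nbhs_ball x U by apply/nbhs_ballP; exact: open_nbhs_nbhs.
have /choice[a ha] : forall i, exists a : rat, x ord0 i - e < ratr a < x ord0 i.
  move=> i; have : x ord0 i - e < x ord0 i by rewrite ltrBlDr ltrDl.
  by move=> /rat_in_itvoo[q]; rewrite in_itv /= => hq; exists q.
have /choice[b hb] : forall i, exists b : rat, x ord0 i < ratr b < x ord0 i + e.
  move=> i; have : x ord0 i < x ord0 i + e by rewrite ltrDl.
  by move=> /rat_in_itvoo[q]; rewrite in_itv /= => hq; exists q.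
exists (\row_i a i, \row_i b i) => //; rewrite /F; case: pselect => /= [_|[]].
  move=> i /=; rewrite in_itv /= !mxE.
  by have /andP[_ ->] := ha i; have /andP[-> _] := hb i.
move=> y hy; apply: he; rewrite -ball_normE /ball_ /=.
rewrite /Num.Def.normr/= mx_normrE (bigmax_lt _ e0)//= => -[i j] _.
rewrite !mxE /= ord1; have := hy j; rewrite /= in_itv /= !mxE => /andP[h1 h2].
have /andP[h3 _] := ha j; have /andP[_ h4] := hb j.
rewrite ltr_norml; lra.
Qed.

Lemma continuous_measurable_rV n (D : set 'rV[R]_n) (f : 'rV[R]_n -> R) :
  open D -> (forall x, D x -> {for x, continuous f}) -> measurable_fun D f.
Proof.
move=> oD cf; apply: (measurability _ (RGenOInfty.measurableE R)) => //.
move=> _ [_ [a ->] <-]; apply: open_measurable_rV.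
rewrite openE => x [Dx fx].
apply: filterI; first exact: open_nbhs_nbhs.
by apply: (cf _ Dx); apply: open_nbhs_nbhs; split => //; exact: rray_open.
Qed.

Lemma compact_continuous_bounded (T : topologicalType) (K : set T) (f : T -> R) :
  compact K -> {within K, continuous f} -> exists C, forall x, K x -> `|f x| <= C.
Proof.
move=> cK cf; have /compact_bounded[M [_ hM]] := continuous_compact cf cK.
exists (M + 1) => x Kx; apply: hM; first by rewrite ltrDl.
by exists x.
Qed.

End rV_borel.

Section ibp.
Context {R : realType}.
Local Notation leb := (@lebesgue_measure R).

Definition rV_cube n (M : R) := [set x : 'rV[R]_n | forall i, `|x ord0 i| <= M].
Arguments rV_cube : clear implicits.

Lemma rV_cubeE n M : rV_cube n M =
  [set x : 'rV[R]_n | forall i, [set` `[- M, M]%R] (x ord0 i)].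
Proof.
by apply/seteqP; split => x h i; have := h i; rewrite /= in_itv /= ler_norml.
Qed.

Lemma compact_cube n M : compact (rV_cube n M).
Proof. by rewrite rV_cubeE; apply: (@rV_compact R n (fun=> [set` `[- M, M]%R])) => _; exact: segment_compact. Qed.

Lemma measurable_cube n M : measurable (rV_cube n M).
Proof. by rewrite rV_cubeE; apply: (@rV_box_measurable _ n (fun=> [set` `[- M, M]%R])) => _; exact: measurable_itv. Qed.

Lemma lebRn_cube_fin n M : (lebRn n (rV_cube n M) < +oo)%E.
Proof.
rewrite rV_cubeE (lebRn_box (A := fun=> [set` `[- M, M]%R])) => [|_]; last exact: measurable_itv.
suff [] : ((0 <= \prod_(i < n) leb [set` `[- M, M]%R]) /\
           (\prod_(i < n) leb [set` `[- M, M]%R] < +oo))%E by [].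
elim/big_ind : _ => [|x y [x0 xy] [y0 yy]|i _].
- by split; [exact: lee01|exact: ltry].
- by split; [exact: mule_ge0|apply: lte_mul_pinfty => //; rewrite ge0_fin_numE].
- by split=> //; rewrite lebesgue_measure_itv /=; case: ifP => _; rewrite ltry.
Qed.

Lemma integrable_cube n (f : 'rV[R]_n -> R) (M C : R) : measurable_fun setT f ->
  (forall x, `|f x| <= C) -> (forall x, ~ rV_cube n M x -> f x = 0) ->
  (lebRn n).-integrable setT (EFin \o f).
Proof.
move=> mf fC f0.
have -> : EFin \o f = (EFin \o f) \_ (rV_cube n M).
  apply/funext => x; rewrite patchE; case: ifPn => //.
  by rewrite notin_setE => /f0 /= ->.
apply/integrable_restrict => //; first exact: measurable_cube.
rewrite setTI; apply: measurable_bounded_integrable.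
- exact: measurable_cube.
- exact: lebRn_cube_fin.
- exact: measurable_funS mf.
- by exists C; split; [exact: num_real|move=> D hD x _ /=; apply: le_trans (fC x) (ltW hD)].
Qed.

Lemma integral_derive0 (f df : R -> R) (M : R) : 0 < M ->
  (forall s : R, is_derive s 1 f (df s)) -> continuous df ->
  (forall s, M < `|s| -> f s = 0) -> (forall s, M < `|s| -> df s = 0) ->
  (\int[leb]_s (df s)%:E = 0)%E.
Proof.
move=> M0 hdf cdf f0 df0.
have -> : (\int[leb]_s (df s)%:E = \int[leb]_(s in `[(- (M + 1))%R, (M + 1)%R]) (df s)%:E)%E.
  rewrite [RHS]integral_mkcond; apply: eq_integral => x _; rewrite patchE.
  case: ifPn => //; rewrite notin_setE /= in_itv /= => h; rewrite df0 //.
  by rewrite ltNge ler_norml; apply/negP => h'; apply: h; lra.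
have h1 : M < `|M + 1| by rewrite gtr0_norm; lra.
have h2 : M < `|- (M + 1)| by rewrite normrN.
rewrite (@continuous_FTC2 _ df f); first by rewrite !f0 // subee.
- lra.
- exact: continuous_subspaceT.
- have cf (s : R) : {for s, continuous f} by exact: is_derive1_continuous (hdf s).
  split.
  + by move=> x _; have [] := hdf x.
  + by apply: cvg_at_right_filter; exact: cf.
  + by apply: cvg_at_left_filter; exact: cf.
- by move=> x _; rewrite derive1E; have [_] := hdf x.
Qed.

Lemma integral_lebRnS n (f : 'rV[R]_n.+1 -> R) : measurable_fun setT f ->
  (lebRn n.+1).-integrable setT (EFin \o f) ->
  (\int[lebRn n.+1]_x (f x)%:E =
   \int[leb \x lebRn n]_p (f (rV_cons p))%:E)%E /\
  (leb \x lebRn n)%E.-integrable setT (fun p => (f (rV_cons p))%:E).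
Proof.
move=> mf fi.
have ic : (leb \x lebRn n)%E.-integrable setT (fun p => (f (rV_cons p))%:E).
  apply/integrableP; split.
    by apply/measurable_EFinP; apply: measurableT_comp mf _; exact: measurable_rV_cons.
  have /integrableP[_] := fi; rewrite /= /leb_step ge0_integral_pushforward //.
  - exact: measurable_rV_cons.
  - by apply/measurable_EFinP; exact: measurableT_comp.
split=> //; rewrite /= /leb_step integral_pushforward //.
- exact: measurable_rV_cons.
- exact/measurable_EFinP.
Qed.

Lemma rV_cons_addl n (a h : R) (v : 'rV[R]_n) :
  rV_cons (h * 1 + a, v) = h *: delta_mx ord0 ord0 + rV_cons (a, v).
Proof.
apply/rowP => i; rewrite !mxE /=.
case: (unliftP ord0 i) => [j ->|->]; first by rewrite !mulr0 add0r.
by rewrite eqxx mulr1.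
Qed.

Lemma rV_cons_addr n (a h : R) (v w : 'rV[R]_n) :
  rV_cons (a, h *: w + v) = h *: rV_cons (0, w) + rV_cons (a, v).
Proof.
apply/rowP => i; rewrite !mxE /=.
by case: (unliftP ord0 i) => [j _|_]; rewrite ?mulr0 ?add0r // !mxE.
Qed.

Lemma rV_cons_delta n (j : 'I_n) :
  rV_cons (0 : R, delta_mx ord0 j) = delta_mx ord0 (lift ord0 j).
Proof.
apply/rowP => i; rewrite !mxE /=.
case: (unliftP ord0 i) => [k ->|->] /=.
  by rewrite !mxE /= (inj_eq lift_inj).
by [].
Qed.

Lemma rV_cons_continuousl n (v : 'rV[R]_n) : continuous (fun a : R => rV_cons (a, v)).
Proof.
move=> a; apply: continuous_rV => i.
case: (unliftP ord0 i) => [j ->|->].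
  rewrite (_ : (fun _ => _) = cst (v ord0 j)); first exact: cst_continuous.
  by apply/funext => s; rewrite mxE liftK.
rewrite (_ : (fun _ => _) = id) //.
by apply/funext => s; rewrite mxE unlift_none.
Qed.

Lemma rV_cons_continuousr n (a : R) : continuous (fun v : 'rV[R]_n => rV_cons (a, v)).
Proof.
move=> v; apply: continuous_rV => i.
case: (unliftP ord0 i) => [j ->|->].
  rewrite (_ : (fun _ => _) = fun v : 'rV[R]_n => v ord0 j); first exact: coord_continuous.
  by apply/funext => s; rewrite mxE liftK.
rewrite (_ : (fun _ => _) = cst a); first exact: cst_continuous.
by apply/funext => s; rewrite mxE unlift_none.
Qed.

(** Fubini singles out the first coordinate. A derivative along it integrates to
    zero on each line by the fundamental theorem of calculus; a derivative along
    another coordinate integrates to zero on each slice by induction on n. *)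
Lemma integral_partial0 n (i : 'I_n) (f df : 'rV[R]_n -> R) (M : R) : 0 < M ->
  (forall x, is_derive x (delta_mx ord0 i) f (df x)) -> continuous df ->
  (forall x, ~ rV_cube n M x -> f x = 0) -> (forall x, ~ rV_cube n M x -> df x = 0) ->
  (\int[lebRn n]_x (df x)%:E = 0)%E.
Proof.
move=> M0; elim: n i f df => [|n ih] i f df hdf cdf f0 df0; first by case: i hdf.
have mdf : measurable_fun setT df.
  by apply: continuous_measurable_rV; [exact: openT|move=> x _; exact: cdf].
have [C hC] : exists C, forall x, rV_cube n.+1 M x -> `|df x| <= C.
  apply: compact_continuous_bounded; first exact: compact_cube.
  exact: continuous_subspaceT.
have hC' x : `|df x| <= Num.max 0 C.
  have [/hC h|/df0 ->] := pselect (rV_cube n.+1 M x); first by rewrite le_max h orbT.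
  by rewrite normr0 le_max lexx.
have [-> ic] := integral_lebRnS mdf (integrable_cube mdf hC' df0).
have ncube (a : R) (v : 'rV[R]_n) : M < `|a| -> ~ rV_cube n.+1 M (rV_cons (a, v)).
  by move=> Ma /(_ ord0); rewrite mxE unlift_none /= leNgt Ma.
have ncuber (a : R) (v : 'rV[R]_n) : ~ rV_cube n M v -> ~ rV_cube n.+1 M (rV_cons (a, v)).
  by move=> nv h; apply: nv => j; have := h (lift ord0 j); rewrite mxE liftK.
case: (unliftP ord0 i) hdf => [j ->|->] hdf.
- rewrite -(integral12_prod_meas1 ic) integral0_eq // => a _.
  apply: (ih j (fun v => f (rV_cons (a, v))) (fun v => df (rV_cons (a, v)))).
  + move=> v; apply/is_derive_line0P.
    have /is_derive_line0P := hdf (rV_cons (a, v)).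
    rewrite -rV_cons_delta.
    rewrite [X in is_derive _ _ X _](_ : _ = fun h : R => f (rV_cons (a, h *: delta_mx ord0 j + v))) //.
    by apply/funext => h; rewrite rV_cons_addr.
  + move=> v; apply: (@continuous_comp _ _ _ (fun v => rV_cons (a, v)) df).
      exact: rV_cons_continuousr.
    exact: cdf.
  + by move=> v nv; rewrite f0 //; exact: ncuber.
  + by move=> v nv; rewrite df0 //; exact: ncuber.
- rewrite -(integral21_prod_meas1 ic) integral0_eq // => v _.
  apply: (@integral_derive0 (fun a => f (rV_cons (a, v))) (fun a => df (rV_cons (a, v))) M) => //.
  + move=> a; apply/is_deriveP; have /is_deriveP := hdf (rV_cons (a, v)).
    rewrite [X in X @ _ --> _](_ : _ = fun h : R =>
      h^-1 *: (f (rV_cons (h *: 1 + a, v)) - f (rV_cons (a, v)))) //.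
    by apply/funext => h; rewrite -rV_cons_addl.
  + move=> a; apply: (@continuous_comp _ _ _ (fun a => rV_cons (a, v)) df).
      exact: rV_cons_continuousl.
    exact: cdf.
  + by move=> a Ma; rewrite f0 //; exact: ncube.
  + by move=> a Ma; rewrite df0 //; exact: ncube.
Qed.

End ibp.
Arguments rV_cube {R} n M.

(** * Functions with compact support *)

Section compact_support.
Context {R : realType} {N : nat}.
Implicit Types (f g w : 'rV[R]_N -> R) (D K : set 'rV[R]_N) (x v : 'rV[R]_N).
Local Notation mu := (lebRn (R := R) N).

Lemma is_derive_partial f i x (l : R) :
  is_derive x (delta_mx ord0 i) f l -> partial i f x = l.
Proof. by case. Qed.

Lemma rV_hausdorff : hausdorff_space 'rV[R]_N.
Proof. exact: norm_hausdorff. Qed.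

Lemma compact_closed_rV K : compact K -> closed K.
Proof. by apply: compact_closed; exact: rV_hausdorff. Qed.

Lemma compact_sub_cube K : compact K -> exists2 M, 0 < M & K `<=` rV_cube N M.
Proof.
move=> /compact_bounded[M [_ hM]]; exists (Num.max 0 M + 1).
  by rewrite ltr_wpDl // le_max lexx.
move=> x Kx i; have : `|x| <= Num.max 0 M + 1.
  by apply: hM => //; rewrite ltr_pwDr // le_max lexx orbT.
apply: le_trans; rewrite [leRHS]/Num.Def.normr/= mx_normrE.
exact: (le_bigmax _ (fun ij => `|x ij.1 ij.2|) (ord0, i)).
Qed.

(** The open sets D and ~` K cover the space; f is C^k on the first and zero on
    the second. *)
Lemma Ck_on_zero_ext k D K f : open D -> closed K -> K `<=` D -> Ck_on k D f ->
  (forall x, ~ K x -> f x = 0) -> Ck_on k setT f.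
Proof.
move=> oD cK KD Cf f0; apply: (@Ck_on_sub _ _ _ (D `|` ~` K)).
  by move=> x _; have [/KD|] := pselect (K x); [left|right].
apply: Ck_onU => //; apply: (@Ck_on_eq _ _ _ _ (cst 0)).
- by rewrite openC.
- by move=> x /f0.
- by apply: Ck_on_cst; rewrite openC.
Qed.

Lemma partial_zero K f i x : closed K -> (forall x, ~ K x -> f x = 0) ->
  ~ K x -> partial i f x = 0.
Proof.
move=> cK f0 nKx.
have oK : open (~` K) by rewrite openC.
have [_] : is_derive x (delta_mx ord0 i) f 0 by
  apply: (@near_eq_is_derive _ _ _ (cst 0));
  apply: filterS (open_nbhs_nbhs (conj oK nKx)) => y /f0.
by [].
Qed.

Lemma compact_support_integrable D K f : open D -> (mu D < +oo)%E -> compact K ->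
  K `<=` D -> (forall x, D x -> {for x, continuous f}) ->
  (forall x, ~ K x -> f x = 0) -> mu.-integrable D (EFin \o f).
Proof.
move=> oD fD cK KD cf f0; apply: measurable_bounded_integrable => //.
- exact: open_measurable_rV.
- exact: continuous_measurable_rV.
- have [C hC] : exists C, forall x, K x -> `|f x| <= C.
    apply: compact_continuous_bounded => //.
    by apply: continuous_in_subspaceT => x; rewrite inE => /KD; exact: cf.
  exists (Num.max 0 C); split; [exact: num_real|move=> C' hC' x _ /=].
  have [/hC h|/f0 ->] := pselect (K x).
    by rewrite (le_trans h) // ltW // (le_lt_trans _ hC') // le_max lexx orbT.
  by rewrite normr0 ltW // (le_lt_trans _ hC') // le_max lexx.
Qed.

Lemma integral_partial_compact D K f i : open D -> compact K -> K `<=` D ->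
  Ck_on 1 D f -> (forall x, ~ K x -> f x = 0) ->
  \int[mu]_(x in D) partial i f x = 0.
Proof.
move=> oD cK KD Cf f0; have [M M0 KM] := compact_sub_cube cK.
have clK := compact_closed_rV cK.
have CT : Ck_on 1 setT f by exact: Ck_on_zero_ext Cf f0.
have p0 x : ~ K x -> partial i f x = 0 by exact: partial_zero.
rewrite Rintegral_mkcond /Rintegral (_ : partial i f \_ D = partial i f); last first.
  apply/funext => x; rewrite patchE; case: ifPn => //.
  by rewrite notin_setE => nD; rewrite p0 // => /KD.
suff -> : (\int[mu]_x (partial i f x)%:E = 0)%E by [].
apply: (@integral_partial0 _ _ i f (partial i f) M) => //.
- by move=> x; exact: Ck_on_is_derive CT _.
- by move=> x; exact: Ck_on_continuous (Ck_on_partial i CT) _.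
- by move=> x nx; apply: f0 => /KM.
- by move=> x nx; apply: p0 => /KM.
Qed.

(** The product f g is supported in K, so its partial derivative integrates to
    zero. *)
Lemma integral_by_parts D K f g i : open D -> (mu D < +oo)%E -> compact K ->
  K `<=` D -> Ck_on 1 D f -> Ck_on 1 D g -> (forall x, ~ K x -> g x = 0) ->
  \int[mu]_(x in D) (f x * partial i g x) = - \int[mu]_(x in D) (partial i f x * g x).
Proof.
move=> oD fD cK KD Cf Cg g0.
have Cfg := Ck_onM oD Cf Cg; have clK := compact_closed_rV cK.
have fg0 x : ~ K x -> (f \* g) x = 0 by move=> /g0 /= ->; rewrite mulr0.
have := integral_partial_compact i oD cK KD Cfg fg0.
have h x : D x -> partial i (f \* g) x = f x * partial i g x + partial i f x * g x.
  move=> Dx; rewrite [partial i f x * _]mulrC; apply: is_derive_partial.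
  by apply: is_deriveM; [exact: Ck_on_is_derive Cf Dx|exact: Ck_on_is_derive Cg Dx].
rewrite (@eq_Rintegral _ _ _ mu D (fun x => f x * partial i g x + partial i f x * g x)); last first.
  by move=> x; rewrite inE => /h.
move=> {}h; apply/eqP; rewrite -addr_eq0 -RintegralD ?h //.
- exact: open_measurable_rV.
- apply: (@compact_support_integrable D K) => //.
    move=> x Dx; apply: continuous_atM; first exact: Ck_on_continuous Cf Dx.
    exact: Ck_on_continuous (Ck_on_partial i Cg) Dx.
  by move=> x nKx; rewrite (partial_zero _ clK g0 nKx) mulr0.
- apply: (@compact_support_integrable D K) => //.
    move=> x Dx; apply: continuous_atM; last exact: Ck_on_continuous Cg Dx.
    exact: Ck_on_continuous (Ck_on_partial i Cf) Dx.
  by move=> x nKx; rewrite g0 // mulr0.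
Qed.

End compact_support.

(** * Test functions on the unit ball *)

Lemma Rintegral_sum d (T : measurableType d) (R : realType)
    (mu : {measure set T -> \bar R}) (D : set T) n (f : 'I_n -> T -> R) :
  measurable D -> (forall i, mu.-integrable D (EFin \o f i)) ->
  mu.-integrable D (EFin \o (fun x => \sum_i f i x)) /\
  \int[mu]_(x in D) (\sum_i f i x) = \sum_i \int[mu]_(x in D) f i x.
Proof.
move=> mD; elim: n f => [|n ih] f fi.
  have e : (fun x : T => \sum_(i < 0) f i x) = cst 0.
    by apply/funext => x; rewrite big_ord0.
  rewrite e big_ord0; split; first exact: integrable0.
  by rewrite /Rintegral integral0.
have [i1 i2] := ih (fun i => f (lift ord0 i)) (fun i => fi (lift ord0 i)).
have e : (fun x : T => \sum_(i < n.+1) f i x) =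
    (fun x => f ord0 x + \sum_(i < n) f (lift ord0 i) x).
  by apply/funext => x; rewrite big_ord_recl.
rewrite e big_ord_recl -i2; split; last by rewrite RintegralD.
rewrite (_ : EFin \o _ = (EFin \o f ord0) \+
  (EFin \o (fun x => \sum_(i < n) f (lift ord0 i) x))) //.
exact: integrableD.
Qed.

Lemma EFin_Rintegral d (T : measurableType d) (R : realType)
    (mu : {measure set T -> \bar R}) (D : set T) (f : T -> R) : measurable D ->
  mu.-integrable D (EFin \o f) ->
  (\int[mu]_(x in D) (f x)%:E)%E = (\int[mu]_(x in D) f x)%:E.
Proof. by move=> mD fi; rewrite /Rintegral fineK // integrable_fin_num. Qed.

Section ball.
Context {R : realType} {N : nat}.
Implicit Types (f g w psi eta : 'rV[R]_N -> R) (D K : set 'rV[R]_N) (x v : 'rV[R]_N).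
Local Notation mu := (lebRn (R := R) N).
Local Notation B := (unit_ball R N).

Lemma measurable_unit_ball : measurable B.
Proof. exact: open_measurable_rV open_unit_ball. Qed.

Lemma unit_ball_sub_cube : B `<=` rV_cube N 1.
Proof.
move=> x Bx i; rewrite -(@ler_pXn2r _ 2) ?nnegrE // expr1n.
exact: le_trans (coord_le_sqnorm x i) (ltW Bx).
Qed.

Lemma unit_ball_fin : (mu B < +oo)%E.
Proof.
apply: le_lt_trans (lebRn_cube_fin N (1 : R)); apply: le_measure.
- by rewrite inE; exact: measurable_unit_ball.
- by rewrite inE; exact: measurable_cube.
- exact: unit_ball_sub_cube.
Qed.

Lemma ball_support_integrable K f : compact K -> K `<=` B ->
  (forall x, B x -> {for x, continuous f}) ->
  (forall x, ~ K x -> f x = 0) -> mu.-integrable B (EFin \o f).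
Proof.
by move=> *; apply: (@compact_support_integrable _ _ B K) => //;
  [exact: open_unit_ball|exact: unit_ball_fin].
Qed.

Lemma green_formula K w eta : compact K -> K `<=` B -> Ck_on 2 B w ->
  Ck_on 1 B eta -> (forall x, ~ K x -> eta x = 0) ->
  \int[mu]_(x in B) (\sum_i partial i w x * partial i eta x) =
  \int[mu]_(x in B) (- laplacian w x * eta x).
Proof.
move=> cK KB Cw Ce e0; have clK := compact_closed_rV cK.
have mB := measurable_unit_ball.
have i1 i : mu.-integrable B (EFin \o (fun x => partial i w x * partial i eta x)).
  apply: (ball_support_integrable cK KB) => [x Bx|x nK].
    apply: continuous_atM; first exact: Ck_on_continuous (Ck_on_partial i Cw) Bx.
    exact: Ck_on_continuous (Ck_on_partial i Ce) Bx.
  by rewrite (partial_zero _ clK e0 nK) mulr0.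
have i3 i : mu.-integrable B (EFin \o (fun x => partial i (partial i w) x * eta x)).
  apply: (ball_support_integrable cK KB) => [x Bx|x nK]; last by rewrite e0 // mulr0.
  apply: continuous_atM; last exact: Ck_on_continuous Ce Bx.
  exact: Ck_on_continuous (Ck_on_partial i (Ck_on_partial i Cw)) Bx.
have i2 i : mu.-integrable B (EFin \o (fun x => - (partial i (partial i w) x * eta x))).
  exact: (integrableN (i3 i)).
have [_ ->] := Rintegral_sum mB i1.
transitivity (\int[mu]_(x in B) (\sum_i - (partial i (partial i w) x * eta x))).
  have [_ ->] := Rintegral_sum mB i2.
  apply: eq_bigr => i _.
  rewrite (integral_by_parts i open_unit_ball unit_ball_fin cK KB (Ck_on_partial i Cw) Ce e0).
  under [RHS]eq_Rintegral do rewrite -mulN1r.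
  by rewrite RintegralZl // mulN1r.
by apply: eq_Rintegral => x _; rewrite sumrN /laplacian mulNr mulr_suml.
Qed.

Lemma test_funP K psi : compact K -> K `<=` B -> (forall k, Ck_on k B psi) ->
  (forall x, ~ K x -> psi x = 0) -> test_fun B psi.
Proof.
move=> cK KB Cpsi p0; split; last by exists K.
apply/smooth_onP => k; apply: Ck_on_zero_ext (Cpsi k) p0 => //.
  exact: open_unit_ball.
exact: compact_closed_rV.
Qed.

Lemma test_fun_Ck k psi : test_fun B psi -> Ck_on k setT psi.
Proof. by move=> [/smooth_onP]. Qed.

Lemma continuous_atX2 (T : topologicalType) (h : T -> R) t : {for t, continuous h} ->
  {for t, continuous (fun s => h s ^+ 2)}.
Proof.
move=> ch; rewrite (_ : (fun s => _) = h \* h); first exact: continuous_atM.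
by apply/funext => s; rewrite /= expr2.
Qed.

(** The constant sequence approximates psi, and integration by parts identifies
    the weak gradient with the classical one. *)
Lemma test_fun_H01 psi : test_fun B psi -> H01 B psi (fun i => partial i psi).
Proof.
move=> tpsi; have [_ [K [cK KB p0]]] := tpsi; have clK := compact_closed_rV cK.
have Cp k : Ck_on k B psi by apply: Ck_on_sub (test_fun_Ck k tpsi).
have sq f : (forall x, B x -> {for x, continuous f}) ->
    (forall x, ~ K x -> f x = 0) -> square_integrable_on B f.
  move=> cf f0; split; first exact: continuous_measurable_rV open_unit_ball cf.
  have : mu.-integrable B (EFin \o (fun x => f x ^+ 2)).
    apply: (ball_support_integrable cK KB) => [x Bx|x /f0 ->].
      by apply: continuous_atX2; exact: cf.
    by rewrite expr0n.
  move=> /integrableP[_]; congr (_ < _)%E; apply: eq_integral => x _.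
  by rewrite /= ger0_norm // sqr_ge0.
split.
  split.
  - by apply: sq => // x Bx; exact: Ck_on_continuous (Cp 0) Bx.
  - move=> i; apply: sq => [x Bx|x nK].
      exact: Ck_on_continuous (Ck_on_partial i (Cp 1)) Bx.
    exact: partial_zero clK p0 nK.
  - move=> i eta [eta_sm [K' [cK' K'B e0]]].
    have Ce : Ck_on 1 B eta by apply: (@Ck_on_sub _ _ _ setT) => //; move/smooth_onP: eta_sm.
    have clK' := compact_closed_rV cK'.
    have i1 : mu.-integrable B (EFin \o (fun x => psi x * partial i eta x)).
      apply: (ball_support_integrable cK KB) => [x Bx|x nK]; last by rewrite p0 // mul0r.
      apply: continuous_atM; first exact: Ck_on_continuous (Cp 0) Bx.
      exact: Ck_on_continuous (Ck_on_partial i Ce) Bx.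
    have i2 : mu.-integrable B (EFin \o (fun x => partial i psi x * eta x)).
      apply: (ball_support_integrable cK' K'B) => [x Bx|x nK]; last by rewrite e0 // mulr0.
      apply: continuous_atM; last exact: Ck_on_continuous Ce Bx.
      exact: Ck_on_continuous (Ck_on_partial i (Cp 1)) Bx.
    rewrite (EFin_Rintegral measurable_unit_ball i1) (EFin_Rintegral measurable_unit_ball i2).
    rewrite -EFinN.
    congr EFin; exact: integral_by_parts open_unit_ball unit_ball_fin cK' K'B (Cp 1) Ce e0.
exists (fun=> psi); split=> //.
- rewrite (_ : (fun k => _) = cst 0%E); first exact: cvg_cst.
  by apply/funext => k; apply: integral0_eq => x _; rewrite subrr expr0n.
- move=> i; rewrite (_ : (fun k => _) = cst 0%E); first exact: cvg_cst.
  by apply/funext => k; apply: integral0_eq => x _; rewrite subrr expr0n.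
Qed.

Lemma grad_sqr_integrable psi : test_fun B psi ->
  mu.-integrable B (EFin \o (fun x => \sum_i partial i psi x ^+ 2)).
Proof.
move=> tpsi; have [_ [K [cK KB p0]]] := tpsi; have clK := compact_closed_rV cK.
have [] // := @Rintegral_sum _ _ _ mu B N (fun i x => partial i psi x ^+ 2).
  exact: measurable_unit_ball.
move=> i; apply: (ball_support_integrable cK KB) => [x Bx|x nK].
  by apply: continuous_atX2; exact: Ck_on_continuous (Ck_on_partial i (test_fun_Ck 1 tpsi)) _.
by rewrite (partial_zero _ clK p0 nK) expr0n.
Qed.

Lemma semi_stable_test lambda u psi : semi_stable lambda u ->
  (forall x, B x -> {for x, continuous u}) -> (forall x, B x -> u x < 1) ->
  test_fun B psi ->
  mu.-integrable B (EFin \o (fun x => 2 / (1 - u x) ^+ 3 * psi x ^+ 2)) /\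
  lambda * \int[mu]_(x in B) (2 / (1 - u x) ^+ 3 * psi x ^+ 2) <=
  \int[mu]_(x in B) (\sum_i partial i psi x ^+ 2).
Proof.
move=> st cu u1 tpsi; have := st _ _ (test_fun_H01 tpsi).
have [_ [K [cK KB p0]]] := tpsi.
have mB := measurable_unit_ball.
have ifu : mu.-integrable B (EFin \o (fun x => 2 / (1 - u x) ^+ 3 * psi x ^+ 2)).
  apply: (ball_support_integrable cK KB) => [x Bx|x nK]; last by rewrite p0 // expr0n mulr0.
  apply: continuous_atM; last first.
    by apply: continuous_atX2; exact: Ck_on_continuous (test_fun_Ck 0 tpsi) _.
  apply: continuous_atM; first exact: cst_continuous.
  apply: (@continuous_comp _ _ _ (fun x => (1 - u x) ^+ 3) (fun y : R => y^-1)).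
    apply: (@continuous_comp _ _ _ (fun x => 1 - u x) (fun y => y ^+ 3)).
      by apply: continuous_atB; [exact: cst_continuous|exact: cu].
    exact: exprn_continuous.
  by apply: inv_continuous; rewrite expf_neq0 // subr_eq0 gt_eqF // u1.
rewrite !EFin_Rintegral //; last exact: grad_sqr_integrable.
Qed.

End ball.

(** * A smooth cutoff and the powers of 1 - s *)

Section flat.
Context {R : realType}.
Implicit Types (p : {poly R}) (s d : R).

(** The functions p(1/s) exp(- d/s), extended by zero to s <= 0, form a class
    that is stable under differentiation: flat_step d p is the polynomial of the
    derivative. This reduces smoothness at 0 to a single differentiability
    statement. *)
Definition flat d p s : R := if 0 < s then p.[s^-1] * expR (- (d * s^-1)) else 0.

Definition flat_step d p : {poly R} := 'X^2 * (d *: p - p^`()).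

(** One term of the exponential series bounds its sum from below. *)
Lemma exprn_expR_le d n y : 0 < d -> 0 <= y ->
  y ^+ n * expR (- (d * y)) <= n`!%:R / d ^+ n.
Proof.
move=> d0 y0; rewrite expRN ler_pdivrMr ?expR_gt0 // mulrAC ler_pdivlMr ?exprn_gt0 //.
rewrite -exprMn [y * d]mulrC -ler_pdivrMl ?ltr0n ?fact_gt0 // [_^-1 * _]mulrC.
have dy : 0 <= d * y by rewrite mulr_ge0 // ltW.
case: n => [|n]; last by apply: le_trans (expR_ge1Dxn n dy); rewrite lerDr.
by rewrite expr0 fact0 divr1 -expR0 ler_expR.
Qed.

Lemma poly_expR_bounded d p n : 0 < d ->
  exists C, forall y, 0 < y -> `|y ^+ n * p.[y] * expR (- (d * y))| <= C.
Proof.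
move=> d0; elim/poly_ind: p n => [|p c ih] n.
  by exists 0 => y _; rewrite horner0 mulr0 mul0r normr0.
have [C hC] := ih n.+1.
exists (C + `|c| * (n`!%:R / d ^+ n)) => y y0.
rewrite hornerMXaddC [y ^+ n * _]mulrDr mulrDl (le_trans (ler_normD _ _)) // lerD //.
  suff -> : y ^+ n * (p.[y] * y) = y ^+ n.+1 * p.[y] by exact: hC.
  by rewrite exprSr -mulrA [y * _]mulrC.
rewrite [y ^+ n * c]mulrC -mulrA normrM; apply: ler_wpM2l => //.
rewrite ger0_norm; last by rewrite mulr_ge0 ?expR_ge0 // exprn_ge0 // ltW.
by apply: exprn_expR_le => //; exact: ltW.
Qed.

(** At 0 the difference quotient is h y^2 p(y) exp(- d y) with y = 1/h, and the
    factor that multiplies h is bounded by poly_expR_bounded. *)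
Lemma is_derive_flat d p s : 0 < d -> is_derive s 1 (flat d p) (flat d (flat_step d p) s).
Proof.
move=> d0; have [s0|s0|<-] := ltgtP 0 s.
- pose f := fun t : R => p.[t^-1] * expR (- (d * t^-1)).
  have ef : \forall t \near s, f t = flat d p t.
    near=> t; rewrite /flat ifT //; near: t.
    by apply: open_nbhs_nbhs; split => //; exact: open_gt.
  apply: near_eq_is_derive ef _.
  have dV : is_derive s 1 (fun t : R => t^-1) (- s ^- 2 *: 1).
    by apply: is_deriveV; rewrite gt_eqF.
  have dP : is_derive s 1 (fun t : R => p.[t^-1]) (p^`().[s^-1] * (- s ^- 2 *: 1)).
    exact: (@is_derive1_comp R (horner p) (fun t => t^-1)).
  have dE : is_derive s 1 (fun t : R => expR (- (d * t^-1)))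
      (expR (- (d * s^-1)) * (- d * (- s ^- 2 *: 1))).
    apply: (@is_derive1_comp R expR (fun t => - (d * t^-1))).
    rewrite (_ : (fun t => _) = (fun t => - d * t^-1)).
      exact: is_derive_scalef.
    by apply/funext => t; rewrite mulNr.
  apply: is_derive_eq (is_deriveM dP dE) _.
  rewrite /flat s0 /flat_step hornerM hornerXn !hornerE /= -exprVn.
  rewrite /GRing.scale /=; ring.
- rewrite [X in is_derive _ _ _ X](_ : _ = 0); last by rewrite /flat ltNge (ltW s0).
  apply: (@near_eq_is_derive _ _ _ (cst 0)).
  near=> t; rewrite /flat ltNge ifF //; apply/negbTE; rewrite negbK.
  apply: ltW; near: t.
  by apply: open_nbhs_nbhs; split => //; exact: open_lt.
- rewrite [X in is_derive _ _ _ X](_ : _ = 0); last by rewrite /flat ltxx.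
  apply/is_deriveP.
  have [C hC] := poly_expR_bounded p 2 d0.
  have C0 : 0 < `|C| + 1 by rewrite ltr_pwDr.
  apply/cvgrPdist_le => e e0; near=> h.
  rewrite [h *: 1]mulr1 addr0 {2}/flat ltxx subr0 sub0r normrN /flat.
  case: ifPn => [h0|_]; last by rewrite scaler0 normr0 ltW.
  have /hC : 0 < h^-1 by rewrite invr_gt0.
  rewrite (_ : h^-1 ^+ 2 * _ * _ = h^-1 * (h^-1 *: (p.[h^-1] * expR (- (d * h^-1))))); last first.
    by rewrite /GRing.scale /= expr2 !mulrA.
  rewrite normrM normfV (gtr0_norm h0) ler_pdivrMl // => /le_trans; apply.
  apply: (@le_trans _ _ (h * (`|C| + 1))).
    by rewrite ler_pM2l // (le_trans (ler_norm C)) // lerDl.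
  rewrite -ler_pdivlMr // -(gtr0_norm h0); near: h.
  by apply: dnbhs0_le; rewrite divr_gt0.
Unshelve. all: by end_near. Qed.

(** A smooth substitute for the positive part of s: the function
    (s - d) exp(- d / (s - d)) for s > d and 0 for s <= d. It lies between s - 2 d
    and s for s >= 0, and its slope stays between 0 and 1, which is what stability
    arguments require of a truncation. *)
Definition cutoff d s : R := (s - d) * flat d 1 (s - d).

Definition dcutoff d s : R := if d < s then expR (- (d / (s - d))) * (1 + d / (s - d)) else 0.

(** Leibniz' rule, where the factor s - d contributes two terms. For k = 0 the
    first one vanishes, whatever k.-1 means there. *)
Definition cutoff_family d k s : R :=
  k%:R * flat d (iter k.-1 (flat_step d) 1) (s - d) +
  (s - d) * flat d (iter k (flat_step d) 1) (s - d).

Lemma cutoff_family0 d : cutoff_family d 0 = cutoff d.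
Proof. by apply/funext => s; rewrite /cutoff_family mul0r add0r. Qed.

Lemma cutoff_smooth d : 0 < d -> smooth_family setT (cutoff_family d).
Proof.
move=> d0 k s _.
have dsh (f : R -> R) (l : R) : is_derive (s - d) 1 f l -> is_derive s 1 (fun t => f (t - d)) l.
  move=> h; have hs : is_derive s 1 (fun t : R => t - d) 1.
    exact: (@is_derive_shift R s 1 (- d)).
  by rewrite -[l]mulr1; exact: (@is_derive1_comp R f (fun t => t - d)).
apply: (dsh (fun s => k%:R * flat d (iter k.-1 (flat_step d) 1) s +
  s * flat d (iter k (flat_step d) 1) s)).
set r := s - d; set q := iter k _ 1.
have d1 : is_derive r 1 (flat d q) (flat d (flat_step d q) r) by exact: is_derive_flat.
have d2 : is_derive r 1 (fun s => s * flat d q s) (r * flat d (flat_step d q) r + flat d q r * 1).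
  exact: (@is_deriveM R R id (flat d q) r 1).
have d3 : is_derive r 1 (fun s => k%:R * flat d (iter k.-1 (flat_step d) 1) s) (k%:R * flat d q r).
  case: k @q d1 d2 => [|k] q d1 d2.
    rewrite mul0r (_ : (fun s => _) = cst 0); first exact: is_derive_cst.
    by apply/funext => t; rewrite mul0r.
  by apply: is_derive_scalef; exact: is_derive_flat.
apply: is_derive_eq (is_deriveD d3 d2) _.
rewrite /cutoff_family -/r /= -/q -natr1; ring.
Qed.

Lemma is_derive_cutoff d s : 0 < d -> is_derive s 1 (cutoff d) (dcutoff d s).
Proof.
move=> d0; have := @cutoff_smooth d d0 0 s I; rewrite cutoff_family0.
move/is_derive_eq; apply; rewrite /cutoff_family /dcutoff /= /flat subr_gt0.
case: ifPn => [ds|_]; last by rewrite !mulr0 addr0.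
rewrite /flat_step derivC subr0 !hornerE /=.
have : s - d != 0 by rewrite gt_eqF // subr_gt0.
by move=> ?; field.
Qed.

Lemma dcutoff_ge0 d s : 0 < d -> 0 <= dcutoff d s.
Proof.
move=> d0; rewrite /dcutoff; case: ifPn => // ds.
by rewrite mulr_ge0 ?expR_ge0 // addr_ge0 // divr_ge0 ?ltW // subr_gt0.
Qed.

(** With y = d / (s - d), this is 1 + y <= exp y. *)
Lemma dcutoff_le1 d s : 0 < d -> dcutoff d s <= 1.
Proof.
move=> d0; rewrite /dcutoff; case: ifPn => // ds.
by rewrite expRN ler_pdivrMl ?expR_gt0 // mulr1 expR_ge1Dx.
Qed.

Lemma cutoff_eq0 d s : s <= d -> cutoff d s = 0.
Proof. by move=> sd; rewrite /cutoff /flat subr_gt0 ltNge sd mulr0. Qed.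

Lemma cutoffE d s : d < s -> cutoff d s = (s - d) * expR (- (d / (s - d))).
Proof. by move=> ds; rewrite /cutoff /flat subr_gt0 ds hornerC mul1r. Qed.

Lemma cutoff_le d s : 0 < d -> 0 <= s -> cutoff d s <= s.
Proof.
move=> d0 s0; have [sd|ds] := leP s d; first by rewrite cutoff_eq0.
rewrite cutoffE //.
apply: (@le_trans _ _ (s - d)); last by rewrite gerBl ltW.
by rewrite ler_piMr ?subr_ge0 1?ltW // expR_lt1 oppr_lt0 divr_gt0 // subr_gt0.
Qed.

Lemma cutoff_ge0 d s : 0 <= cutoff d s.
Proof.
have [sd|ds] := leP s d; first by rewrite cutoff_eq0.
rewrite cutoffE //.
by rewrite mulr_ge0 ?expR_ge0 // subr_ge0 ltW.
Qed.

Lemma cutoff_ge d s : 0 < d -> s - 2 * d <= cutoff d s.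
Proof.
move=> d0; have [sd|ds] := leP s d; first by rewrite cutoff_eq0 //; lra.
rewrite cutoffE //.
have sd0 : 0 < s - d by rewrite subr_gt0.
apply: (@le_trans _ _ ((s - d) * (1 - d / (s - d)))).
  rewrite mulrBr mulr1 mulrCA divff ?gt_eqF // mulr1; lra.
by rewrite ler_wpM2l ?(ltW sd0) // expR_ge1Dx.
Qed.

End flat.

Section powers.
Context {R : realType}.

(** The successive derivatives of s |-> (1 - s)^a. *)
Definition pow1_family (a : R) k s : R :=
  (\prod_(j < k) (- (a - j%:R))) * (1 - s) `^ (a - k%:R).

Lemma pow1_smooth a : smooth_family [set s | s < 1] (pow1_family a).
Proof.
move=> k s /= s1; rewrite /pow1_family big_ord_recr /= -mulrA.
apply: is_derive_scalef.
have s10 : 0 < 1 - s by rewrite subr_gt0.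
have h : is_derive s 1 (fun t : R => 1 - t) (- 1).
  by apply: is_derive_eq (is_deriveB (is_derive_cst (1 : R) s 1) (is_derive_id s 1)) _; rewrite sub0r.
have := @is_derive1_comp R (fun x => x `^ (a - k%:R)) (fun t => 1 - t) s _ _ (is_derive1_powR _ s10) h.
move=> /is_derive_eq; apply.
rewrite (_ : a - k.+1%:R = a - k%:R - 1); first by ring.
by rewrite -natr1 opprD addrA.
Qed.

Lemma pow1_family0 a : pow1_family a 0 = fun s => (1 - s) `^ a.
Proof. by apply/funext => s; rewrite /pow1_family big_ord0 mul1r subr0. Qed.

Lemma is_derive_pow1 (a s : R) : s < 1 ->
  is_derive s 1 (fun s : R => (1 - s) `^ a) (- a * (1 - s) `^ (a - 1)).
Proof.
move=> s1; have := @pow1_smooth a 0 s s1; rewrite pow1_family0.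
by move=> /is_derive_eq; apply; rewrite /pow1_family big_ord1 subr0.
Qed.

End powers.

(** * A lower bound for the Dirichlet eigenvalues *)

Section picone.
Context {R : realType} {N : nat}.
Implicit Types (f g w psi eta phi : 'rV[R]_N -> R) (D K : set 'rV[R]_N) (x v : 'rV[R]_N).
Local Notation mu := (lebRn (R := R) N).
Local Notation B := (unit_ball R N).

(** The inverse of w is the power -1 of 1 - (1 - w), a case of Ck_on_comp. *)
Lemma Ck_on_inv k D w : open D -> Ck_on k D w -> (forall x, D x -> 0 < w x) ->
  Ck_on k D (fun x => (w x)^-1).
Proof.
move=> oD Cw w0.
have C1w : Ck_on k D (cst 1 \- w) by apply: Ck_onB => //; exact: Ck_on_cst.
have I1 x : D x -> [set s : R | s < 1] ((cst 1 \- w) x).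
  by move=> /w0 /= ?; rewrite gtrBl.
apply: Ck_on_eq (Ck_on_comp 0 oD (pow1_smooth (-1 : R)) C1w I1) => // x Dx.
by rewrite /= pow1_family0 subKr powR_inv1 // ltW // w0.
Qed.

(** The inequality of arithmetic and geometric means for a/2, a/2 and b, where
    a = 1 - s and b = s + e: 4 (a + b)^3 - 27 a^2 b = (a - 2 b)^2 (4 a + b). The
    constant 4/27 of the theorem comes from here. *)
Lemma weighted_amgm_cubic (s e : R) : 0 < s + e -> s <= 1 ->
  27 * ((1 - s) ^+ 2 * (s + e)) <= 4 * (1 + e) ^+ 3.
Proof.
move=> se s1; have : 0 <= (1 - s - 2 * (s + e)) ^+ 2 * (4 * (1 - s) + (s + e)).
  by rewrite mulr_ge0 ?sqr_ge0 // addr_ge0 ?mulr_ge0 ?subr_ge0 // ltW.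
nra.
Qed.

(** Picone's identity. With v = u + e, the difference between |grad phi|^2 and
    grad u . grad (phi^2 / v) is the square of grad phi - (phi / v) grad u. By the
    equation grad u . grad (phi^2 / v) and lambda phi^2 / ((1 - u)^2 v) have the
    same integral, and (1 - u)^2 v is bounded by weighted_amgm_cubic. The shift by e makes v
    positive without a maximum principle for u. *)
Lemma picone_poincare lambda u phi (e : R) : 0 < lambda -> 0 < e ->
  Ck_on 2 B u -> (forall x, B x -> 0 <= u x < 1) ->
  (forall x, B x -> - laplacian u x = lambda / (1 - u x) ^+ 2) ->
  test_fun B phi ->
  27 * lambda / 4 / (1 + e) ^+ 3 * \int[mu]_(x in B) (phi x ^+ 2) <=
  \int[mu]_(x in B) (\sum_i partial i phi x ^+ 2).
Proof.
move=> l0 e0 Cu u01 eq tphi; have [_ [K [cK KB p0]]] := tphi.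
have clK := compact_closed_rV cK.
have oB : open B by exact: open_unit_ball.
have Cp k : Ck_on k B phi by apply: Ck_on_sub (test_fun_Ck k tphi).
pose v x := u x + e.
have v0 x : B x -> 0 < v x by move=> /u01 /andP[? _]; rewrite ltr_wpDl.
have Cv : Ck_on 1 B v by apply: Ck_onD => //; [exact: Ck_onW|exact: Ck_on_cst].
pose eta := (phi \* phi) \* (fun x => (v x)^-1).
have Ce : Ck_on 1 B eta.
  exact: (Ck_onM oB (Ck_onM oB (Cp 1) (Cp 1)) (Ck_on_inv oB Cv v0)).
have e_0 x : ~ K x -> eta x = 0 by move=> nK; rewrite /eta /= p0 // !mul0r.
have pe x i : B x -> partial i eta x =
    2 * phi x * partial i phi x / v x - phi x ^+ 2 * partial i u x / v x ^+ 2.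
  move=> Bx; apply: is_derive_partial.
  have dv : is_derive x (delta_mx ord0 i) v (partial i u x + 0).
    by apply: is_deriveD; exact: Ck_on_is_derive (Ck_onW Cu) Bx.
  have vn0 : v x != 0 by rewrite gt_eqF // v0.
  have dV : is_derive x (delta_mx ord0 i) (fun x => (v x)^-1) (- v x ^- 2 * (partial i u x + 0)).
    have h : is_derive (v x) (1 : R) (fun y : R => y^-1) (- v x ^- 2 *: 1).
      by apply: is_deriveV.
    by have := is_derive_comp_real h dv; rewrite [_ *: _]mulr1.
  have dp := Ck_on_is_derive i (Cp 1) Bx.
  apply: is_derive_eq (is_derive_mulf (is_derive_mulf dp dp) dV) _.
  by rewrite addr0; field.
have := green_formula cK KB Cu Ce e_0; set I1 := \int[mu]_(x in B) _.
move=> hI1; apply: (@le_trans _ _ I1); last first.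
  apply: le_Rintegral; last 1 first.
  - move=> x Bx; apply: ler_sum => i _; rewrite pe //.
    have vn0 : v x != 0 by rewrite gt_eqF // v0.
    rewrite -subr_ge0 (_ : _ - _ = (partial i phi x - phi x * partial i u x / v x) ^+ 2).
      exact: sqr_ge0.
    by field.
  - exact: measurable_unit_ball.
  - apply: (ball_support_integrable cK KB) => [x Bx|x nK].
      apply: continuous_at_sum => i _; apply: continuous_atM.
        exact: Ck_on_continuous (Ck_on_partial i Cu) Bx.
      exact: Ck_on_continuous (Ck_on_partial i Ce) Bx.
    by rewrite big1 // => i _; rewrite (partial_zero i clK e_0 nK) mulr0.
  - exact: grad_sqr_integrable.
have i2 : mu.-integrable B (EFin \o (fun x => phi x ^+ 2)).
  apply: (ball_support_integrable cK KB) => [x Bx|x /p0 ->]; last by rewrite expr0n.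
  by apply: continuous_atX2; exact: Ck_on_continuous (Cp 0) Bx.
rewrite hI1 -RintegralZl //; last exact: measurable_unit_ball.
apply: le_Rintegral; last 1 first.
- move=> x Bx; rewrite eq // /eta /=.
  have /andP[u0 u1] := u01 _ Bx; have vx0 := v0 _ Bx.
  have u10 : 0 < 1 - u x by rewrite subr_gt0.
  have -> : lambda / (1 - u x) ^+ 2 * (phi x * phi x / v x) =
      lambda / ((1 - u x) ^+ 2 * v x) * phi x ^+ 2.
    by field; rewrite !gt_eqF.
  have -> : 27 * lambda / 4 / (1 + e) ^+ 3 = lambda * 27 / (4 * (1 + e) ^+ 3).
    by field; rewrite gt_eqF // addr_gt0.
  apply: ler_wpM2r; first exact: sqr_ge0.
  have e1 : 0 < 1 + e by rewrite addr_gt0.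
  rewrite ler_pdivlMr ?mulr_gt0 ?exprn_gt0 // mulrAC ler_pdivrMr ?mulr_gt0 ?exprn_gt0 //.
  rewrite -mulrA ler_pM2l //.
  by apply: weighted_amgm_cubic => //; exact: ltW.
- exact: measurable_unit_ball.
- have := integrableZl measurable_unit_ball (27 * lambda / 4 / (1 + e) ^+ 3) i2.
  by [].
- apply: (ball_support_integrable cK KB) => [x Bx|x /e_0 ->]; last by rewrite mulr0.
  apply: continuous_atM; last exact: Ck_on_continuous Ce Bx.
  rewrite (_ : (fun _ => _) = fun y => -1 * \sum_i partial i (partial i u) y); last first.
    by apply/funext => y; rewrite mulN1r.
  apply: continuous_atM; first exact: cst_continuous.
  apply: continuous_at_sum => i _.
  exact: Ck_on_continuous (Ck_on_partial i (Ck_on_partial i Cu)) Bx.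
Qed.

End picone.

Lemma ler_add_small {R : realType} (x y C : R) :
  (forall a, 0 < a <= 1 -> x <= y + C * a) -> x <= y.
Proof.
move=> h; apply/ler_addgt0Pr => e e0.
have C0 : 0 < `|C| + 1 by rewrite ltr_pwDr.
pose a := Num.min 1 (e / (`|C| + 1)).
have a0 : 0 < a by rewrite /a lt_min ltr01 divr_gt0.
apply: le_trans (h a _) _; first by rewrite a0 /a ge_min lexx.
rewrite lerD2l (@le_trans _ _ ((`|C| + 1) * a)) //.
  by rewrite ler_pM2r // (le_trans (ler_norm C)) // lerDl.
by rewrite mulrC -ler_pdivlMr // /a ge_min lexx orbT.
Qed.

Section eigenvalue.
Context {R : realType} {N : nat}.
Implicit Types (f g w psi eta phi : 'rV[R]_N -> R) (D K : set 'rV[R]_N) (x v : 'rV[R]_N).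
Local Notation mu := (lebRn (R := R) N).
Local Notation B := (unit_ball R N).

Lemma poincare_test lambda u phi : 0 < lambda ->
  Ck_on 2 B u -> (forall x, B x -> 0 <= u x < 1) ->
  (forall x, B x -> - laplacian u x = lambda / (1 - u x) ^+ 2) ->
  test_fun B phi ->
  27 * lambda / 4 * \int[mu]_(x in B) (phi x ^+ 2) <=
  \int[mu]_(x in B) (\sum_i partial i phi x ^+ 2).
Proof.
move=> l0 Cu u01 eq tphi; set G := leRHS.
(* (1 + a)^3 <= 1 + 7 a for a in [0, 1] *)
apply: (@ler_add_small _ _ _ (7 * G)) => a /andP[a0 a1].
have := picone_poincare l0 a0 Cu u01 eq tphi.
have G0 : 0 <= G.
  by apply: Rintegral_ge0 => x _; apply: sumr_ge0 => i _; exact: sqr_ge0.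
rewrite -/G mulrAC ler_pdivrMr ?exprn_gt0 ?addr_gt0 // => /le_trans; apply.
have : (1 + a) ^+ 3 <= 1 + 7 * a by nra.
by move=> /(ler_wpM2l G0) /le_trans; apply; rewrite mulrDr mulr1 mulrA [G * 7]mulrC.
Qed.

Lemma square_integrableP f : square_integrable_on B f ->
  mu.-integrable B (EFin \o (fun x => f x ^+ 2)).
Proof.
move=> [mf fi]; apply/integrableP; split.
  by apply/measurable_EFinP; exact: measurable_funX.
rewrite (eq_integral (fun x => (f x ^+ 2)%:E)) // => x _.
by rewrite /= ger0_norm // sqr_ge0.
Qed.

(** Young's inequality with a parameter: the difference of both sides is a
    square divided by a. *)
Lemma sqr_le_split (a p q : R) : 0 < a ->
  p ^+ 2 <= (1 + a) * q ^+ 2 + (1 + a^-1) * (q - p) ^+ 2.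
Proof.
move=> a0; rewrite -subr_ge0.
rewrite (_ : _ - _ = (a * q + (q - p)) ^+ 2 / a); first by rewrite divr_ge0 ?sqr_ge0 // ltW.
by field; rewrite gt_eqF.
Qed.

Lemma Rintegral_sqr_split (a : R) (p q : 'rV[R]_N -> R) : 0 < a ->
  mu.-integrable B (EFin \o (fun x => p x ^+ 2)) ->
  mu.-integrable B (EFin \o (fun x => q x ^+ 2)) ->
  mu.-integrable B (EFin \o (fun x => (q x - p x) ^+ 2)) ->
  \int[mu]_(x in B) (p x ^+ 2) <= (1 + a) * \int[mu]_(x in B) (q x ^+ 2) +
    (1 + a^-1) * \int[mu]_(x in B) ((q x - p x) ^+ 2).
Proof.
move=> a0 ip iq ipq; have mB := @measurable_unit_ball R N.
have i1 := integrableZl mB (1 + a) iq; have i2 := integrableZl mB (1 + a^-1) ipq.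
rewrite -!RintegralZl // -RintegralD //.
apply: le_Rintegral => //; last by move=> x _; exact: sqr_le_split.
exact: (integrableD mB i1 i2).
Qed.

Lemma measurable_test_fun phi : test_fun B phi -> measurable_fun B phi.
Proof.
move=> tp; apply: continuous_measurable_rV; first exact: open_unit_ball.
by move=> x _; exact: Ck_on_continuous (test_fun_Ck 0 tp) _.
Qed.

Lemma sqr_diff_integrable (p q : 'rV[R]_N -> R) (d : R) :
  measurable_fun B p -> measurable_fun B q ->
  (\int[mu]_(x in B) ((q x - p x) ^+ 2)%:E < d%:E)%E ->
  mu.-integrable B (EFin \o (fun x => (q x - p x) ^+ 2)) /\
  \int[mu]_(x in B) ((q x - p x) ^+ 2) <= d.
Proof.
move=> mp mq hd.
have i : mu.-integrable B (EFin \o (fun x => (q x - p x) ^+ 2)).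
  apply: (@square_integrableP (fun x => q x - p x)); split.
    exact: measurable_funB.
  by apply: lt_trans hd _; exact: ltry.
split=> //; rewrite -lee_fin -(EFin_Rintegral (@measurable_unit_ball R N) i).
exact: ltW.
Qed.

(** The inequality passes from test functions to the closure. Approximants with
    squared error a^2 are compared with their limits by sqr_le_split, whose
    factors 1 + a and (1 + 1/a) a^2 leave a total error of order a. *)
Lemma H01_poincare (c : R) psi (g : 'I_N -> 'rV[R]_N -> R) : 0 <= c ->
  (forall phi, test_fun B phi -> c * \int[mu]_(x in B) (phi x ^+ 2) <=
     \int[mu]_(x in B) (\sum_i partial i phi x ^+ 2)) ->
  H01 B psi g ->
  c * \int[mu]_(x in B) (psi x ^+ 2) <= \int[mu]_(x in B) (\sum_i g i x ^+ 2).
Proof.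
move=> c0 hc [[sp sg _] [phi [tphi cphi cg]]].
have mB := @measurable_unit_ball R N.
have ip := square_integrableP sp; have ig i := square_integrableP (sg i).
have [_ eG] := Rintegral_sum mB ig.
set P := \int[mu]_(x in B) (psi x ^+ 2); set G := \int[mu]_(x in B) _.
have G0 : 0 <= G.
  by apply: Rintegral_ge0 => x _; apply: sumr_ge0 => i _; exact: sqr_ge0.
apply: (@ler_add_small _ _ _ (3 * G + c * 2 + 4 * N%:R)) => a /andP[a0 a1].
have a20 : 0 < a ^+ 2 by rewrite exprn_gt0.
have near_lt (F : nat -> \bar R) : F k @[k --> \oo] --> 0%E ->
    \forall k \near \oo, (F k < (a ^+ 2)%:E)%E.
  move=> cF; have h : nbhs (0%E : \bar R) [set y | (y < (a ^+ 2)%:E)%E].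
    by apply: open_nbhs_nbhs; split; [exact: open_ereal_lt_ereal|rewrite /= lte_fin].
  exact: cF _ h.
have [k [hk hgk]] : exists k, (\int[mu]_(x in B) ((phi k x - psi x) ^+ 2)%:E < (a ^+ 2)%:E)%E /\
    forall i, (\int[mu]_(x in B) ((partial i (phi k) x - g i x) ^+ 2)%:E < (a ^+ 2)%:E)%E.
  have h1 := near_lt _ cphi.
  have h2 : \forall k \near \oo, forall i, (\int[mu]_(x in B) ((partial i (phi k) x - g i x) ^+ 2)%:E < (a ^+ 2)%:E)%E.
    by apply: filter_forall => i; exact: near_lt (cg i).
  exact: filter_ex (filterI h1 h2).
have tk := tphi k.
have [i1 e1] := sqr_diff_integrable (proj1 sp) (measurable_test_fun tk) hk.
have sk := test_fun_H01 tk; case: sk => [[skp skg _] _].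
have ik := square_integrableP skp; have ikg i := square_integrableP (skg i).
have i2 i := sqr_diff_integrable (proj1 (sg i)) (proj1 (skg i)) (hgk i).
have [_ eK] := Rintegral_sum mB ikg.
have s1 := Rintegral_sqr_split a0 ip ik i1.
have s2 : \int[mu]_(x in B) (\sum_i partial i (phi k) x ^+ 2) <=
    (1 + a) * G + (1 + a^-1) * (N%:R * a ^+ 2).
  rewrite eK /G eG mulr_sumr.
  have -> : N%:R * a ^+ 2 = \sum_(i < N) a ^+ 2 by rewrite sumr_const card_ord mulr_natl.
  rewrite mulr_sumr -big_split /=; apply: ler_sum => i _.
  have [j1 j2] := i2 i.
  have i3 : mu.-integrable B (EFin \o (fun x => (g i x - partial i (phi k) x) ^+ 2)).
    rewrite (_ : (fun x => (g i x - partial i (phi k) x) ^+ 2) = (fun x => (partial i (phi k) x - g i x) ^+ 2)) //.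
    by apply/funext => x; rewrite -sqrrN opprB.
  apply: le_trans (Rintegral_sqr_split a0 (ikg i) (ig i) i3) _.
  rewrite lerD2l ler_pM2l; last by rewrite addr_gt0 // invr_gt0.
  apply: le_trans j2; apply: le_Rintegral => // x _.
  by rewrite -sqrrN opprB.
have s3 := hc _ tk.
set Q := \int[mu]_(x in B) (phi k x ^+ 2) in s1 s3.
have a21 : (1 + a^-1) * a ^+ 2 <= 2 * a.
  by rewrite mulrDl mul1r expr2 mulrA mulVf ?gt_eqF // mul1r; nra.
have : c * P <= (1 + a) * ((1 + a) * G + N%:R * (2 * a)) + c * (2 * a).
  apply: le_trans (ler_wpM2l c0 s1) _.
  rewrite mulrDr; apply: lerD.
    rewrite mulrCA ler_pM2l ?addr_gt0 //; apply: le_trans s3 _; apply: le_trans s2 _.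
    by rewrite lerD2l mulrCA ler_wpM2l.
  apply: ler_wpM2l => //; apply: le_trans a21.
  by rewrite ler_pM2l // addr_gt0 // invr_gt0.
move=> /le_trans; apply.
have N0 : 0 <= N%:R :> R by [].
rewrite -subr_ge0 (_ : _ - _ = (1 - a) * a * G + 2 * a * N%:R * (1 - a)); last by ring.
have : 0 <= 1 - a by rewrite subr_ge0.
move=> a10; apply: addr_ge0; first by rewrite !mulr_ge0 // ltW.
by rewrite !mulr_ge0 // ltW.
Qed.

(** The Poincare inequality with constant 27 lambda / 4, applied to an
    eigenfunction, whose Dirichlet integral is nu times its squared norm. *)
Lemma eigenvalue_lower_bound lambda u nu : 0 < lambda ->
  Ck_on 2 B u -> (forall x, B x -> 0 <= u x < 1) ->
  (forall x, B x -> - laplacian u x = lambda / (1 - u x) ^+ 2) ->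
  dirichlet_eigenvalue B nu -> lambda <= 4 * nu / 27.
Proof.
move=> l0 Cu u01 eq [phi [g [hphi nz]]] /(_ phi g hphi) hE.
have mB := @measurable_unit_ball R N.
have c0 : 0 <= 27 * lambda / 4 by rewrite divr_ge0 // mulr_ge0 // ltW.
have := H01_poincare c0 (fun p => poincare_test l0 Cu u01 eq) hphi.
have [[sp sg _] _] := hphi.
have ip := square_integrableP sp; have ig i := square_integrableP (sg i).
have [iG _] := Rintegral_sum mB ig.
have : \int[mu]_(x in B) (\sum_i g i x ^+ 2) = nu * \int[mu]_(x in B) (phi x ^+ 2).
  apply: EFin_inj; rewrite EFinM -!EFin_Rintegral //.
move=> ->; have : 0 < \int[mu]_(x in B) (phi x ^+ 2).
  rewrite lt_neqAle Rintegral_ge0 ?andbT => [|x _]; last exact: sqr_ge0.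
  apply/eqP => /esym h0; apply: nz.
  have : (\int[mu]_(x in B) `|(phi x ^+ 2)%:E| = 0)%E.
    rewrite -[RHS]/(0%:E) -h0 -EFin_Rintegral //; apply: eq_integral => x _.
    by rewrite /= ger0_norm // sqr_ge0.
  have mp2 : measurable_fun B (fun x => (phi x ^+ 2)%:E).
    by apply/measurable_EFinP; apply: measurable_funX; exact: (proj1 sp).
  move=> /(ae_eq_integral_abs mu mB mp2); apply: filterS => x h /h.
  by move=> [] /eqP; rewrite sqrf_eq0 => /eqP.
move=> P0 h; have : 27 * lambda / 4 <= nu by rewrite -(ler_pM2r P0).
lra.
Qed.

End eigenvalue.

(** * Superlevel sets of functions that vanish on the boundary *)

Section superlevel.
Context {R : realType} {N : nat}.
Implicit Types (f g w psi eta phi u : 'rV[R]_N -> R) (D K : set 'rV[R]_N) (x v : 'rV[R]_N).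
Local Notation mu := (lebRn (R := R) N).
Local Notation B := (unit_ball R N).
Local Notation cB := (@closed_unit_ball R N).

Lemma closed_closed_unit_ball : closed cB.
Proof.
rewrite (_ : cB = @sqnorm R N @^-1` [set y | y <= 1]) //.
by apply: closed_comp; [move=> x _; exact: sqnorm_continuous|exact: closed_le].
Qed.

Lemma compact_closed_unit_ball : compact cB.
Proof.
apply: (subclosed_compact (@closed_closed_unit_ball) (@compact_cube R N 1)).
move=> x Bx i; rewrite -(@ler_pXn2r _ 2) ?nnegrE // expr1n.
exact: le_trans (coord_le_sqnorm x i) Bx.
Qed.

Lemma unit_ball_closed : B `<=` cB.
Proof. by move=> x; rewrite /closed_unit_ball /=; exact: ltW. Qed.

Definition boundary_null w := {within cB, continuous w} /\
  forall x, unit_sphere x -> w x = 0.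

(** By continuity up to the boundary, where w is zero, the set where w >= d is
    closed and does not meet the sphere. *)
Lemma compact_superlevel w (d : R) : 0 < d -> boundary_null w ->
  exists K, [/\ compact K, K `<=` B & forall x, B x -> ~ K x -> w x < d].
Proof.
move=> d0 [cw w0]; exists (cB `&` w @^-1` [set y | d <= y]); split.
- apply: (subclosed_compact _ compact_closed_unit_ball) => [|x [] //].
  rewrite (@closed_setSI _ cB _ closed_closed_unit_ball).
  by apply: (@closed_comp _ _ (w : subspace cB -> R)); [move=> x _; exact: cw|exact: closed_ge].
- move=> x [cx dx]; have [h|h|h] := ltgtP (sqnorm x) 1.
  + exact: h.
  + by move: cx; rewrite /closed_unit_ball /= leNgt -/(sqnorm x) h.
  + by move: dx => /=; rewrite w0 // leNgt d0.
- by move=> x Bx nK; rewrite ltNge; apply/negP => dx; apply: nK; split => //; exact: unit_ball_closed.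
Qed.

Lemma partial_patch f i x : B x -> partial i (f \_ B) x = partial i f x.
Proof.
move=> Bx; rewrite /partial; apply: near_eq_derive.
by apply: filterS (open_nbhs_nbhs (conj open_unit_ball Bx)) => y By; rewrite patchE mem_set.
Qed.

(** Patching by zero removes the arbitrary values of h outside the ball; inside,
    h vanishes off a superlevel set of w, which is compact. *)
Lemma superlevel_test w h (d : R) : 0 < d -> boundary_null w ->
  (forall k, Ck_on k B h) -> (forall x, B x -> w x <= d -> h x = 0) ->
  exists K, [/\ compact K, K `<=` B, forall x, ~ K x -> (h \_ B) x = 0,
    (forall k, Ck_on k B (h \_ B)) & test_fun B (h \_ B)].
Proof.
move=> d0 bw Ch h0; have [K [cK KB Kd]] := compact_superlevel d0 bw.
have p0 x : ~ K x -> (h \_ B) x = 0.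
  move=> nK; rewrite patchE; case: ifPn => // /set_mem Bx.
  by apply: h0 => //; apply: ltW; exact: Kd.
have Cp k : Ck_on k B (h \_ B).
  apply: Ck_on_eq (Ch k); first exact: open_unit_ball.
  by move=> x Bx; rewrite patchE mem_set.
by exists K; split => //; exact: test_funP cK KB Cp p0.
Qed.

(** u is continuous and less than 1 on the closed ball, which is compact. *)
Lemma solution_inv_bounded u : {within cB, continuous u} ->
  (forall x, unit_sphere x -> u x = 0) -> (forall x, B x -> u x < 1) ->
  exists2 C, 1 <= C & forall x, B x -> (1 - u x)^-1 <= C.
Proof.
move=> cu u0 u1.
have u1' x : cB x -> u x < 1.
  rewrite /closed_unit_ball /= -/(sqnorm x) le_eqVlt => /orP[/eqP h|/u1 //].
  by rewrite u0.
have [C hC] : exists C, forall x, cB x -> `|(1 - u x)^-1| <= C.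
  apply: compact_continuous_bounded; first exact: compact_closed_unit_ball.
  apply/subspace_continuousP => x cx.
  have h : (1 - u y) @[y --> within cB (nbhs x)] --> 1 - u x.
    apply: cvgB; first exact: cvg_cst.
    by have /subspace_continuousP := cu; apply.
  by apply: cvgV => //; rewrite subr_eq0 gt_eqF // u1'.
exists (Num.max 1 C); first by rewrite le_max lexx.
move=> x /unit_ball_closed /hC h; rewrite le_max (le_trans _ h) ?orbT //.
exact: ler_norm.
Qed.

Lemma open_measure_gt0 n (U : set 'rV[R]_n) : open U -> U !=set0 -> (0 < lebRn n U)%E.
Proof.
move=> oU [x Ux].
have [e /= e0 he] : nbhs_ball x U by apply/nbhs_ballP; exact: open_nbhs_nbhs.
pose A i := [set` `[x ord0 i - e / 2, x ord0 i + e / 2]%R].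
apply: (@lt_le_trans _ _ (lebRn n [set y | forall i, A i (y ord0 i)])).
  rewrite lebRn_box => [|i]; last exact: measurable_itv.
  elim/big_ind : _ => [|a b a0 b0|i _]; first exact: lte01.
  - exact: mule_gt0.
  - rewrite lebesgue_measure_itv /= lte_fin ifT; last by lra.
    by rewrite -EFinD lte_fin; lra.
apply: le_measure; rewrite ?inE.
- by apply: rV_box_measurable => i; exact: measurable_itv.
- exact: open_measurable_rV.
- move=> y hy; apply: he; rewrite -ball_normE /ball_ /=.
  rewrite /Num.Def.normr/= mx_normrE (bigmax_lt _ e0)//= => -[i j] _.
  rewrite !mxE /= ord1; have := hy j; rewrite /A /= in_itv /= => /andP[h1 h2].
  rewrite ltr_norml; lra.
Qed.

End superlevel.

(** * Radial symmetry of semi-stable solutions *)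

Section stability.
Context {R : realType} {N : nat}.
Implicit Types (f g w psi eta phi u h : 'rV[R]_N -> R) (D K : set 'rV[R]_N) (x v : 'rV[R]_N).
Local Notation mu := (lebRn (R := R) N).
Local Notation B := (unit_ball R N).
Local Notation cB := (@closed_unit_ball R N).

(** Stability is tested with h1 and the Laplacian of w with h2. The hypothesis on
    a and b says that |grad h1|^2 <= grad w . grad h2, so the two gradient terms
    can be eliminated. *)
Lemma stability_test lambda u w h1 h2 (a b : 'rV[R]_N -> R) (d : R) :
  semi_stable lambda u ->
  (forall x, B x -> {for x, continuous u}) -> (forall x, B x -> u x < 1) ->
  0 < d -> boundary_null w -> (forall k, Ck_on k B w) ->
  (forall k, Ck_on k B h1) -> (forall k, Ck_on k B h2) ->
  (forall x, B x -> w x <= d -> h1 x = 0) ->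
  (forall x, B x -> w x <= d -> h2 x = 0) ->
  (forall i x, B x -> partial i h1 x = a x * partial i w x) ->
  (forall i x, B x -> partial i h2 x = b x * partial i w x) ->
  (forall x, B x -> a x ^+ 2 <= b x) ->
  [/\ mu.-integrable B (EFin \o (fun x => 2 / (1 - u x) ^+ 3 * h1 x ^+ 2)),
      mu.-integrable B (EFin \o (fun x => - laplacian w x * h2 x)) &
  lambda * \int[mu]_(x in B) (2 / (1 - u x) ^+ 3 * h1 x ^+ 2) <=
  \int[mu]_(x in B) (- laplacian w x * h2 x)].
Proof.
move=> st cu u1 d0 bw Cw C1 C2 z1 z2 p1 p2 ab.
have mB := @measurable_unit_ball R N.
have [K1 [cK1 K1B q1 _ t1]] := superlevel_test d0 bw C1 z1.
have [K [cK KB q2 C2' t2]] := superlevel_test d0 bw C2 z2.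
have clK := compact_closed_rV cK.
have [i1 le1] := semi_stable_test st cu u1 t1.
have pe f x : B x -> (f \_ B) x = f x by move=> Bx; rewrite patchE mem_set.
have e1 : {in B, (fun x => 2 / (1 - u x) ^+ 3 * (h1 \_ B) x ^+ 2) =1
    (fun x => 2 / (1 - u x) ^+ 3 * h1 x ^+ 2)}.
  by move=> x /set_mem Bx; rewrite pe.
have e2 : {in B, (fun x => - laplacian w x * (h2 \_ B) x) =1
    (fun x => - laplacian w x * h2 x)}.
  by move=> x /set_mem Bx; rewrite pe.
have i2 : mu.-integrable B (EFin \o (fun x => - laplacian w x * (h2 \_ B) x)).
  apply: (ball_support_integrable cK KB) => [x Bx|x /q2 ->]; last by rewrite mulr0.
  apply: continuous_atM; last exact: Ck_on_continuous (C2' 0) Bx.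
  rewrite (_ : (fun _ => _) = fun y => -1 * \sum_i partial i (partial i w) y); last first.
    by apply/funext => y; rewrite mulN1r.
  apply: continuous_atM; first exact: cst_continuous.
  apply: continuous_at_sum => i _.
  exact: Ck_on_continuous (Ck_on_partial i (Ck_on_partial i (Cw 2))) Bx.
have i1' : mu.-integrable B (EFin \o (fun x => 2 / (1 - u x) ^+ 3 * h1 x ^+ 2)).
  by apply: eq_integrable i1 => // x Bx; rewrite /= (e1 x Bx).
have i2' : mu.-integrable B (EFin \o (fun x => - laplacian w x * h2 x)).
  by apply: eq_integrable i2 => // x Bx; rewrite /= (e2 x Bx).
split => //.
rewrite -(eq_Rintegral mu e1) -(eq_Rintegral mu e2).
apply: le_trans le1 _; rewrite -(green_formula cK KB (Cw 2) (C2' 1) q2).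
apply: le_Rintegral => //; first exact: grad_sqr_integrable.
- apply: (ball_support_integrable cK KB) => [x Bx|x nK].
    apply: continuous_at_sum => i _; apply: continuous_atM.
      exact: Ck_on_continuous (Ck_on_partial i (Cw 1)) Bx.
    exact: Ck_on_continuous (Ck_on_partial i (C2' 1)) Bx.
  by rewrite big1 // => i _; rewrite (partial_zero i clK q2 nK) mulr0.
- move=> x Bx; apply: ler_sum => i _.
  rewrite !partial_patch // p1 // p2 // exprMn.
  rewrite [leRHS]mulrCA -expr2 ler_wpM2r ?sqr_ge0 //; exact: ab.
Qed.

Lemma Ck_on_cutoff k D w (d : R) : open D -> 0 < d -> Ck_on k D w ->
  Ck_on k D (fun x => cutoff d (w x)).
Proof.
move=> oD d0 Cw; have := Ck_on_comp 0 oD (cutoff_smooth d0) Cw (fun _ _ => I).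
by rewrite cutoff_family0.
Qed.

Lemma partial_comp (F : R -> R) (dF : R) w i x :
  is_derive (w x) (1 : R) F dF -> is_derive x (delta_mx ord0 i) w (partial i w x) ->
  partial i (fun y => F (w y)) x = dF * partial i w x.
Proof. by move=> hF hw; apply: is_derive_partial; exact: (is_derive_comp_real hF hw). Qed.

(** Quantitative convexity of f(s) = (1 - s)^-2 on [0, 1[, where f'' >= 6. With
    p = 1 - u and q = 1 - v it reads
    f(u) - f(v) <= f'(u) (u - v) - 3 (u - v)^2. *)
Lemma inv_sqr_convex (p q : R) : 0 < p <= 1 -> 0 < q <= 1 -> p <= q ->
  p ^- 2 - q ^- 2 <= 2 / p ^+ 3 * (q - p) - 3 * (q - p) ^+ 2.
Proof.
move=> /andP[p0 p1] /andP[q0 q1] pq; rewrite -subr_ge0.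
have -> : 2 / p ^+ 3 * (q - p) - 3 * (q - p) ^+ 2 - (p ^- 2 - q ^- 2) =
   (q - p) ^+ 2 * ((2 * q + p) / (p ^+ 3 * q ^+ 2) - 3).
  by field; rewrite !gt_eqF.
rewrite mulr_ge0 ?sqr_ge0 // subr_ge0 ler_pdivlMr ?mulr_gt0 ?exprn_gt0 //.
have h1 : p ^+ 3 <= p by rewrite exprS ler_piMr ?(ltW p0) // exprn_ile1 // ltW.
have h2 : p ^+ 3 * q ^+ 2 <= p ^+ 3.
  by rewrite ler_piMr ?exprn_ge0 ?(ltW p0) // exprn_ile1 // ltW.
lra.
Qed.

Lemma Rintegral_bounded_integrable f (C : R) : measurable_fun B f ->
  (forall x, B x -> `|f x| <= C) -> mu.-integrable B (EFin \o f).
Proof.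
move=> mf fC; apply: measurable_bounded_integrable => //.
- exact: measurable_unit_ball.
- exact: unit_ball_fin.
- exists C; split; [exact: num_real|move=> C' hC' x Bx /=].
  exact: le_trans (fC _ Bx) (ltW hC').
Qed.

Lemma boundary_null_mulmxr (A : 'M[R]_N) u : (forall z, sqnorm (z *m A) = sqnorm z) ->
  boundary_null u -> boundary_null (fun x => u x - u (x *m A)).
Proof.
move=> hA [/subspace_continuousP cu u0]; split; last first.
  by move=> x sx; rewrite u0 // u0 ?subrr //; rewrite /unit_sphere /= -/(sqnorm _) hA.
apply/subspace_continuousP => x cx; apply: cvgB; first exact: cu.
have cxA : cB (x *m A) by rewrite /closed_unit_ball /= -/(sqnorm _) hA.
apply: cvg_comp (cu _ cxA) => P; rewrite /within /= => hP.
have h := @mulmxr_continuous R N A x _ hP.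
apply: (@filterS _ (nbhs x) _ _ _ _ h) => y hy cy; apply: hy.
by rewrite /closed_unit_ball /= -/(sqnorm _) hA.
Qed.

(** Write f(s) = (1 - s)^-2 and v = u o A, which solves the same equation, and let
    h be the truncation of w = u - v at level d. By stability_test the integral of
    (f(u) - f(v)) h is at least that of f'(u) h^2, whereas by convexity the
    integrand is at most f'(u) h^2 - 3 h^3, up to a multiple of d. Hence the
    integral of h^3 is of order d, and the limit d -> 0 excludes w > 0. *)
Lemma semi_stable_reflection lambda u (A : 'M[R]_N) : 0 < lambda ->
  smooth_solution lambda u -> semi_stable lambda u ->
  A^T *m A = 1%:M -> (forall z, sqnorm (z *m A) = sqnorm z) ->
  forall x, B x -> u x <= u (x *m A).
Proof.
move=> l0 [/smooth_onP Cu cu u01 eq u0] st AA hA.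
have mB := @measurable_unit_ball R N; have oB := @open_unit_ball R N.
have BA x : B x -> B (x *m A) by rewrite /unit_ball /= -![\sum_(i < N) _]/(sqnorm _) hA.
pose v x := u (x *m A); pose w x := u x - v x.
have bu : boundary_null u by split.
have bw : boundary_null w by exact: boundary_null_mulmxr.
have Cv k : Ck_on k B v by apply: Ck_on_mulmxr (Cu k).
have Cw k : Ck_on k B w by apply: Ck_onB.
have cuB x : B x -> {for x, continuous u} by move=> Bx; exact: Ck_on_continuous (Cu 0) Bx.
have u1 x : B x -> u x < 1 by move=> /u01 /andP[].
have [C C1 hC] := solution_inv_bounded cu u0 u1.
have lapw x : B x -> - laplacian w x = lambda * ((1 - u x) ^- 2 - (1 - v x) ^- 2).
  move=> Bx; have -> : laplacian w x = laplacian u x - laplacian v x.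
    rewrite /laplacian -sumrB; apply: eq_bigr => i _.
    apply: is_derive_partial.
    apply: (@near_eq_is_derive _ _ _ (fun y => partial i u y - partial i v y)).
      apply: filterS (open_nbhs_nbhs (conj oB Bx)) => y By.
      apply/esym; apply: is_derive_partial.
      apply: is_derive_subf; [exact: Ck_on_is_derive (Cu 1) By|exact: Ck_on_is_derive (Cv 1) By].
    apply: is_derive_subf.
      exact: Ck_on_is_derive (Ck_on_partial i (Cu 2)) Bx.
    exact: Ck_on_is_derive (Ck_on_partial i (Cv 2)) Bx.
  rewrite opprB addrC mulrBr -eq // (laplacian_mulmxr AA oB (Cu 2) (BA _ Bx)).
  by rewrite -[in RHS](eq _ (BA _ Bx)) opprK.
pose m := fine (mu B).
have main (d : R) : 0 < d ->
    3 * \int[mu]_(x in B) (cutoff d (w x) ^+ 3) <= 4 * C ^+ 3 * m * d /\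
    mu.-integrable B (EFin \o (fun x => cutoff d (w x) ^+ 3)).
  move=> d0; pose h x := cutoff d (w x).
  have Ch k : Ck_on k B h by exact: Ck_on_cutoff.
  have hz x : B x -> w x <= d -> h x = 0 by move=> _ ?; exact: cutoff_eq0.
  have ph i x : B x -> partial i h x = dcutoff d (w x) * partial i w x.
    move=> Bx; apply: partial_comp; first exact: is_derive_cutoff.
    exact: Ck_on_is_derive (Cw 1) Bx.
  have hab x : B x -> dcutoff d (w x) ^+ 2 <= dcutoff d (w x).
    by move=> _; rewrite expr2 ler_piMr ?dcutoff_ge0 ?dcutoff_le1.
  have [i1 i2 le12] := stability_test st cuB u1 d0 bw Cw Ch Ch hz hz ph ph hab.
  have w1 x : B x -> w x <= 1.
    move=> Bx; have /andP[_ ?] := u01 _ Bx; have /andP[? _] := u01 _ (BA _ Bx).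
    by rewrite /w /v; lra.
  have h01 x : B x -> 0 <= h x <= 1.
    move=> Bx; rewrite cutoff_ge0 /=; have [w0|w0] := leP 0 (w x).
      by apply: le_trans (cutoff_le d0 w0) (w1 _ Bx).
    by rewrite /h cutoff_eq0 // ltW // (lt_trans w0).
  have i3 : mu.-integrable B (EFin \o (fun x => h x ^+ 3)).
    apply: (@Rintegral_bounded_integrable _ 1).
      apply: continuous_measurable_rV => // x Bx.
      apply: (@continuous_comp _ _ _ h (fun y => y ^+ 3)); last exact: exprn_continuous.
      exact: Ck_on_continuous (Ch 0) Bx.
    move=> x Bx; have /andP[? ?] := h01 _ Bx.
    by rewrite ger0_norm ?exprn_ge0 // exprn_ile1.
  split => //.
  have pt x : B x -> - laplacian w x * h x <=
      lambda * (2 / (1 - u x) ^+ 3 * h x ^+ 2) + lambda * (4 * C ^+ 3 * d - 3 * h x ^+ 3).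
    move=> Bx; rewrite lapw // -[X in X <= _]mulrA -mulrDr ler_pM2l //.
    have /andP[h0 h1] := h01 _ Bx; have /andP[ux0 ux1] := u01 _ Bx.
    have /andP[vx0 vx1] := u01 _ (BA _ Bx); rewrite -/(v x) in vx0 vx1.
    have C3d : 0 <= 4 * C ^+ 3 * d.
      by rewrite !mulr_ge0 ?exprn_ge0 // ?(ltW d0) // (le_trans _ C1).
    have [wd|dw] := leP (w x) d.
      by rewrite hz // !(expr0n, mulr0) add0r subr0.
    have wx0 : 0 < w x by exact: lt_trans dw.
    have hw : h x <= w x by apply: cutoff_le => //; exact: ltW.
    have wh : w x - 2 * d <= h x by exact: cutoff_ge.
    (* f'(u) w h = f'(u) h^2 + f'(u) h (w - h), where f'(u) <= 2 C^3, h <= 1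
       and w - h <= 2 d. *)
    have cv : (1 - u x) ^- 2 - (1 - v x) ^- 2 <= 2 / (1 - u x) ^+ 3 * w x - 3 * w x ^+ 2.
      have -> : w x = (1 - v x) - (1 - u x) by rewrite /w; ring.
      by apply: inv_sqr_convex; move: wx0; rewrite /w => ?; lra.
    apply: le_trans (ler_wpM2r h0 cv) _.
    have inv3 : 2 / (1 - u x) ^+ 3 <= 2 * C ^+ 3.
      rewrite ler_pM2l // -exprVn; apply: lerXn2r; rewrite ?nnegrE.
      - by rewrite invr_ge0 subr_ge0 ltW.
      - by rewrite (le_trans _ C1).
      - exact: hC.
    have inv0 : 0 <= 2 / (1 - u x) ^+ 3 by rewrite divr_ge0 // exprn_ge0 // subr_ge0 ltW.
    set k := 2 / (1 - u x) ^+ 3 in inv3 inv0 *.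
    have hh : h x * (w x - h x) <= 2 * d.
      apply: (@le_trans _ _ (1 * (w x - h x))); last by rewrite mul1r; lra.
      by rewrite ler_wpM2r // subr_ge0.
    have e1 : k * (h x * (w x - h x)) <= 2 * C ^+ 3 * (2 * d).
      by apply: ler_pM => //; rewrite mulr_ge0 // subr_ge0.
    have e2 : h x ^+ 3 <= w x ^+ 2 * h x.
      by rewrite exprSr ler_wpM2r // lerXn2r // nnegrE // ltW.
    by rewrite mulrBl; lra.
  have mfin : \int[mu]_(x in B) (4 * C ^+ 3 * d) = 4 * C ^+ 3 * d * m.
    by rewrite Rintegral_cst.
  have icst : mu.-integrable B (EFin \o (fun=> 4 * C ^+ 3 * d)).
    apply: (@Rintegral_bounded_integrable _ (`|4 * C ^+ 3 * d|)) => //.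
  have i3' := integrableZl mB 3 i3.
  have i4 : mu.-integrable B (EFin \o (fun x => 4 * C ^+ 3 * d - 3 * h x ^+ 3)).
    exact: (integrableB mB icst i3').
  have i5 := integrableZl mB lambda i4; have i6 := integrableZl mB lambda i1.
  have : \int[mu]_(x in B) (- laplacian w x * h x) <=
      \int[mu]_(x in B) (lambda * (2 / (1 - u x) ^+ 3 * h x ^+ 2) + lambda * (4 * C ^+ 3 * d - 3 * h x ^+ 3)).
    apply: le_Rintegral => //; exact: (integrableD mB i6 i5).
  rewrite RintegralD // RintegralZl // RintegralZl // RintegralB // mfin RintegralZl // => hle.
  have := le_trans le12 hle; rewrite lerDl pmulr_rge0 // subr_ge0.
  by move=> le3; rewrite [leRHS]mulrAC.
move=> x0 Bx0; rewrite leNgt; apply/negP => ux0.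
(* For 2 d <= c the truncation of w is at least c on the open set U where
   w > 2 c, so the integral of its cube does not tend to 0 with d. *)
pose c := w x0 / 3.
have c0 : 0 < c by rewrite divr_gt0 // subr_gt0.
pose U := B `&` (w @^-1` [set y | 2 * c < y]).
have oU : open U.
  rewrite openE => x [Bx wx]; apply: filterI; first exact: open_nbhs_nbhs.
  have hw : nbhs (w x) [set y | 2 * c < y].
    by apply: open_nbhs_nbhs; split => //; exact: open_gt.
  exact: (Ck_on_continuous (Cw 0) Bx) hw.
have U0 : (0 < mu U)%E.
  apply: open_measure_gt0 => //; exists x0; split => //=.
  have -> : w x0 = 3 * c by rewrite /c mulrCA divff ?mulr1 // pnatr_eq0.
  by rewrite ltr_pM2r // ltr_nat.
have mU : measurable U by exact: open_measurable_rV.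
have Ufin : (mu U < +oo)%E.
  apply: le_lt_trans (@unit_ball_fin R N); apply: le_measure; rewrite ?inE //.
  by move=> x [].
pose mUr := fine (mu U).
have mUr0 : 0 < mUr by rewrite fine_gt0 // U0.
have low (d : R) : 0 < d -> 2 * d <= c -> c ^+ 3 * mUr <= \int[mu]_(x in B) (cutoff d (w x) ^+ 3).
  move=> d0 dc; have [_ i3] := main _ d0.
  rewrite -lee_fin -EFin_Rintegral // EFinM fineK ?ge0_fin_numE //.
  rewrite -integral_cst //.
  apply: (@le_trans _ _ (\int[mu]_(x in U) (cutoff d (w x) ^+ 3)%:E)%E).
    apply: ge0_le_integral => //.
    - by move=> x _; rewrite lee_fin exprn_ge0 // ltW.
    - by apply: measurable_funS mB _ (measurable_int _ i3) => x [].
    - move=> x [_ /= wx]; rewrite lee_fin lerXn2r // ?nnegrE ?cutoff_ge0 ?(ltW c0) //.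
      apply: le_trans (cutoff_ge (w x) d0); lra.
  apply: ge0_subset_integral => //.
  - exact: measurable_int i3.
  - by move=> x _; rewrite lee_fin exprn_ge0 // cutoff_ge0.
  - by move=> x [].
have C30 : 0 < 4 * C ^+ 3 * m + 1.
  have C0 : 0 <= C by apply: le_trans C1.
  by rewrite ltr_wpDl // !mulr_ge0 ?exprn_ge0 // ?fine_ge0.
pose d := Num.min (c / 2) (c ^+ 3 * mUr / (4 * C ^+ 3 * m + 1)).
have d0 : 0 < d by rewrite /d lt_min; apply/andP; split; apply: divr_gt0 => //; apply: mulr_gt0 => //; exact: exprn_gt0.
have dc : 2 * d <= c by rewrite mulrC -ler_pdivlMr // /d ge_min lexx.
have dd : d * (4 * C ^+ 3 * m + 1) <= c ^+ 3 * mUr.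
  by rewrite -ler_pdivlMr // /d ge_min lexx orbT.
have [h1 _] := main _ d0; have h2 := low _ d0 dc.
have : 0 < c ^+ 3 * mUr by rewrite mulr_gt0 // exprn_gt0.
by move: dd; rewrite mulrDr mulr1 [d * _]mulrC => ? ?; lra.
Qed.

(** Two points of the same norm are exchanged by a reflection, in either order. *)
Lemma semi_stable_radial lambda u x y : 0 < lambda ->
  smooth_solution lambda u -> semi_stable lambda u ->
  B x -> sqnorm x = sqnorm y -> u x = u y.
Proof.
move=> l0 su st Bx xy.
have By : B y by rewrite /unit_ball /= -/(sqnorm y) -xy.
apply/eqP; rewrite eq_le; apply/andP; split.
- have [A [AA xA hA]] := exists_reflection xy.
  by rewrite -xA; exact: semi_stable_reflection l0 su st AA hA x Bx.
- have [A [AA yA hA]] := exists_reflection (esym xy).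
  by rewrite -yA; exact: semi_stable_reflection l0 su st AA hA y By.
Qed.

End stability.

(** * The energy estimate *)

Section energy.
Context {R : realType} {N : nat}.
Implicit Types (f g w psi eta phi u h : 'rV[R]_N -> R) (D K : set 'rV[R]_N) (x v : 'rV[R]_N).
Local Notation mu := (lebRn (R := R) N).
Local Notation B := (unit_ball R N).
Local Notation cB := (@closed_unit_ball R N).

(** The right-hand side is the integrand of the stability inequality for
    (1 - s)^-t - 1 minus that of the equation tested with a primitive of the
    squared derivative of this function. With X = 1 - s and
    beta = (4 t + 2 - t^2) / (2 t + 1) it is at least
    beta X^-(2 t + 3) - 4 X^-(t + 3). Since beta A = 4, Young's inequality with
    exponents (2 t + 3) / (t + 3) and (2 t + 3) / t, applied to X^-(t + 3) A,
    absorbs the negative term. *)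
Lemma energy_pointwise (t s A : R) : 0 < t -> 0 < 4 * t + 2 - t ^+ 2 -> s < 1 ->
  A = 4 * (2 * t + 1) / (4 * t + 2 - t ^+ 2) ->
  (4 * t + 2 - t ^+ 2) / (2 * t + 1) * (t / (2 * t + 3)) *
    ((1 - s) `^ (- (2 * t + 3)) - A `^ ((2 * t + 3) / t)) <=
  2 / (1 - s) ^+ 3 * ((1 - s) `^ (- t) - 1) ^+ 2 -
  t ^+ 2 / (2 * t + 1) * ((1 - s) `^ (- (2 * t + 1)) - 1) / (1 - s) ^+ 2.
Proof.
move=> t0 b0 s1 eA.
have X0 : 0 < 1 - s by rewrite subr_gt0.
set X := 1 - s in X0 *.
have t21 : 0 < 2 * t + 1 by lra.
have t23 : 0 < 2 * t + 3 by lra.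
have t3 : 0 < t + 3 by lra.
have A0 : 0 < A by rewrite eA divr_gt0 // mulr_gt0.
have Xn0 : X != 0 by rewrite gt_eqF.
pose y := X `^ (- t); pose z := X^-1.
have z0 : 0 < z by rewrite invr_gt0.
have y0 : 0 < y by rewrite powR_gt0.
have eX1 : X `^ (-1) = z by rewrite powR_inv1 // ltW.
have eX3 : X `^ (- 3) = z ^+ 3 by rewrite powR_invn ?(ltW X0) // exprVn.
have eP : X `^ (- (2 * t + 3)) = z ^+ 3 * y ^+ 2.
  rewrite (_ : - (2 * t + 3) = - 3 + (- t + - t)); last by ring.
  by rewrite !powRD ?Xn0 ?implybT // eX3 expr2.
have eQ : X `^ (- (t + 3)) = z ^+ 3 * y.
  rewrite (_ : - (t + 3) = - 3 + - t); last by ring.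
  by rewrite !powRD ?Xn0 ?implybT // eX3.
have eS : X `^ (- (2 * t + 1)) = z * y ^+ 2.
  rewrite (_ : - (2 * t + 1) = -1 + (- t + - t)); last by ring.
  by rewrite !powRD ?Xn0 ?implybT // eX1 expr2.
pose p := (2 * t + 3) / (t + 3); pose q := (2 * t + 3) / t.
have := @conjugate_powR R (z ^+ 3 * y) A p q.
have -> : (z ^+ 3 * y) `^ p = z ^+ 3 * y ^+ 2.
  rewrite -eQ -eP -powRrM; congr (_ `^ _); rewrite /p; field; lra.
move=> /(_ _ _ _ _ _) young.
have {}young : z ^+ 3 * y * A <= z ^+ 3 * y ^+ 2 / p + A `^ q / q.
  apply: young.
  - by rewrite mulr_ge0 ?exprn_ge0 // ltW.
  - exact: ltW.
  - by rewrite /p divr_gt0.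
  - by rewrite /q divr_gt0.
  - by rewrite /p /q; field; rewrite !gt_eqF //; lra.
rewrite eP eS -/y -/q.
set E := A `^ q in young *.
set beta := (4 * t + 2 - t ^+ 2) / (2 * t + 1).
have beta0 : 0 < beta by rewrite divr_gt0.
have bA : beta * A = 4 by rewrite /beta eA; field; lra.
have ez3 : 2 / X ^+ 3 = 2 * z ^+ 3 by rewrite exprVn.
have ez2 : (X ^+ 2)^-1 = z ^+ 2 by rewrite exprVn.
rewrite ez3 ez2.
have h1 : 4 * (z ^+ 3 * y) <= beta * (z ^+ 3 * y ^+ 2 / p + E / q).
  by rewrite -bA -[X in X <= _]mulrA ler_pM2l // mulrC.
have pz : 0 <= t ^+ 2 / (2 * t + 1) * z ^+ 2 + 2 * z ^+ 3.
  have z20 := sqr_ge0 z; have z30 : 0 <= z ^+ 3 by rewrite exprn_ge0 // ltW.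
  have k0 : 0 <= t ^+ 2 / (2 * t + 1) by rewrite divr_ge0 ?sqr_ge0 // ltW.
  by apply: addr_ge0; apply: mulr_ge0.
have ip : p^-1 = 1 - t / (2 * t + 3) by rewrite /p; field; lra.
have iq : q^-1 = t / (2 * t + 3) by rewrite /q invf_div.
have bt : beta = 2 - t ^+ 2 / (2 * t + 1) by rewrite /beta; field; lra.
rewrite ip iq in h1.
set th := t / (2 * t + 3) in h1 *; set k := t ^+ 2 / (2 * t + 1) in bt pz *.
move: h1 pz; rewrite bt; set P3 := z ^+ 3; set y2 := y ^+ 2 => h1 pz.
have -> : 2 * P3 * (y - 1) ^+ 2 - k * (z * y2 - 1) * z ^+ 2 =
   (2 - k) * (P3 * y2) - 4 * (P3 * y) + (k * z ^+ 2 + 2 * P3).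
  by rewrite /P3 /y2; ring.
lra.
Qed.

(** Controls the effect of replacing u by its truncation in the test function. *)
Lemma pow1_lipschitz (t C c s : R) : 0 < t -> c <= s -> s < 1 -> 1 <= C ->
  (1 - s)^-1 <= C ->
  (1 - s) `^ (- t) - (1 - c) `^ (- t) <= t * C `^ (t + 1) * (s - c).
Proof.
move=> t0 cs s1 C1 hC.
have d (x : R) : x \in `]c, s[ -> is_derive x (1 : R) (fun s : R => (1 - s) `^ (- t)) (t * (1 - x) `^ (- t - 1)).
  rewrite in_itv /= => /andP[_ xs]; have := @is_derive_pow1 R (- t) x (lt_trans xs s1).
  by rewrite opprK.
have [|x] := @MVT_segment R (fun s : R => (1 - s) `^ (- t)) (fun x : R => t * (1 - x) `^ (- t - 1)) c s cs d.
  apply: continuous_in_subspaceT => z; rewrite inE /= in_itv /= => /andP[_ zs].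
  exact: is_derive1_continuous (@is_derive_pow1 R (- t) z (le_lt_trans zs s1)).
rewrite in_itv /= => /andP[_ xs] ->; rewrite ler_wpM2r ?subr_ge0 // ler_pM2l //.
have x1 : 0 < 1 - x by lra.
rewrite -opprD powRN -powR_inv1 ?powR_ge0 // -powRrM mulrC powRrM powR_inv1 ?(ltW x1) //.
rewrite ge0_ler_powR ?nnegrE ?invr_ge0 ?(ltW x1) //; first by lra.
  by lra.
apply: le_trans hC; rewrite lef_pV2 ?posrE; lra.
Qed.

Lemma ler_powRN (p q e : R) : 0 <= e -> 0 < p -> p <= q -> q `^ (- e) <= p `^ (- e).
Proof.
move=> e0 p0 pq; have q0 : 0 < q by exact: lt_le_trans pq.
rewrite !powRN lef_pV2 ?posrE ?powR_gt0 //.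
by rewrite ge0_ler_powR ?nnegrE // ltW.
Qed.

(** The pointwise inequality is integrated. The test functions are those of
    energy_pointwise with u replaced by its truncation c at level d, so that they
    have compact support; the constants do not depend on d, and d tends to 0. *)
Lemma energy_estimate lambda u (t : R) : 0 < lambda -> 0 < t ->
  0 < 4 * t + 2 - t ^+ 2 ->
  smooth_solution lambda u -> semi_stable lambda u ->
  mu.-integrable B (EFin \o (fun x => (1 - u x) `^ (- (2 * t + 3)))) /\
  \int[mu]_(x in B) ((1 - u x) `^ (- (2 * t + 3))) <=
  (4 * (2 * t + 1) / (4 * t + 2 - t ^+ 2)) `^ ((2 * t + 3) / t) * fine (mu B).
Proof.
move=> l0 t0 b0 [/smooth_onP Cu cu u01 eq u0] st.
have mB := @measurable_unit_ball R N; have oB := @open_unit_ball R N.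
have bu : boundary_null u by split.
have cuB x : B x -> {for x, continuous u} by move=> Bx; exact: Ck_on_continuous (Cu 0) Bx.
have u1 x : B x -> u x < 1 by move=> /u01 /andP[].
have ug0 x : B x -> 0 <= u x by move=> /u01 /andP[].
have [C C1 hC] := solution_inv_bounded cu u0 u1.
have C0 : 0 <= C by apply: le_trans C1.
have t21 : 0 < 2 * t + 1 by lra.
have t23 : 0 < 2 * t + 3 by lra.
set A := _ / _; set E := A `^ _.
have Cpow (a : R) k w : Ck_on k B w -> (forall x, B x -> w x < 1) -> Ck_on k B (fun x => (1 - w x) `^ a).
  move=> Cw w1; have := Ck_on_comp 0 oB (pow1_smooth a) Cw w1.
  by rewrite pow1_family0.
have bpow (a : R) x : 0 <= a -> B x -> 0 <= (1 - u x) `^ (- a) <= C `^ a.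
  move=> a0 Bx; rewrite powR_ge0 /=; have ux1 : 0 < 1 - u x by rewrite subr_gt0 u1.
  rewrite powRN -powR_inv1 ?powR_ge0 // -powRrM mulrC powRrM powR_inv1 ?(ltW ux1) //.
  by rewrite ge0_ler_powR ?nnegrE ?invr_ge0 ?(ltW ux1) // hC.
have ipow (a : R) : 0 <= a -> mu.-integrable B (EFin \o (fun x => (1 - u x) `^ (- a))).
  move=> a0; apply: (@Rintegral_bounded_integrable _ _ _ (C `^ a)).
    apply: continuous_measurable_rV => // x Bx.
    exact: Ck_on_continuous (Cpow _ 0 _ (Cu 0) u1) Bx.
  by move=> x Bx; have /andP[h1 h2] := bpow a x a0 Bx; rewrite ger0_norm.
have iP : mu.-integrable B (EFin \o (fun x => (1 - u x) `^ (- (2 * t + 3)))) by exact: ipow (ltW _).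
split => //.
set m := fine (mu B).
pose beta := (4 * t + 2 - t ^+ 2) / (2 * t + 1) * (t / (2 * t + 3)).
have beta0 : 0 < beta by rewrite !mulr_gt0 ?invr_gt0.
(* Bounds the loss in f'(u) h1^2 caused by the truncation, per unit of d. *)
pose Kc := 8 * C ^+ 3 * C `^ t * (t * C `^ (t + 1)).
have Kc0 : 0 <= Kc by rewrite !mulr_ge0 ?powR_ge0 ?exprn_ge0 // ltW.
suff main (d : R) : 0 < d -> beta * (\int[mu]_(x in B) ((1 - u x) `^ (- (2 * t + 3))) - E * m) <= Kc * m * d.
  rewrite -subr_le0 -(pmulr_rle0 _ beta0).
  apply: (@ler_add_small _ _ _ (Kc * m)) => a /andP[a0 _].
  by rewrite add0r; exact: main.
move=> d0; pose c x := cutoff d (u x).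
have cu' x : B x -> 0 <= c x <= u x.
  by move=> Bx; rewrite cutoff_ge0 cutoff_le // ug0.
have c1 x : B x -> c x < 1 by move=> Bx; have /andP[_ /le_lt_trans] := cu' _ Bx; apply; exact: u1.
have Cc k : Ck_on k B c by exact: Ck_on_cutoff.
pose h1 x := (1 - c x) `^ (- t) - 1.
pose h2 x := t ^+ 2 / (2 * t + 1) * ((1 - c x) `^ (- (2 * t + 1)) - 1).
have Ch1 k : Ck_on k B h1.
  by apply: (Ck_onB oB (Cpow _ _ _ (Cc k) c1)); exact: Ck_on_cst.
have Ch2 k : Ck_on k B h2.
  apply: Ck_on_scale => //; apply: (Ck_onB oB (Cpow _ _ _ (Cc k) c1)); exact: Ck_on_cst.
have z1 x : B x -> u x <= d -> h1 x = 0.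
  by move=> _ ud; rewrite /h1 /c cutoff_eq0 // subr0 powR1 subrr.
have z2 x : B x -> u x <= d -> h2 x = 0.
  by move=> _ ud; rewrite /h2 /c cutoff_eq0 // subr0 powR1 subrr mulr0.
pose a x := t * (1 - c x) `^ (- t - 1) * dcutoff d (u x).
pose b x := t ^+ 2 * (1 - c x) `^ (- (2 * t + 1) - 1) * dcutoff d (u x).
have dc i x : B x -> is_derive x (delta_mx ord0 i) c (dcutoff d (u x) * partial i u x).
  move=> Bx; apply: is_derive_comp_real; first exact: is_derive_cutoff.
  exact: Ck_on_is_derive (Cu 1) Bx.
have p1 i x : B x -> partial i h1 x = a x * partial i u x.
  move=> Bx; apply: is_derive_partial.
  have h := is_derive_comp_real (is_derive_pow1 (- t) (c1 _ Bx)) (dc i x Bx).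
  apply: is_derive_eq (is_derive_subf h (is_derive_cst (1 : R) x _)) _.
  by rewrite /a; ring.
have p2 i x : B x -> partial i h2 x = b x * partial i u x.
  move=> Bx; apply: is_derive_partial.
  have h := is_derive_comp_real (is_derive_pow1 (- (2 * t + 1)) (c1 _ Bx)) (dc i x Bx).
  apply: is_derive_eq (is_derive_scalef _ (is_derive_subf h (is_derive_cst (1 : R) x _))) _.
  by rewrite /b; field; lra.
(* a^2 = b but for the slope of the truncation, which enters a squared and
   lies in [0, 1]. *)
have ab x : B x -> a x ^+ 2 <= b x.
  move=> Bx; rewrite /a /b; have cx : 1 - c x != 0 by rewrite gt_eqF // subr_gt0 c1.
  have -> : (1 - c x) `^ (- (2 * t + 1) - 1) = ((1 - c x) `^ (- t - 1)) ^+ 2.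
    rewrite (_ : - (2 * t + 1) - 1 = (- t - 1) + (- t - 1)); last by ring.
    by rewrite powRD ?cx ?implybT // expr2.
  rewrite exprMn exprMn.
  apply: ler_wpM2l; first by rewrite mulr_ge0 ?sqr_ge0.
  by rewrite expr2 ler_piMr ?dcutoff_ge0 ?dcutoff_le1.
have [i1 i2 le12] := stability_test st cuB u1 d0 bu Cu Ch1 Ch2 z1 z2 p1 p2 ab.
have iE : mu.-integrable B (EFin \o (fun=> E)).
  by apply: (@Rintegral_bounded_integrable _ _ _ (`|E|)).
have iK : mu.-integrable B (EFin \o (fun=> Kc * d)).
  by apply: (@Rintegral_bounded_integrable _ _ _ (`|Kc * d|)).
have i3 : mu.-integrable B (EFin \o (fun x => beta * ((1 - u x) `^ (- (2 * t + 3)) - E))).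
  exact: (integrableZl mB beta (integrableB mB iP iE)).
have i4 := integrableZl mB lambda (integrableB mB i3 iK).
have i5 := integrableZl mB lambda i1.
have pt x : B x -> lambda * (beta * ((1 - u x) `^ (- (2 * t + 3)) - E) - Kc * d) <=
    lambda * (2 / (1 - u x) ^+ 3 * h1 x ^+ 2) - (- laplacian u x * h2 x).
  move=> Bx; rewrite eq //.
  have -> : lambda / (1 - u x) ^+ 2 * h2 x = lambda * (h2 x / (1 - u x) ^+ 2) by ring.
  rewrite -mulrBr ler_pM2l //.
  have /andP[cx0 cxu] := cu' _ Bx; have ux1 := u1 _ Bx.
  have X0 : 0 < 1 - u x by rewrite subr_gt0.
  have hp := energy_pointwise t0 b0 ux1 (erefl A); rewrite -/E -/beta in hp.
  have k1 := pow1_lipschitz t0 cxu ux1 C1 (hC _ Bx).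
  have k2 : u x - c x <= 2 * d by rewrite lerBlDr -lerBlDl; exact: cutoff_ge.
  have tC0 : 0 <= t * C `^ (t + 1) by rewrite mulr_ge0 ?powR_ge0 // ltW.
  have cxX : 1 - u x <= 1 - c x by rewrite lerD2l lerN2.
  have mono (e : R) : 0 <= e -> (1 - c x) `^ (- e) <= (1 - u x) `^ (- e).
    by move=> e0; exact: ler_powRN.
  have mt := mono t (ltW t0).
  have one : 1 <= (1 - c x) `^ (- t).
    have := @ler_powRN (1 - c x) 1 t (ltW t0); rewrite powR1; apply.
      exact: lt_le_trans cxX.
    by rewrite gerBl.
  have [_ bt] := andP (bpow t x (ltW t0) Bx).
  have e2 : h2 x / (1 - u x) ^+ 2 <= t ^+ 2 / (2 * t + 1) * ((1 - u x) `^ (- (2 * t + 1)) - 1) / (1 - u x) ^+ 2.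
    rewrite ler_pM2r ?invr_gt0 ?exprn_gt0 // ler_wpM2l //.
      by rewrite divr_ge0 ?sqr_ge0 // ltW.
    by rewrite lerD2r mono // ltW.
  have inv0 : 0 <= 2 / (1 - u x) ^+ 3 by rewrite divr_ge0 // exprn_ge0 // ltW.
  have inv3 : 2 / (1 - u x) ^+ 3 <= 2 * C ^+ 3.
    rewrite ler_pM2l // -exprVn; apply: lerXn2r; rewrite ?nnegrE ?invr_ge0 ?(ltW X0) //.
    exact: hC.
  have e1 : ((1 - u x) `^ (- t) - 1) ^+ 2 - h1 x ^+ 2 <= 2 * C `^ t * (t * C `^ (t + 1) * (2 * d)).
    rewrite subr_sqr mulrC /h1; apply: ler_pM.
    - by rewrite addr_ge0 // subr_ge0 // (le_trans one).
    - by rewrite opprB addrA subrK subr_ge0.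
    - rewrite mulr_natl mulr2n; apply: lerD; rewrite lerBlDr.
        by rewrite (le_trans bt) // lerDl.
      by rewrite (le_trans mt) // (le_trans bt) // lerDl.
    - rewrite opprB addrA subrK; apply: le_trans k1 _; exact: ler_wpM2l.
  have e3 : 2 / (1 - u x) ^+ 3 * (((1 - u x) `^ (- t) - 1) ^+ 2 - h1 x ^+ 2) <= Kc * d.
    have sq0 : 0 <= ((1 - u x) `^ (- t) - 1) ^+ 2 - h1 x ^+ 2.
      rewrite subr_ge0 lerXn2r ?nnegrE /h1 ?subr_ge0 ?lerD2r //.
      exact: le_trans one mt.
    apply: le_trans (ler_pM inv0 sq0 inv3 e1) _.
    by rewrite le_eqVlt; apply/orP; left; apply/eqP; rewrite /Kc; ring.
  rewrite mulrBr in e3.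
  lra.
have := @le_Rintegral _ _ _ mu B _ _ mB i4 (integrableB mB i5 i2) pt.
rewrite RintegralZl //; last exact: (integrableB mB i3 iK).
rewrite RintegralB // RintegralZl //; last exact: (integrableB mB iP iE).
rewrite RintegralB // !Rintegral_cst // -/m RintegralB // RintegralZl // => hle.
have : lambda * (beta * (\int[mu]_(x in B) (1 - u x) `^ (- (2 * t + 3)) - E * m) - Kc * d * m) <= 0.
  by apply: le_trans hle _; rewrite subr_le0.
by rewrite pmulr_rle0 // subr_le0 [Kc * m * d]mulrAC.
Qed.

End energy.

(** * Scaling of the Lebesgue measure and polar coordinates *)

Local Notation push_measure m mf :=
  (measure_function_pushforward__canonical__measure_function_Measure m mf).

Section scaling.
Context {R : realType}.
Local Notation leb := (@lebesgue_measure R).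

Lemma measurable_mulr (r : R) : measurable_fun [set: measurableTypeR R] (fun x : measurableTypeR R => r * x : measurableTypeR R).
Proof. by apply: measurable_funM; [exact: measurable_cst|exact: measurable_id]. Qed.

Lemma lebesgue_scale (r : R) (A : set (measurableTypeR R)) : 0 < r -> measurable A ->
  leb A = (r%:E * leb ((fun x => (r * x)%R) @^-1` A))%E.
Proof.
move=> r0 mA; pose r' : {nonneg R} := NngNum (ltW r0).
rewrite (@lebesgue_measure_unique _ (mscale r' (push_measure leb (measurable_mulr r)))) //.
move=> _ [[a b] /= _ <-].
have e : ((fun x : R => r * x) @^-1` [set` `]a, b]%R]) = [set` `](a / r), (b / r)]%R].
  by apply/seteqP; split=> x /=; rewrite !in_itv /= ltr_pdivrMr // ler_pdivlMr // [x * r]mulrC.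
rewrite -[RHS]/((r%:E * leb ((fun x : R => r * x)%R @^-1` [set` `]a, b]%R]))%E) e.
rewrite !lebesgue_measure_itv /= !lte_fin ltr_pM2r ?invr_gt0 //.
case: ifPn => ab; last by rewrite mule0.
by rewrite -!EFinD -EFinM -mulrBl mulrC divfK // gt_eqF.
Qed.

Lemma measurable_scale_rV n (r : R) : measurable_fun setT (fun x : 'rV[R]_n => r *: x).
Proof.
apply: measurable_fun_rVP => i.
rewrite (_ : (fun t => _) = (fun x : 'rV[R]_n => r * rV_coor i x)).
  by apply: measurable_funM; [exact: measurable_cst|exact: measurable_rV_coor].
by apply/funext => x; rewrite mxE.
Qed.

(** On rectangles the scaled product measure is the product of the scaled
    factors, and a product measure is determined by its values there. *)
Lemma lebRn_scale n (r : R) (A : set 'rV[R]_n) : 0 < r -> measurable A ->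
  lebRn n A = ((r ^+ n)%:E * lebRn n ((fun x => r *: x) @^-1` A))%E.
Proof.
move=> r0; elim: n A => [|n ih] A mA.
  rewrite expr0 mul1e; congr (lebRn 0 _).
  by apply/funext => x; rewrite /preimage /= (_ : r *: x = x) //; apply/rowP; case.
have mcA : measurable (@rV_cons R n @^-1` A).
  by rewrite -[X in measurable X]setTI; exact: measurable_rV_cons.
pose H (p : measurableTypeR R * 'rV[R]_n) : measurableTypeR R * 'rV[R]_n := (r * p.1, r *: p.2).
have mH : measurable_fun setT H.
  apply: measurable_fun_pair.
    exact: measurableT_comp (measurable_mulr r) measurable_fst.
  exact: measurableT_comp (@measurable_scale_rV n r) measurable_snd.
pose r' : {nonneg R} := NngNum (ltW (exprn_gt0 n.+1 r0)).
rewrite /= /leb_step /pushforward.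
rewrite (@product_measure_unique _ _ _ _ R leb (lebRn n)
  (mscale r' (push_measure (leb \x lebRn n)%E mH))) //.
  rewrite /mscale /pushforward /=; congr (_ * _)%E; congr ((leb \x lebRn n)%E _).
  apply/funext => -[a v]; rewrite /preimage /mkset /H /=; congr A.
  apply/rowP => i; rewrite !mxE /=.
  by case: (unliftP ord0 i) => [j _|_]; rewrite ?mxE.
move=> A1 A2 mA1 mA2.
have e : H @^-1` (A1 `*` A2) = ((fun x => r * x) @^-1` A1) `*` ((fun x => r *: x) @^-1` A2) by [].
rewrite -[LHS]/((r ^+ n.+1)%:E * (leb \x lebRn n) (H @^-1` (A1 `*` A2)))%E e.
have mB1 : measurable ((fun x : measurableTypeR R => r * x : measurableTypeR R) @^-1` A1).
  by rewrite -[X in measurable X]setTI; exact: measurable_mulr.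
have mB2 : measurable ((fun x : 'rV[R]_n => r *: x) @^-1` A2).
  by rewrite -[X in measurable X]setTI; exact: measurable_scale_rV.
rewrite (product_measure1E leb (lebRn n) mB1 mB2).
rewrite exprS EFinM muleACA.
by apply: f_equal2; apply: esym; [exact: lebesgue_scale|exact: ih].
Qed.

End scaling.

Section polar.
Context {R : realType} {N : nat}.
Local Notation leb := (@lebesgue_measure R).
Local Notation mu := (lebRn (R := R) N).
Local Notation B := (unit_ball R N).
Local Notation m := (fine (mu B)).

(** The Euclidean norm; the norm that row vectors carry is the maximum norm. *)
Definition rnorm (x : 'rV[R]_N) : R := Num.sqrt (sqnorm x).

Definition rball (r : R) := [set x : 'rV[R]_N | rnorm x < r].

Lemma rnorm_ge0 x : 0 <= rnorm x. Proof. exact: sqrtr_ge0. Qed.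

Lemma rballE r : 0 <= r -> rball r = @sqnorm R N @^-1` [set y | y < r ^+ 2].
Proof.
move=> r0; rewrite /rball; apply/funext => x; rewrite /preimage /=.
by rewrite -(@ltr_pXn2r _ 2 _ (rnorm x) r) ?nnegrE ?rnorm_ge0 // sqr_sqrtr // sqnorm_ge0.
Qed.

Lemma rball1 : rball 1 = B.
Proof. by rewrite rballE // expr1n. Qed.

Lemma measurable_rball r : measurable (rball r).
Proof.
have [r0|r0] := leP 0 r.
  rewrite rballE //; apply: open_measurable_rV; apply: open_comp; last exact: open_lt.
  by move=> x _; exact: sqnorm_continuous.
rewrite (_ : rball r = set0) //; apply/seteqP; split => // x; rewrite /rball /=.
by rewrite ltNge (le_trans (ltW r0)) // rnorm_ge0.
Qed.

Lemma lebRn_rball r : 0 < r -> mu (rball r) = ((r ^+ N)%:E * mu B)%E.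
Proof.
move=> r0; rewrite (lebRn_scale r0 (measurable_rball r)); congr (_ * mu _)%E.
apply/seteqP; split => x; rewrite rballE ?(ltW r0) // /unit_ball /= -/(sqnorm x);
  rewrite (_ : sqnorm (r *: x) = r ^+ 2 * sqnorm x) ?gtr_pMr ?exprn_gt0 //.
- by rewrite /sqnorm mulr_sumr; apply: eq_bigr => i _; rewrite mxE exprMn.
- by rewrite /sqnorm mulr_sumr; apply: eq_bigr => i _; rewrite mxE exprMn.
Qed.

Lemma rball_fin r : 0 <= r -> (mu (rball r) < +oo)%E.
Proof.
move=> r0; apply: (@le_lt_trans _ _ (mu (rball (r + 1)))).
  apply: le_measure; rewrite ?inE; [exact: measurable_rball|exact: measurable_rball|].
  by move=> x; rewrite /rball /= => /lt_trans; apply; rewrite ltrDl.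
rewrite lebRn_rball ?ltr_wpDl // lte_mul_pinfty ?lee_fin ?exprn_ge0 ?addr_ge0 //.
exact: unit_ball_fin.
Qed.

Lemma annulus_measure r s : (0 < N)%N -> 0 <= r <= s ->
  mu (rball s `\` rball r) = ((s ^+ N - r ^+ N) * m)%:E.
Proof.
move=> N0 /andP[r0 rs].
have rb q : 0 <= q -> mu (rball q) = (q ^+ N * m)%:E.
  rewrite le_eqVlt => /orP[/eqP <-|q0].
    rewrite expr0n eqn0Ngt N0 /= mul0r (_ : rball 0 = set0) ?measure0 //.
    by apply/seteqP; split => // x; rewrite /rball /= ltNge rnorm_ge0.
  rewrite lebRn_rball // EFinM fineK // ge0_fin_numE //; exact: unit_ball_fin.
rewrite measureD; last 3 first.
- exact: measurable_rball.
- exact: measurable_rball.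
- by apply: rball_fin; exact: le_trans rs.
have -> : rball s `&` rball r = rball r.
  by apply/setIidPr => x; rewrite /rball /= => /lt_le_trans; apply.
by rewrite mulrBl EFinB -(rb _ r0) -(rb _ (le_trans r0 rs)).
Qed.

(** Over a partition of [0, 1] into n equal intervals the bounds on the increments
    of D telescope to K (G 0 - G 1) / n. *)
Lemma partition_le (D G : R -> R) (K : R) : 0 <= K ->
  (forall r s, 0 <= r -> r <= s -> s <= 1 -> D s - D r <= (G r - G s) * (K * (s - r))) ->
  G 1 <= G 0 -> D 0 <= 0 -> D 1 <= 0.
Proof.
move=> K0 h G01 D0.
apply: (@ler_add_small _ _ _ (K * (G 0 - G 1))) => a /andP[a0 _]; rewrite add0r.
have [n na] : exists n : nat, a^-1 < n.+1%:R.
  exists (Num.truncn a^-1); exact: truncnS_gt.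
have n0 : 0 < n.+1%:R :> R by [].
have main k : (k <= n.+1)%N -> D (k%:R / n.+1%:R) <= (G 0 - G (k%:R / n.+1%:R)) * (K / n.+1%:R).
  elim: k => [|k ih] kn; first by rewrite mul0r subrr mul0r.
  have {}ih := ih (ltnW kn).
  have := h (k%:R / n.+1%:R) (k.+1%:R / n.+1%:R).
  rewrite (_ : k.+1%:R / _ - k%:R / _ = n.+1%:R^-1); last first.
    by rewrite -mulrBl -natrB // subSnn mul1r.
  rewrite divr_ge0 // ler_pM2r ?invr_gt0 // ler_nat leqnSn ler_pdivrMr // mul1r ler_nat.
  move=> /(_ isT isT kn); move: ih; rewrite lerBlDr.
  set v := K / _; set r := k%:R / _; set s := _ / _ => ih /le_trans; apply.
  apply: le_trans (lerD (lexx _) ih) _.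
  by rewrite -mulrDl addrC subrKA.
have := main n.+1 (leqnn _); rewrite divff ?gt_eqF // => /le_trans; apply.
rewrite mulrA [K * _]mulrC ler_wpM2l ?mulr_ge0 ?subr_ge0 //.
by rewrite -[leRHS]invrK lef_pV2 ?posrE ?invr_gt0 // ltW.
Qed.

End polar.

Section polar_integral.
Context {R : realType}.
Local Notation leb := (@lebesgue_measure R).

Lemma ler_exprn_sub n (r s : R) : 0 <= r -> r <= s -> s <= 1 ->
  s ^+ n - r ^+ n <= n%:R * (s - r).
Proof.
move=> r0 rs s1; have s0 := le_trans r0 rs.
elim: n => [|n ih]; first by rewrite !expr0 subrr mul0r.
have -> : s ^+ n.+1 - r ^+ n.+1 = s * (s ^+ n - r ^+ n) + (s - r) * r ^+ n.
  by rewrite !exprS; ring.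
rewrite -natr1 [leRHS]mulrDl mul1r lerD //; last first.
  by rewrite ler_piMr ?subr_ge0 // exprn_ile1 // (le_trans rs).
apply: le_trans ih; rewrite ler_piMl // subr_ge0 lerXn2r // nnegrE.
Qed.

Lemma itv_bounded_integrable (r s : R) (f : R -> R) (C : R) : 0 <= r -> s <= 1 ->
  measurable_fun `[r, s[ f -> (forall x, r <= x < s -> `|f x| <= C) ->
  leb.-integrable `[r, s[ (EFin \o f).
Proof.
move=> r0 s1 mf fC; apply: measurable_bounded_integrable => //.
  by rewrite /= lebesgue_measure_itv /=; case: ifP => _; rewrite ltry.
exists C; split; [exact: num_real|move=> C' hC' x /=].
rewrite in_itv /= => xrs; exact: le_trans (fC _ xrs) (ltW hC').
Qed.

Lemma continuous_measurable_itv (i : interval R) (f : R -> R) :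
  continuous f -> measurable_fun [set` i] f.
Proof. by move=> cf; apply: measurable_funTS; exact: continuous_measurable_fun. Qed.

Lemma monomial_continuous (a : R) n : continuous (fun x : R => a * x ^+ n).
Proof.
by move=> x; apply: cvgM; [exact: cvg_cst|exact: exprn_continuous].
Qed.

Lemma Rintegral_exprn n (r s : R) : 0 <= r -> r <= s -> s <= 1 ->
  \int[leb]_(x in `[r, s[) (n.+1%:R * x ^+ n) = s ^+ n.+1 - r ^+ n.+1.
Proof.
move=> r0; rewrite le_eqVlt => /orP[/eqP <- _|rs s1].
  by rewrite set_itvco0 // Rintegral_set0 subrr.
have cf := @monomial_continuous n.+1%:R n.
rewrite Rintegral_itv_bndo_bndc; last first.
  apply: (@itv_bounded_integrable _ _ _ n.+1%:R) => //.
    exact: continuous_measurable_itv.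
  move=> x /andP[rx xs]; have x0 : 0 <= x by exact: le_trans rx.
  rewrite ger0_norm ?mulr_ge0 ?exprn_ge0 // ler_piMr // exprn_ile1 //.
  by rewrite ltW // (lt_le_trans xs).
have d (x : R) : is_derive x (1 : R) (fun x => x ^+ n.+1) (n.+1%:R * x ^+ n).
  apply: DeriveDef; first exact: exprn_derivable.
  by rewrite exp_derive [_ *: 1]mulr1.
rewrite /Rintegral (@continuous_FTC2 _ _ (fun x => x ^+ n.+1) r s rs) //.
- exact: continuous_subspaceT.
- have cF (x : R) : {for x, continuous (fun x : R => x ^+ n.+1)} by exact: exprn_continuous.
  split.
  + by move=> x _; have [] := d x.
  + by apply: cvg_at_right_filter; exact: cF.
  + by apply: cvg_at_left_filter; exact: cF.
- by move=> x _; rewrite derive1E; have [_] := d x.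
Qed.

(** For nonincreasing G this half of the integration formula in polar coordinates
    is obtained without a change of variables. On the annulus r <= |x| < s the
    values of G lie between G s and G r, and the measures of both integrals give
    it the mass m (s^N - r^N), where m is that of the ball. Hence the difference
    of the two integrals over the ball of radius r, as a function of r, satisfies
    the hypothesis of partition_le. *)
Lemma polar_le N (G : R -> R) : (0 < N)%N ->
  (forall r s, 0 <= r -> r <= s -> s <= 1 -> G s <= G r) -> 0 <= G 1 ->
  measurable_fun (`[0, 1[%classic : set R) G ->
  measurable_fun (unit_ball R N) (fun x => G (rnorm x)) ->
  fine (lebRn N (unit_ball R N)) *
    \int[leb]_(r in `[0, 1[) (N%:R * r ^+ N.-1 * G r) <=
  \int[lebRn N]_(x in unit_ball R N) G (rnorm x).
Proof.
case: N => // n _ monoG G1 mG mGr.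
set B := unit_ball R n.+1; set mu := lebRn n.+1; set m := fine _.
have m0 : 0 <= m by rewrite fine_ge0.
pose w (x : R) := n.+1%:R * x ^+ n * G x.
have Gb x : 0 <= x <= 1 -> 0 <= G x <= G 0.
  by move=> /andP[x0 x1]; rewrite (le_trans G1) ?monoG.
have cf := @monomial_continuous n.+1%:R n.
have iw : leb.-integrable (`[0, 1[%classic : set R) (EFin \o w).
  apply: (@itv_bounded_integrable _ _ _ (n.+1%:R * G 0)) => //.
    by apply: measurable_funM => //; exact: continuous_measurable_itv.
  move=> x /andP[x0 x1]; have /andP[h1 h2] : 0 <= G x <= G 0 by rewrite Gb // x0 ltW.
  rewrite ger0_norm ?mulr_ge0 ?exprn_ge0 // ler_pM ?mulr_ge0 ?exprn_ge0 //.
  by rewrite ler_piMr // exprn_ile1 // ltW.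
have iGr : mu.-integrable B (EFin \o (fun x => G (rnorm x))).
  apply: (@Rintegral_bounded_integrable _ _ _ (G 0)) => // x.
  rewrite -rball1 /rball /= => x1; have /andP[h1 h2] : 0 <= G (rnorm x) <= G 0.
    by rewrite Gb // rnorm_ge0 ltW.
  by rewrite ger0_norm.
(* m J - I is the function to which partition_le applies; hJ and hI below
   bound its increments. *)
pose J r := \int[leb]_(x in `[0, r[) w x.
pose I r := \int[mu]_(x in rball r) G (rnorm x).
suff : m * J 1 - I 1 <= 0 by rewrite subr_le0 /J /I rball1.
apply: (@partition_le _ (fun r => m * J r - I r) G (m * n.+1%:R)); last 2 first.
- exact: monoG.
- rewrite /J set_itvco0 // Rintegral_set0 mulr0 /I.
  rewrite (_ : rball 0 = set0) ?Rintegral_set0 ?subrr //.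
  by apply/seteqP; split => // x; rewrite /rball /= ltNge rnorm_ge0.
- by rewrite mulr_ge0.
move=> r s r0 rs s1; have s0 := le_trans r0 rs.
have rball_sub p q : p <= q -> rball p `<=` @rball R n.+1 q.
  by move=> pq x; rewrite /rball /= => /lt_le_trans; apply.
have sB : rball s `<=` B by rewrite /B -rball1; exact: rball_sub.
have eJ : J s = J r + \int[leb]_(x in `[r, s[) w x.
  rewrite /J -Rintegral_setU //.
  - by rewrite -itv_bndbnd_setU ?bnd_simp.
  - apply: (integrableS _ _ _ iw) => //.
      exact: measurableU.
    by move=> x /= [] ; rewrite !in_itv /= => /andP[h1 h2]; apply/andP; split; lra.
  - by apply/disj_setPS => x /= []; rewrite !in_itv /= => /andP[_ h1] /andP[h2 _]; lra.
have mAn : measurable (rball s `\` @rball R n.+1 r).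
  by apply: measurableD; exact: measurable_rball.
have eI : I s = I r + \int[mu]_(x in rball s `\` rball r) G (rnorm x).
  rewrite /I -Rintegral_setU //.
  - by rewrite setDUK //; exact: rball_sub.
  - exact: measurable_rball.
  - rewrite setDUK //; last exact: rball_sub.
    by apply: (integrableS _ _ _ iGr) => //; [exact: measurable_unit_ball|exact: measurable_rball].
  - by apply/disj_setPS => x [h1 [_ h2]].
have [Gs0 _] := andP (Gb s (introT andP (conj s0 s1))).
have hJ : \int[leb]_(x in `[r, s[) w x <= G r * (s ^+ n.+1 - r ^+ n.+1).
  have ie : leb.-integrable `[r, s[ (EFin \o (fun x : R => n.+1%:R * x ^+ n)).
    apply: (@itv_bounded_integrable _ _ _ n.+1%:R) => //.
      exact: continuous_measurable_itv.
    move=> x /andP[rx xs]; have x0 : 0 <= x by exact: le_trans rx.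
    rewrite ger0_norm ?mulr_ge0 ?exprn_ge0 // ler_piMr // exprn_ile1 //.
    by rewrite ltW // (lt_le_trans xs).
  rewrite -Rintegral_exprn // -RintegralZl //; apply: le_Rintegral => //.
  - apply: (integrableS _ _ _ iw) => // x /=; rewrite !in_itv /= => /andP[h1 h2].
    by apply/andP; split; lra.
  - apply: (@itv_bounded_integrable _ _ _ (`|G r| * n.+1%:R)) => //.
      by apply: measurable_funM => //; exact: continuous_measurable_itv.
    move=> x /andP[rx xs]; have x0 : 0 <= x by exact: le_trans rx.
    rewrite normrM ler_wpM2l // ger0_norm ?mulr_ge0 ?exprn_ge0 //.
    by rewrite ler_piMr // exprn_ile1 // ltW // (lt_le_trans xs).
  - move=> x /=; rewrite in_itv /= => /andP[rx xs].
    have x0 : 0 <= x by exact: le_trans rx.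
    rewrite /w [leRHS]mulrC; apply: ler_wpM2l; first by rewrite mulr_ge0 ?exprn_ge0.
    by apply: monoG => //; exact: le_trans (ltW xs) s1.
have hI : G s * ((s ^+ n.+1 - r ^+ n.+1) * m) <= \int[mu]_(x in rball s `\` rball r) G (rnorm x).
  have := @annulus_measure R n.+1 r s isT (introT andP (conj r0 rs)).
  rewrite -/mu -/B -/m => hA.
  have -> : G s * ((s ^+ n.+1 - r ^+ n.+1) * m) = \int[mu]_(x in rball s `\` rball r) G s.
    by rewrite Rintegral_cst //; congr (G s * _); exact: (esym (f_equal fine hA)).
  apply: le_Rintegral => //.
  - apply: (integrableS _ _ _ (@Rintegral_bounded_integrable _ _ (fun=> G s) (`|G s|) _ _)) => //.
    + exact: measurable_unit_ball.
    + by move=> x [/sB].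
  - by apply: (integrableS _ _ _ iGr) => //; [exact: measurable_unit_ball|move=> x [/sB]].
  - move=> x [xs _]; apply: monoG => //; [exact: rnorm_ge0|exact: ltW].
rewrite eJ eI.
have G01 : 0 <= G r - G s by rewrite subr_ge0 monoG.
have hk := ler_exprn_sub n.+1 r0 rs s1.
apply: (@le_trans _ _ ((G r - G s) * (m * (s ^+ n.+1 - r ^+ n.+1)))).
  have := ler_wpM2l m0 hJ; move: hI.
  set P := s ^+ n.+1 - r ^+ n.+1; set II := \int[mu]_(x in _) _; set JJ := \int[leb]_(x in _) _.
  move=> hI' hJ'; rewrite mulrDr mulrBl; move: hI' hJ'.
  move: (m * J r) (m * JJ) (I r) II => a1 a2 a3 a4.
  by rewrite [P * m]mulrC [m * (G r * P)]mulrCA => ? ?; lra.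
by rewrite ler_wpM2l // -mulrA ler_wpM2l.
Qed.

End polar_integral.

(** * The radial profile and its differential equation *)

Section profile.
Context {R : realType} {n : nat}.
Local Notation N := n.+1.
Local Notation B := (unit_ball R N).
Local Notation e := (delta_mx ord0 ord0 : 'rV[R]_N).
Variables (lambda : R) (u : 'rV[R]_N -> R).
Hypotheses (l0 : 0 < lambda) (su : smooth_solution lambda u) (st : semi_stable lambda u).

(** Negative r are kept on purpose: the profile is then an even function on
    ]-1, 1[, differentiable at 0. *)
Definition profile (r : R) := u (r *: e).
Definition dprofile (r : R) := partial ord0 u (r *: e).

Lemma sqnorm_axis (r s : R) j : j != ord0 ->
  sqnorm (s *: delta_mx ord0 j + r *: e) = r ^+ 2 + s ^+ 2.
Proof.
move=> j0; rewrite /sqnorm (bigD1 ord0) //= (bigD1 j) //= big1 => [|i /andP[i0 ij]].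
  by rewrite !mxE !eqxx /= eq_sym (negbTE j0) /= mulr0 add0r !mulr1 addr0 mulr0 addr0.
by rewrite !mxE /= (negbTE i0) (negbTE ij) /= !mulr0 addr0 expr0n.
Qed.

Lemma sqnorm_scale_e (r : R) : sqnorm (r *: e) = r ^+ 2.
Proof.
rewrite /sqnorm (bigD1 ord0) //= big1 => [|i i0].
  by rewrite !mxE !eqxx mulr1 addr0.
by rewrite !mxE /= (negbTE i0) mulr0 expr0n.
Qed.

Lemma axis_in_ball (r : R) : -1 < r < 1 -> B (r *: e).
Proof.
move=> /andP[r1 r2]; rewrite /unit_ball /= -/(sqnorm _) sqnorm_scale_e.
by rewrite -real_normK ?num_real // expr_lt1 // ltr_norml r1.
Qed.

Let Cu k : Ck_on k B u. Proof. by have [/smooth_onP h _ _ _ _] := su; exact: h. Qed.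

Lemma profileE x : B x -> u x = profile (rnorm x).
Proof.
move=> Bx; apply: (semi_stable_radial l0 su st Bx).
by rewrite sqnorm_scale_e sqr_sqrtr // sqnorm_ge0.
Qed.

Lemma profile_even (r : R) : -1 < r < 1 -> profile (- r) = profile r.
Proof.
move=> r1; apply: (semi_stable_radial l0 su st); last by rewrite !sqnorm_scale_e sqrrN.
by apply: axis_in_ball; lra.
Qed.

Lemma is_derive_profile (r : R) : -1 < r < 1 -> is_derive r (1 : R) profile (dprofile r).
Proof.
move=> r1; have h : is_derive (r *: e + 0) e u (dprofile r).
  by rewrite addr0; exact: Ck_on_is_derive (Cu 1) (axis_in_ball r1).
move/is_derive_lineP : h; rewrite (_ : (fun h : R => _) = profile) //.
by apply/funext => s; rewrite addr0.
Qed.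

Lemma is_derive_dprofile (r : R) : -1 < r < 1 ->
  is_derive r (1 : R) dprofile (partial ord0 (partial ord0 u) (r *: e)).
Proof.
move=> r1; have h : is_derive (r *: e + 0) e (partial ord0 u) (partial ord0 (partial ord0 u) (r *: e)).
  by rewrite addr0; exact: Ck_on_is_derive (Ck_on_partial ord0 (Cu 2)) (axis_in_ball r1).
move/is_derive_lineP : h; rewrite (_ : (fun h : R => _) = dprofile) //.
by apply/funext => s; rewrite addr0.
Qed.

(** An even function that is differentiable at 0 has derivative 0 there. *)
Lemma dprofile0 : dprofile 0 = 0.
Proof.
have r1 : -1 < (0 : R) < 1 by lra.
have h := is_derive_profile r1.
have hN : is_derive (0 : R) (1 : R) (fun r : R => - r) (-1).
  exact: is_deriveNid.
have h' : is_derive (- (0 : R)) (1 : R) profile (dprofile 0) by rewrite oppr0.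
have [_ d1] := @is_derive1_comp R profile (fun r => - r) 0 _ _ h' hN.
have [_ d2] := h.
suff : dprofile 0 * -1 = dprofile 0 by lra.
rewrite -d1 -[RHS]d2; apply: near_eq_derive.
near=> r; apply: profile_even; rewrite -ltr_norml; near: r.
apply/nbhs_ballP; exists 1 => //= y; by rewrite -ball_normE /= sub0r normrN.
Unshelve. all: by end_near. Qed.

Lemma profile_ge0_lt1 (r : R) : -1 < r < 1 -> 0 <= profile r < 1.
Proof. by move=> /axis_in_ball; have [_ _ h _ _] := su; exact: h. Qed.

Lemma profile1 : profile 1 = 0.
Proof.
by have [_ _ _ _ h] := su; apply: h; rewrite /unit_sphere /= -/(sqnorm _) sqnorm_scale_e expr1n.
Qed.

(** As u is radial, u (r e + s e_j) = U (q s) with q s = sqrt (r^2 + s^2). Its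
    derivative in s is U' (q s) s / q s, and the difference quotient of that at
    s = 0 tends to U' r / r. *)
Lemma partial2_axis j (r : R) : j != ord0 -> 0 < r < 1 ->
  partial j (partial j u) (r *: e) = dprofile r / r.
Proof.
move=> j0 /andP[r0 r1].
have r11 : -1 < r < 1 by lra.
pose q (s : R) := Num.sqrt (r ^+ 2 + s ^+ 2).
have q0 : q 0 = r by rewrite /q expr0n addr0 sqrtr_sqr ger0_norm // ltW.
have qpos s : 0 < q s by rewrite sqrtr_gt0 ltr_pwDl ?exprn_gt0 ?sqr_ge0.
have cq : continuous q.
  move=> s; apply: (@continuous_comp _ _ _ (fun s : R => r ^+ 2 + s ^+ 2) Num.sqrt).
    by apply: cvgD; [exact: cvg_cst|exact: exprn_continuous].
  exact: sqrt_continuous.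
have q1near : \forall s \near (0 : R), q s < 1.
  have hw : nbhs (q 0) [set y | y < 1].
    by rewrite q0; apply: open_nbhs_nbhs; split => //; exact: open_lt.
  exact: cq hw.
have Bq s : q s < 1 -> B (s *: delta_mx ord0 j + r *: e).
  move=> q1; rewrite /unit_ball /= -/(sqnorm _) sqnorm_axis //.
  rewrite -[r ^+ 2 + _]sqr_sqrtr ?addr_ge0 ?sqr_ge0 // -/(q s).
  by rewrite expr_lt1 // ltW.
have uq s : q s < 1 -> u (s *: delta_mx ord0 j + r *: e) = profile (q s).
  move=> q1; apply: (semi_stable_radial l0 su st (Bq _ q1)).
  by rewrite sqnorm_axis // sqnorm_scale_e sqr_sqrtr // addr_ge0 ?sqr_ge0.
have near_at s : q s < 1 -> \forall t \near s, q t < 1.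
  move=> qs1; have hw : nbhs (q s) [set y | y < 1].
    by apply: open_nbhs_nbhs; split => //; exact: open_lt.
  exact: cq hw.
have dq (s : R) : is_derive s (1 : R) q (s / q s).
  have h1 : is_derive s (1 : R) (fun s : R => r ^+ 2 + s ^+ 2) (2 * s).
    have hs : is_derive s (1 : R) (fun s : R => s ^+ 2) (2 * s).
      apply: DeriveDef; first exact: exprn_derivable.
      by rewrite exp_derive [_ *: 1]mulr1.
    by apply: is_derive_eq (is_derive_addf (is_derive_cst (r ^+ 2) s 1) hs) _; rewrite add0r.
  have p0 : 0 < r ^+ 2 + s ^+ 2 by rewrite ltr_pwDl ?exprn_gt0 ?sqr_ge0.
  have := @is_derive1_comp R Num.sqrt (fun s : R => r ^+ 2 + s ^+ 2) s _ _ (is_derive1_sqrt p0) h1.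
  move=> /is_derive_eq; apply; rewrite -/(q s).
  by field; rewrite gt_eqF.
have dj s : q s < 1 -> partial j u (s *: delta_mx ord0 j + r *: e) = dprofile (q s) * (s / q s).
  move=> qs1; apply: is_derive_partial; apply/is_derive_lineP.
  have hd : is_derive (q s) (1 : R) profile (dprofile (q s)).
    by apply: is_derive_profile; rewrite qs1 andbT (lt_trans _ (qpos s)) // ltrN10.
  apply: near_eq_is_derive (@is_derive1_comp R profile q s _ _ hd (dq s)).
  by apply: filterS (near_at _ qs1) => t qt1; rewrite /= uq.
apply: is_derive_partial; apply/is_derive_line0P/is_deriveP.
have cl : dprofile (q s) / q s @[s --> (0 : R)^'] --> dprofile r / r.
  have c0 : dprofile (q s) / q s @[s --> (0 : R)] --> dprofile (q 0) / q 0.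
    apply: cvgM; last by apply: cvgV; [rewrite gt_eqF|exact: cq].
    apply: (@continuous_comp _ _ _ q dprofile); first exact: cq.
    by rewrite q0; exact: is_derive1_continuous (is_derive_dprofile r11).
  by rewrite -q0; apply: cvg_within_filter c0.
apply: cvg_trans cl; apply: near_eq_cvg; near=> s.
have qs1 : q s < 1 by near: s; apply: cvg_within; exact: q1near.
have sn0 : s != 0 by near: s; exact: nbhs_dnbhs_neq.
rewrite [s *: 1]mulr1 addr0 dj // dj ?q0 // mul0r mulr0 subr0.
rewrite /GRing.scale /=; field.
by rewrite gt_eqF.
Unshelve. all: by end_near. Qed.

(** Of the second derivatives at r e, the one along e is U'' and each of the
    n others is U' / r. *)
Lemma profile_ode (r : R) : 0 < r < 1 ->
  is_derive r (1 : R) dprofile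
    (- (n%:R * (dprofile r / r)) - lambda / (1 - profile r) ^+ 2).
Proof.
move=> r01; have r1 : -1 < r < 1 by lra.
apply: is_derive_eq (is_derive_dprofile r1) _.
have [_ _ _ eq _] := su; have := eq _ (axis_in_ball r1).
rewrite -/(profile r) => <-; rewrite /laplacian big_ord_recl.
under eq_bigr do rewrite partial2_axis //.
by rewrite sumr_const card_ord mulr_natl opprK addrCA addNr addr0.
Qed.

End profile.

(** * Growth of the profile at the origin *)

Section growth.
Context {R : realType}.
Local Notation leb := (@lebesgue_measure R).

Lemma derive_le0_le (F dF : R -> R) (rho : R) : 0 < rho ->
  (forall r : R, 0 < r <= rho -> is_derive r (1 : R) F (dF r)) ->
  F r @[r --> 0^'+] --> F 0 ->
  (forall r, 0 < r <= rho -> dF r <= 0) -> F rho <= F 0.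
Proof.
move=> rho0 hF cF h0.
have [x||x x01 e] := @MVT R F dF 0 rho rho0.
- by rewrite in_itv /= => /andP[x0 x1]; apply: hF; rewrite x0 ltW.
- apply: derivable_oo_LRcontinuous_within; split => //.
    by move=> x; rewrite in_itv /= => /andP[x0 x1]; have [] := hF x _; rewrite ?x0 ?ltW.
  apply: cvg_at_left_filter.
  by have := is_derive1_continuous (hF rho _); apply; rewrite rho0 lexx.
- move: x01; rewrite in_itv /= => /andP[x0 x1]; rewrite -subr_le0 e.
  by rewrite subr0 pmulr_lle0 // h0 // x0 ltW.
Qed.

Lemma powR_cvg0_right (k : R) : 0 < k -> r `^ k @[r --> (0 : R)^'+] --> 0 `^ k.
Proof. by move=> k0; rewrite powR0 ?gt_eqF //; exact: powR_cvg0. Qed.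

Lemma powRV (x b : R) : 0 <= x -> x^-1 `^ b = (x `^ b)^-1.
Proof. by move=> x0; rewrite -powR_inv1 // -powRrM mulN1r powRN. Qed.

Lemma powR_divMr (p q b : R) : 0 < p -> 0 < q ->
  (p / q) `^ b * q = p `^ b * q `^ (1 - b).
Proof.
move=> p0 q0; rewrite powRM ?invr_ge0 ?(ltW p0) ?(ltW q0) //.
rewrite -(powR_inv1 (ltW q0)) -powRrM mulN1r -mulrA; congr (_ * _).
have -> : q `^ (1 - b) = q `^ (- b) * q `^ 1.
  by rewrite -powRD ?(gt_eqF q0) ?implybT // addrC.
by rewrite powRr1 // ltW.
Qed.

Lemma powR_divMl (p q a : R) : 0 < p -> 0 < q ->
  (p / q) `^ (- a) * p = q `^ a * p `^ (1 - a).
Proof.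
move=> p0 q0; have pq0 : 0 < p / q by rewrite divr_gt0.
have -> : (p / q) `^ (- a) = (q / p) `^ a.
  by rewrite -(invf_div p q) -(powR_inv1 (ltW pq0)) -powRrM mulN1r.
exact: powR_divMr.
Qed.

(** Hoelder's inequality for the integral of r^e X, of which F is C1 times a
    primitive, in terms of the integral V of r^n X^tau and of a power of r. It is
    proved on the level of derivatives, where no integrability question arises:
    by Young's inequality with a weight c, the derivative of F is at most that of
    a combination of V and r^kappa. The weight is optimized at the end. *)
Lemma holder_derive (tau e kappa S C1 rho : R) (n : nat) (F V X : R -> R) :
  1 < tau -> 0 < rho -> 0 < kappa -> 0 < S -> 0 <= C1 ->
  kappa = (e - n%:R / tau) * (tau / (tau - 1)) + 1 ->
  (forall r, 0 < r <= rho -> 0 <= X r) ->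
  (forall r : R, 0 < r <= rho -> is_derive r (1 : R) F (C1 * (r `^ e * X r))) ->
  (forall r : R, 0 < r <= rho -> is_derive r (1 : R) V (r ^+ n * X r `^ tau)) ->
  F r @[r --> 0^'+] --> F 0 -> V r @[r --> 0^'+] --> V 0 ->
  V rho - V 0 <= S ->
  F rho - F 0 <= C1 * (S `^ (tau^-1) * (rho `^ kappa / kappa) `^ (1 - tau^-1)).
Proof.
move=> t1 rho0 k0 S0 C10 kE X0 dF dV cF cV VS.
have t0 : 0 < tau by lra.
have t10 : 0 < tau - 1 by lra.
pose tau' := tau / (tau - 1).
have t'0 : 0 < tau' by rewrite divr_gt0.
have tt' : tau^-1 + tau'^-1 = 1 by rewrite /tau'; field; rewrite !gt_eqF.
set T := rho `^ kappa / kappa.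
have T0 : 0 < T by rewrite divr_gt0 // powR_gt0.
have main (c : R) : 0 < c -> F rho - F 0 <=
    C1 * (c `^ tau / tau * S + c `^ (- tau') / tau' * T).
  move=> c0; pose H r := F r - C1 * (c `^ tau / tau * V r + c `^ (- tau') / tau' * (r `^ kappa / kappa)).
  have HH : H rho <= H 0.
    pose dP r := c `^ tau / tau * (r ^+ n * X r `^ tau) + c `^ (- tau') / tau' * (r `^ (kappa - 1)).
    apply: (@derive_le0_le _ (fun r => C1 * (r `^ e * X r) - C1 * dP r) rho) => //.
    - move=> r hr; have /andP[r0 _] := hr.
      apply: is_derive_subf; first exact: dF.
      apply: is_derive_scalef; apply: is_derive_addf; first by apply: is_derive_scalef; exact: dV.
      apply: is_derive_scalef.
      have h := is_derive_scalef kappa^-1 (is_derive1_powR kappa r0).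
      rewrite (_ : (fun x => x `^ kappa / kappa) = (fun y => kappa^-1 * y `^ kappa)).
        by apply: is_derive_eq h _; rewrite mulrA mulVf ?gt_eqF // mul1r.
      by apply/funext => y; rewrite mulrC.
    - apply: cvgB => //; apply: cvgM; first exact: cvg_cst.
      apply: cvgD; (apply: cvgM; first exact: cvg_cst) => //.
      by apply: cvgM; [exact: powR_cvg0_right|exact: cvg_cst].
    - move=> r hr; have /andP[r0 _] := hr; rewrite -mulrBr mulr_ge0_le0 // subr_le0.
      have y := @conjugate_powR R (c * (r `^ (n%:R / tau) * X r)) (c^-1 * r `^ (e - n%:R / tau)) tau tau'.
      have rn0 : r != 0 by rewrite gt_eqF.
      have : r `^ e * X r = c * (r `^ (n%:R / tau) * X r) * (c^-1 * r `^ (e - n%:R / tau)).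
        rewrite [X in _ = X](_ : _ = (r `^ (n%:R / tau) * r `^ (e - n%:R / tau)) * X r).
          by rewrite -powRD ?rn0 ?implybT // addrC subrK.
        by field; rewrite gt_eqF.
      move=> ->; apply: le_trans (y _ _ _ _ tt') _ => //.
      + by rewrite !mulr_ge0 ?powR_ge0 ?X0 // ltW.
      + by rewrite mulr_ge0 ?powR_ge0 // invr_ge0 ltW.
      rewrite /dP powRM ?mulr_ge0 ?powR_ge0 ?X0 ?(ltW c0) //.
      rewrite powRM ?powR_ge0 ?X0 // -powRrM.
      rewrite [n%:R / tau * tau]divfK ?gt_eqF // powR_mulrn ?(ltW r0) //.
      rewrite powRM ?powR_ge0 ?invr_ge0 ?(ltW c0) // -[X in _ + X `^ _ * _ / _ <= _]powR_inv1 ?(ltW c0) //.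
      rewrite -!powRrM mulN1r (_ : (e - n%:R / tau) * tau' = kappa - 1); last by rewrite kE addrK.
      by rewrite [X in X + _]mulrAC [X in _ + X <= _]mulrAC.
  move: HH; rewrite /H powR0 ?gt_eqF // mul0r mulr0 addr0 -/T => HH.
  have ct : 0 <= c `^ tau / tau by rewrite divr_ge0 ?powR_ge0 // ltW.
  have := ler_wpM2l C10 (ler_wpM2l ct VS).
  move: HH; set p := c `^ tau / tau; set q := _ * T => HH hV.
  rewrite mulrDr; rewrite mulrDr in HH; rewrite mulrBr mulrBr in hV; lra.
(* With this c both terms of the bound equal S^(1/tau) T^(1 - 1/tau), up to
   the factors 1/tau and 1/tau', which add up to 1. *)
pose c := (T / S) `^ ((tau * tau')^-1).
have TS0 : 0 < T / S by rewrite divr_gt0.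
have c0 : 0 < c by rewrite powR_gt0.
apply: le_trans (main c c0) _; rewrite ler_wpM2l //.
have TSn : T / S != 0 by rewrite gt_eqF.
have e1 : c `^ tau * S = S `^ tau^-1 * T `^ (1 - tau^-1).
  rewrite -powRrM (_ : _ * tau = 1 - tau^-1); last first.
    by rewrite -tt' addrAC subrr add0r; field; rewrite !gt_eqF.
  rewrite powR_divMr // mulrC; congr (_ * _); congr (_ `^ _); ring.
have e2 : c `^ (- tau') * T = S `^ tau^-1 * T `^ (1 - tau^-1).
  rewrite -powRrM (_ : _ * - tau' = - tau^-1); last by field; rewrite !gt_eqF.
  exact: powR_divMl.
by rewrite [X in X + _]mulrAC e1 [X in _ + X]mulrAC e2 -mulrDr tt' mulr1.
Qed.

End growth.

Section profile_growth.
Context {R : realType} {n : nat}.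
Local Notation N := n.+1.
Local Notation B := (unit_ball R N).
Local Notation leb := (@lebesgue_measure R).
Variables (lambda : R) (u : 'rV[R]_N -> R).
Hypotheses (l0 : 0 < lambda) (su : smooth_solution lambda u) (st : semi_stable lambda u).
Local Notation U := (profile u).
Local Notation dU := (dprofile u).

Let in1 (r : R) : 0 <= r < 1 -> -1 < r < 1. Proof. by move=> ?; lra. Qed.

(** The radial equation in divergence form. *)
Lemma is_derive_flux (r : R) : 0 < r < 1 ->
  is_derive r (1 : R) (fun r => - (r ^+ n * dU r)) (lambda * (r ^+ n * (1 - U r) ^- 2)).
Proof.
move=> r01; have /andP[r0 r1] := r01.
have h1 : is_derive r (1 : R) (fun r : R => r ^+ n) (n%:R * r ^+ n.-1).
  by apply: DeriveDef; [exact: exprn_derivable|rewrite exp_derive [_ *: 1]mulr1].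
have h := is_derive_mulf h1 (profile_ode l0 su st r01).
rewrite (_ : (fun r => - (r ^+ n * dU r)) = (fun r => -1 * (r ^+ n * dU r))); last first.
  by apply/funext => s; rewrite mulN1r.
apply: is_derive_eq (is_derive_scalef (-1) h) _.
have e : n%:R * r ^+ n.-1 = n%:R * (r ^+ n / r).
  case: (n) => [|k]; first by rewrite !mul0r.
  by rewrite exprSr mulfK ?gt_eqF.
have /andP[_ U1] := profile_ge0_lt1 su (in1 (introT andP (conj (ltW r0) r1))).
by rewrite e; field; rewrite !gt_eqF // subr_gt0.
Qed.

Lemma profile_continuous (r : R) : -1 < r < 1 -> {for r, continuous U}.
Proof. by move=> r1; exact: is_derive1_continuous (is_derive_profile su r1). Qed.

Lemma dprofile_continuous (r : R) : -1 < r < 1 -> {for r, continuous dU}.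
Proof. by move=> r1; exact: is_derive1_continuous (is_derive_dprofile su r1). Qed.

Lemma flux_cvg0 : - (r ^+ n * dU r) @[r --> (0 : R)^'+] --> - (0 ^+ n * dU 0).
Proof.
apply: cvg_at_right_filter; apply: cvgN; apply: cvgM; first exact: exprn_continuous.
by apply: dprofile_continuous; lra.
Qed.

Lemma flux0 : - (0 ^+ n * dU 0) = 0.
Proof. by rewrite (dprofile0 l0 su st) mulr0 oppr0. Qed.

(** The flux - r^n U' is zero at the origin and has a nonnegative derivative. *)
Lemma dprofile_le0 (r : R) : 0 <= r < 1 -> dU r <= 0.
Proof.
move=> /andP[]; rewrite le_eqVlt => /orP[/eqP <-|r0] r1.
  by rewrite (dprofile0 l0 su st).
have := @derive_le0_le R (fun r => r ^+ n * dU r) (fun r => -1 * (lambda * (r ^+ n * (1 - U r) ^- 2))) r r0.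
rewrite (dprofile0 l0 su st) mulr0 pmulr_rle0 ?exprn_gt0 //; apply.
- move=> s /andP[s0 sr]; have s1 := le_lt_trans sr r1.
  have h := is_derive_flux (introT andP (conj s0 s1)).
  rewrite (_ : (fun r => r ^+ n * dU r) = (fun r => -1 * - (r ^+ n * dU r))).
    exact: is_derive_scalef.
  by apply/funext => x; rewrite mulN1r opprK.
- have h : r ^+ n * dU r @[r --> (0 : R)^'+] --> 0 ^+ n * dU 0.
    apply: cvg_at_right_filter; apply: cvgM; first exact: exprn_continuous.
    by apply: dprofile_continuous; lra.
  by rewrite (dprofile0 l0 su st) mulr0 in h.
- move=> s /andP[s0 sr]; have s1 := le_lt_trans sr r1.
  have /andP[_ U1] := profile_ge0_lt1 su (in1 (introT andP (conj (ltW s0) s1))).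
  rewrite mulN1r oppr_le0 !mulr_ge0 ?invr_ge0 ?exprn_ge0 ?(ltW l0) ?(ltW s0) //.
  by rewrite subr_ge0 ltW.
Qed.

Lemma profile_nincr (r s : R) : 0 <= r -> r <= s -> s <= 1 -> U s <= U r.
Proof.
move=> r0; rewrite le_eqVlt => /orP[/eqP -> //|rs]; rewrite le_eqVlt => /orP[/eqP s1|s1].
  rewrite s1 (profile1 su).
  have r1 : r < 1 by rewrite -s1.
  by have /andP[] := profile_ge0_lt1 su (in1 (introT andP (conj r0 r1))).
have h (x : R) : r <= x <= s -> -1 < x < 1 by move=> ?; lra.
have [x||x + e] := @MVT R U dU r s rs.
- rewrite in_itv /= => /andP[rx xs]; apply: (is_derive_profile su); apply: h.
  by rewrite !ltW.
- apply: continuous_in_subspaceT => x; rewrite inE /= in_itv /= => xrs.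
  exact: profile_continuous (h _ xrs).
- rewrite in_itv /= => /andP[rx xs]; rewrite -subr_le0 e mulr_le0_ge0 //; last lra.
  by apply: dprofile_le0; lra.
Qed.

Variable tau : R.
Hypotheses (tau1 : 1 < tau) (Ntau : N%:R < 2 * tau).

Definition radial_density (r : R) := r ^+ n * (1 - U r) `^ (- (2 * tau)).

Lemma radial_density_continuous (r : R) : -1 < r < 1 -> {for r, continuous radial_density}.
Proof.
move=> r1; have /andP[_ U1] := profile_ge0_lt1 su r1.
apply: cvgM; first exact: exprn_continuous.
apply: (@continuous_comp _ _ _ U (fun s => (1 - s) `^ (- (2 * tau)))).
  exact: profile_continuous.
exact: is_derive1_continuous (is_derive_pow1 _ U1).
Qed.

Lemma radial_density_integrable (r : R) : r < 1 ->
  leb.-integrable `[0, r] (EFin \o radial_density).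
Proof.
move=> r1; apply: continuous_compact_integrable; first exact: segment_compact.
apply: continuous_in_subspaceT => x; rewrite inE /= in_itv /= => /andP[x0 xr].
by apply: radial_density_continuous; lra.
Qed.

Definition radial_mass (r : R) := \int[leb]_(x in `[0, r]) radial_density x.

Lemma is_derive_radial_mass (r : R) : 0 < r < 1 ->
  is_derive r (1 : R) radial_mass (radial_density r).
Proof.
move=> /andP[r0 r1]; have [v rv v1] : exists2 v, r < v & v < 1.
  by exists ((r + 1) / 2); lra.
have [d1 d2] := @continuous_FTC1_closed R radial_density 0 r v rv (radial_density_integrable v1) r0
  (radial_density_continuous (in1 (introT andP (conj (ltW r0) r1)))).
by apply: DeriveDef; [exact: d1|rewrite -derive1E; exact: d2].
Qed.

Lemma radial_mass0 : radial_mass 0 = 0.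
Proof. by rewrite /radial_mass set_itv1 Rintegral_set1. Qed.

Lemma radial_mass_cvg0 : radial_mass r @[r --> (0 : R)^'+] --> radial_mass 0.
Proof.
rewrite radial_mass0; apply: cvg_at_right_filter.
have h : (2^-1 : R) < 1 by rewrite invf_lt1 // ltr1n.
apply: (@parameterized_integral_cvg_left R 0 2^-1); first by rewrite invr_gt0.
exact: radial_density_integrable h.
Qed.

Variable K : R.
Hypotheses (K0 : 0 < K) (massK : forall r, 0 < r < 1 -> radial_mass r <= K / N%:R).

Let X (r : R) := (1 - U r) ^- 2.

Let X_ge0 (r : R) : 0 < r < 1 -> 0 <= X r.
Proof.
move=> /andP[r0 r1]; have /andP[_ U1] := profile_ge0_lt1 su (in1 (introT andP (conj (ltW r0) r1))).
by rewrite invr_ge0 exprn_ge0 // subr_ge0 ltW.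
Qed.

Let densityE (r : R) : 0 < r < 1 -> radial_density r = r ^+ n * X r `^ tau.
Proof.
move=> /andP[r0 r1]; have /andP[_ U1] := profile_ge0_lt1 su (in1 (introT andP (conj (ltW r0) r1))).
have U10 : 0 <= 1 - U r by rewrite subr_ge0 ltW.
by rewrite /radial_density /X -powR_invn // -powRrM mulNr.
Qed.

Let tau0 : 0 < tau. Proof. exact: lt_trans tau1. Qed.
Let N0 : 0 < N%:R :> R. Proof. by []. Qed.
Let S0 : 0 < K / N%:R. Proof. by rewrite divr_gt0. Qed.

Let sub_itv (rho r : R) : rho < 1 -> 0 < r <= rho -> 0 < r < 1.
Proof. by move=> rho1 /andP[-> /le_lt_trans]; apply. Qed.

Let holder (e kappa C1 rho : R) (F : R -> R) : 0 < rho < 1 -> 0 < kappa -> 0 <= C1 ->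
  kappa = (e - n%:R / tau) * (tau / (tau - 1)) + 1 ->
  (forall r : R, 0 < r < 1 -> is_derive r (1 : R) F (C1 * (r `^ e * X r))) ->
  F r @[r --> 0^'+] --> F 0 ->
  F rho - F 0 <= C1 * ((K / N%:R) `^ (tau^-1) * (rho `^ kappa / kappa) `^ (1 - tau^-1)).
Proof.
move=> /andP[r0 r1] k0 C10 kE dF cF.
apply: (@holder_derive R tau e kappa _ C1 rho n F radial_mass X) => //.
- by move=> r /(sub_itv r1); exact: X_ge0.
- by move=> r /(sub_itv r1); exact: dF.
- by move=> r /(sub_itv r1) h; rewrite -densityE //; exact: is_derive_radial_mass.
- exact: radial_mass_cvg0.
- by rewrite radial_mass0 subr0 massK // r0.
Qed.

Let alpha := 2 - N%:R / tau.

Let alpha0 : 0 < alpha.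
Proof. by rewrite subr_gt0 ltr_pdivrMr. Qed.

Let U_cvg0 : U r @[r --> (0 : R)^'+] --> U 0.
Proof. by apply: cvg_at_right_filter; apply: profile_continuous; lra. Qed.

(** The flux is lambda times the integral of r^n (1 - U)^-2, to which Hoelder's
    inequality with exponent tau applies: the mass of r^n (1 - U)^(-2 tau) is
    bounded by K / N. *)
Lemma flux_bound (rho : R) : 0 < rho < 1 ->
  - dU rho <= lambda * K `^ tau^-1 / N%:R * rho `^ (alpha - 1).
Proof.
move=> rho01; have /andP[r0 r1] := rho01.
have kE : N%:R = (n%:R - n%:R / tau) * (tau / (tau - 1)) + 1 :> R.
  by rewrite -natr1; field; rewrite !gt_eqF // subr_gt0.
have := @holder n%:R N%:R lambda rho (fun r => - (r ^+ n * dU r)) rho01 N0 (ltW l0) kE _ flux_cvg0.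
rewrite flux0 subr0 => h; have {}h := h _.
have rn0 : 0 < rho ^+ n by rewrite exprn_gt0.
rewrite -(ler_pM2l rn0) mulrN; apply: le_trans (h _) _.
  move=> r hr; have /andP[rr0 _] := hr.
  by rewrite powR_mulrn ?(ltW rr0) //; exact: is_derive_flux.
rewrite le_eqVlt; apply/orP; left; apply/eqP.
have rho0 : rho != 0 by rewrite gt_eqF.
rewrite powRM ?invr_ge0 ?(ltW K0) // powRM ?powR_ge0 ?invr_ge0 // -powRrM.
have eN : N%:R^-1 `^ tau^-1 * N%:R^-1 `^ (1 - tau^-1) = N%:R^-1 :> R.
  by rewrite -powRD ?invr_eq0 ?(gt_eqF N0) ?implybT // addrC subrK powRr1 // invr_ge0.
have er : rho `^ (N%:R * (1 - tau^-1)) = rho ^+ n * rho `^ (alpha - 1).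
  rewrite -powR_mulrn ?(ltW r0) // -powRD ?rho0 ?implybT //; congr (_ `^ _).
  by rewrite /alpha -natr1; ring.
rewrite er -[in RHS]eN; ring.
Qed.

(** Integration of flux_bound; for N = 1 and N = 2 the constant is gamma tau N. *)
Lemma profile_growth_low (rho : R) : 0 < rho < 1 ->
  U 0 - U rho <= lambda * (tau / (N%:R * (2 * tau - N%:R))) * K `^ tau^-1 * rho `^ alpha.
Proof.
move=> rho01; have /andP[r0 r1] := rho01.
pose C := lambda * K `^ tau^-1 / N%:R.
have := @derive_le0_le R (fun r => - U r - C * (alpha^-1 * r `^ alpha))
  (fun r => - dU r - C * r `^ (alpha - 1)) rho r0.
rewrite powR0 ?(gt_eqF alpha0) // !mulr0 subr0 => h.
have {}h : - U rho - C * (alpha^-1 * rho `^ alpha) <= - U 0.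
  apply: h.
  - move=> r hr; have rr := sub_itv r1 hr; have /andP[rr0 rr1] := rr.
    apply: is_derive_subf.
      apply: is_derive_oppf; apply: (is_derive_profile su).
      by apply: in1; rewrite ltW.
    apply: is_derive_scalef.
    apply: is_derive_eq (is_derive_scalef alpha^-1 (is_derive1_powR alpha rr0)) _.
    by rewrite mulrA mulVf ?mul1r // gt_eqF.
  - have h1 : C * (alpha^-1 * r `^ alpha) @[r --> (0 : R)^'+] --> C * (alpha^-1 * 0).
      by do 2 (apply: cvgM; first exact: cvg_cst); exact: powR_cvg0.
    by rewrite !mulr0 in h1; rewrite -[X in _ --> X]subr0; apply: cvgB h1; exact: cvgN U_cvg0.
  - by move=> r hr; rewrite subr_le0; apply: flux_bound; exact: sub_itv hr.
have -> : lambda * (tau / (N%:R * (2 * tau - N%:R))) * K `^ tau^-1 * rho `^ alpha =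
   C * (alpha^-1 * rho `^ alpha).
  rewrite /C /alpha; field; rewrite !gt_eqF //.
  by rewrite nat1r subr_gt0.
lra.
Qed.

(** The constant gamma for N >= 3 is obtained by a single use of Hoelder's
    inequality: F = - U - r U' / (N - 2) has derivative
    lambda / (N - 2) r (1 - U)^-2, in which U' does not occur, and
    F rho - F 0 >= U 0 - U rho because U' <= 0. *)
Lemma profile_growth_high (rho : R) : (2 <= n)%N -> 0 < rho < 1 ->
  U 0 - U rho <= lambda * ((tau - 1) `^ ((tau - 1) / tau) /
    ((N%:R - 2) * N%:R `^ (1 / tau) * (2 * tau - N%:R) `^ ((tau - 1) / tau))) *
    K `^ tau^-1 * rho `^ alpha.
Proof.
move=> n2 rho01; have /andP[r0 r1] := rho01.
have tau10 : 0 < tau - 1 by rewrite subr_gt0.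
have n1 : 0 < n%:R - 1 :> R by rewrite subr_gt0 ltr1n.
have tN : 0 < 2 * tau - N%:R by rewrite subr_gt0.
pose kappa := (2 * tau - N%:R) / (tau - 1).
have k0 : 0 < kappa by rewrite divr_gt0.
have kE : kappa = (1 - n%:R / tau) * (tau / (tau - 1)) + 1.
  by rewrite /kappa -natr1; field; rewrite !gt_eqF.
pose C1 := lambda / (n%:R - 1).
have C10 : 0 <= C1 by rewrite divr_ge0 // ltW.
have := @holder 1 kappa C1 rho (fun r => - U r - (n%:R - 1)^-1 * (r * dU r)) rho01 k0 C10 kE.
rewrite mul0r mulr0 subr0 => h; have {}h := h _ _.
have dUr := dprofile_le0 (introT andP (conj (ltW r0) r1)).
apply: (@le_trans _ _ (- U rho - (n%:R - 1)^-1 * (rho * dU rho) - - U 0)).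
  have : (n%:R - 1)^-1 * (rho * dU rho) <= 0.
    by rewrite pmulr_rle0 ?invr_gt0 // pmulr_rle0.
  lra.
apply: le_trans (h _ _) _.
- move=> r hr; have /andP[rr0 rr1] := hr.
  have rin : -1 < r < 1 by apply: in1; rewrite ltW.
  have h1 : is_derive r (1 : R) (fun r => - U r) (- dU r).
    by apply: is_derive_oppf; exact: (is_derive_profile su).
  have h2 := is_derive_mulf (is_derive_id r (1 : R)) (profile_ode l0 su st hr).
  have h3 := is_derive_subf h1 (is_derive_scalef (n%:R - 1)^-1 h2).
  apply: is_derive_eq h3 _.
  have /andP[_ U1] := profile_ge0_lt1 su rin.
  rewrite /X /C1 powRr1 ?(ltW rr0) //=.
  by field; rewrite !gt_eqF // subr_gt0.
- have h1 : r * dU r @[r --> (0 : R)^'+] --> 0 * dU 0.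
    apply: cvg_at_right_filter; apply: cvgM; first exact: cvg_id.
    by apply: dprofile_continuous; lra.
  have h2 : (n%:R - 1)^-1 * (r * dU r) @[r --> (0 : R)^'+] --> (n%:R - 1)^-1 * (0 * dU 0).
    by apply: cvgM h1; exact: cvg_cst.
  by rewrite !(mul0r, mulr0) in h2; rewrite -[X in _ --> X]subr0; apply: cvgB h2; exact: cvgN U_cvg0.
rewrite le_eqVlt; apply/orP; left; apply/eqP.
have b0 : 1 - tau^-1 = (tau - 1) / tau by rewrite mulrBl divff ?gt_eqF // mul1r.
rewrite powRM ?invr_ge0 ?(ltW K0) // powRM ?powR_ge0 ?invr_ge0 ?(ltW k0) // -powRrM b0.
have -> : kappa * ((tau - 1) / tau) = alpha.
  by rewrite /kappa /alpha; field; rewrite !gt_eqF.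
have -> : kappa^-1 `^ ((tau - 1) / tau) =
    (tau - 1) `^ ((tau - 1) / tau) / (2 * tau - N%:R) `^ ((tau - 1) / tau).
  by rewrite /kappa invf_div powRM ?invr_ge0 ?(ltW tau10) ?(ltW tN) // powRV // ltW.
have -> : N%:R^-1 `^ tau^-1 = (N%:R `^ (1 / tau))^-1 :> R.
  by rewrite powRV // mul1r.
have -> : N%:R - 2 = n%:R - 1 :> R by rewrite -natr1; ring.
have p1 : N%:R `^ (1 / tau) != 0 :> R by rewrite gt_eqF // powR_gt0.
have p2 : (2 * tau - N%:R) `^ ((tau - 1) / tau) != 0 by rewrite gt_eqF // powR_gt0.
rewrite /C1; field; rewrite p1 p2 /= gt_eqF //.
Qed.

Lemma profile_growth (rho : R) : 0 < rho < 1 ->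
  U 0 - U rho <= lambda * gamma tau N * K `^ tau^-1 * rho `^ alpha.
Proof.
move=> rho01; have [n2|n2] := leqP 2 n.
  rewrite (_ : gamma tau N = (tau - 1) `^ ((tau - 1) / tau) /
    ((N%:R - 2) * N%:R `^ (1 / tau) * (2 * tau - N%:R) `^ ((tau - 1) / tau))).
    exact: profile_growth_high.
  by case: (n) n2 => [|[]].
have -> : gamma tau N = tau / (N%:R * (2 * tau - N%:R)).
  case: (n) n2 => [|[|//]] _ /=; first by rewrite mul1r.
  by rewrite (_ : 4 * (tau - 1) = 2 * (2 * tau - 2)) //; ring.
exact: profile_growth_low.
Qed.

End profile_growth.

(** * The theorem *)

Section radial_energy.
Context {R : realType} {n : nat}.
Local Notation N := n.+1.
Local Notation B := (unit_ball R N).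
Local Notation leb := (@lebesgue_measure R).
Local Notation mu := (lebRn (R := R) N).
Variables (lambda : R) (u : 'rV[R]_N -> R).
Hypotheses (l0 : 0 < lambda) (su : smooth_solution lambda u) (st : semi_stable lambda u).
Local Notation U := (profile u).

Lemma Linfty_norm_profile : Linfty_norm B u <= U 0.
Proof.
have U00 : 0 <= U 0 by have /andP[] := profile_ge0_lt1 su (introT andP (conj (@ltrN10 R) ltr01)).
have hle : ('N[mu]_+oo[EFin \o (u \_ B)] <= (U 0)%:E)%E.
  rewrite unlock /=; case: ifP => _; last by rewrite lee_fin.
  apply/ess_supP; apply: aeW => x /=; rewrite lee_fin patchE.
  case: ifPn => [|_]; last by rewrite normr0.
  rewrite inE => Bx; have [_ _ h _ _] := su; have /andP[ux0 _] := h x Bx.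
  rewrite ger0_norm // (profileE l0 su st Bx); apply: (profile_nincr l0 su st) => //.
    exact: rnorm_ge0.
  by move: Bx; rewrite -rball1 => /ltW.
rewrite -lee_fin /Linfty_norm fineK //; rewrite ge0_fin_numE ?Lnorm_ge0 //.
exact: le_lt_trans hle (ltry _).
Qed.

Lemma radial_density_measurable tau : measurable_fun (`[0, 1[%classic : set R) (radial_density u tau).
Proof.
apply: subspace_continuous_measurable_fun => //.
apply: continuous_in_subspaceT => x; rewrite inE /= in_itv /= => /andP[x0 x1].
by apply: (radial_density_continuous su); lra.
Qed.

Lemma profile_pow_measurable (e : R) :
  measurable_fun (`[0, 1[%classic : set R) (fun r => (1 - U r) `^ e).
Proof.
apply: subspace_continuous_measurable_fun => //.
apply: continuous_in_subspaceT => x; rewrite inE /= in_itv /= => /andP[x0 x1].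
have x11 : -1 < x < 1 by lra.
have /andP[_ U1] := profile_ge0_lt1 su x11.
apply: (@continuous_comp _ _ _ U (fun s => (1 - s) `^ e)).
  exact: (profile_continuous su).
exact: is_derive1_continuous (is_derive_pow1 _ U1).
Qed.

Lemma profile_pow_nincr tau (r s : R) : 0 <= tau -> 0 <= r -> r <= s -> s <= 1 ->
  (1 - U s) `^ (- tau) <= (1 - U r) `^ (- tau).
Proof.
move=> t0 r0 rs s1; have [r1|r1] := ltP r 1.
  have /andP[_ U1] := profile_ge0_lt1 su (introT andP (conj (lt_le_trans (@ltrN10 R) r0) r1)).
  apply: ler_powRN => //; first by rewrite subr_gt0.
  by rewrite lerD2l lerN2; exact: (profile_nincr l0 su st r0 rs s1).
by have -> : r = s by apply/eqP; rewrite eq_le rs (le_trans s1 r1).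
Qed.

Lemma radial_density_le tau (r : R) : 0 <= tau -> 0 <= r -> r < 1 ->
  0 <= radial_density u tau r <= (1 - U 0) `^ (- (2 * tau)).
Proof.
move=> t0 r0 r1; rewrite /radial_density mulr_ge0 ?exprn_ge0 ?powR_ge0 //=.
rewrite -[X in _ <= X]mul1r ler_pM ?exprn_ge0 ?powR_ge0 ?exprn_ile1 ?(ltW r1) //.
by apply: profile_pow_nincr => //; rewrite ?mulr_ge0 // ltW.
Qed.

Lemma radial_density_integrable01 tau : 0 <= tau ->
  leb.-integrable `[0, 1[ (EFin \o radial_density u tau).
Proof.
move=> t0; apply: (@itv_bounded_integrable R 0 1 _ ((1 - U 0) `^ (- (2 * tau)))) => //.
  exact: radial_density_measurable.
move=> x /andP[x0 x1]; have /andP[h1 h2] := radial_density_le t0 x0 x1.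
by rewrite ger0_norm.
Qed.

(** The energy estimate, written in polar coordinates and divided by the measure
    of the ball. *)
Lemma radial_energy (t : R) : 0 < t -> 0 < 4 * t + 2 - t ^+ 2 ->
  \int[leb]_(r in `[0, 1[) radial_density u (t + 3 / 2) r <=
  N%:R^-1 * (4 * (2 * t + 1) / (4 * t + 2 - t ^+ 2)) `^ ((2 * t + 3) / t).
Proof.
move=> t0 q0; pose tau := t + 3 / 2.
have tau2 : 2 * tau = 2 * t + 3 by rewrite /tau; lra.
have tau0 : 0 <= 2 * tau by rewrite tau2; lra.
pose G r := (1 - U r) `^ (- (2 * tau)).
have [ui ule] := energy_estimate l0 t0 q0 su st.
have eG x : B x -> (1 - u x) `^ (- (2 * t + 3)) = G (rnorm x).
  by move=> Bx; rewrite (profileE l0 su st Bx) /G tau2.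
have mG : measurable_fun B (fun x => G (rnorm x)).
  have /measurable_EFinP h := measurable_int _ ui.
  by apply: eq_measurable_fun h => x; rewrite inE => /eG.
have := @polar_le R N G isT _ _ _ mG.
have m0 : 0 < fine (mu B).
  apply: fine_gt0; rewrite unit_ball_fin andbT.
  apply: open_measure_gt0; first exact: open_unit_ball.
  by exists 0; rewrite /unit_ball /= big1 // => i _; rewrite mxE expr0n.
have <- : \int[mu]_(x in B) ((1 - u x) `^ (- (2 * t + 3))) = \int[mu]_(x in B) G (rnorm x).
  by apply: eq_Rintegral => x; rewrite inE => /eG.
move=> /(_ _ _ _)/le_trans => /(_ _ _ _ _ ule).
have -> : \int[leb]_(r in `[0, 1[) (N%:R * r ^+ N.-1 * G r) =
   N%:R * \int[leb]_(r in `[0, 1[) radial_density u tau r.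
  rewrite -RintegralZl //; last by apply: radial_density_integrable01; rewrite /tau; lra.
  by apply: eq_Rintegral => r _; rewrite mulrA.
rewrite mulrC ler_pM2r // ler_pdivlMl //; apply.
- by move=> r s; exact: profile_pow_nincr.
- exact: powR_ge0.
- exact: profile_pow_measurable.
Qed.

End radial_energy.

Theorem theorem3p3 (R : realType) (N : nat) (hN : (1 <= N <= 11)%N)
  (lambda : R) (hlambda : 0 < lambda) (u : 'rV[R]_N -> R)
  (hu : smooth_solution lambda u) (hstable : semi_stable lambda u)
  (lambda1 : R) (hlambda1 : first_dirichlet_eigenvalue (unit_ball R N) lambda1)
  (t : R) (ht : Num.max 0 ((N%:R - 3) / 2) < t < 2 + Num.sqrt 6) :
  (\int[@lebesgue_measure R]_(r in `[0%R, 1%R])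
     (r ^+ N.-1 /
      (1 - Linfty_norm (unit_ball R N) u
       + 4 * lambda1 * gamma (t + 3 / 2) N / 27
         * (4 * (2 * t + 1) / (4 * t + 2 - t ^+ 2)) `^ (2 / t)
         * r `^ ((4 * t + 6 - 2 * N%:R) / (2 * t + 3)))
      `^ (2 * t + 3))%:E
   <= (N%:R^-1 * (4 * (2 * t + 1) / (4 * t + 2 - t ^+ 2))
                 `^ ((2 * t + 3) / t))%:E)%E.
Proof.
have /andP[N0 _] := hN.
case: N N0 hN u hu hstable hlambda1 ht => // n _ _ u su st [ev1 _] /andP[].
rewrite gt_max => /andP[t0 tN] t6.
(* 4 t + 2 - t^2 = 6 - (t - 2)^2 *)
have q0 : 0 < 4 * t + 2 - t ^+ 2.
  have h : 0 <= Num.sqrt 6 :> R by exact: sqrtr_ge0.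
  have h2 : Num.sqrt 6 ^+ 2 = 6 :> R by rewrite sqr_sqrtr.
  have [h3|h3] := leP t 2; first by nra.
  have : (t - 2) ^+ 2 < Num.sqrt 6 ^+ 2 by rewrite ltr_pXn2r ?nnegrE // ?subr_ge0 ?ltW //; lra.
  by rewrite h2; nra.
set A := 4 * (2 * t + 1) / (4 * t + 2 - t ^+ 2).
have A0 : 0 < A by rewrite divr_gt0 //; lra.
pose tau := t + 3 / 2; pose K := A `^ ((2 * t + 3) / t).
have K0 : 0 < K by exact: powR_gt0.
have tau2 : 2 * tau = 2 * t + 3 by rewrite /tau; lra.
have tau1 : 1 < tau by rewrite /tau; lra.
have tau00 : 0 < tau by lra.
have Ntau : n.+1%:R < 2 * tau by rewrite tau2; lra.
have energy := radial_energy hlambda su st t0 q0; rewrite -/A -/K -/tau in energy.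
have fi := radial_density_integrable01 hlambda su st (ltW tau00).
have fge r : 0 <= r -> 0 <= radial_density u tau r.
  by move=> r0; rewrite mulr_ge0 ?exprn_ge0 ?powR_ge0.
have massK r : 0 < r < 1 -> radial_mass u tau r <= K / n.+1%:R.
  move=> /andP[r0 r1]; rewrite mulrC; apply: le_trans energy.
  have ri := radial_density_integrable su tau r1.
  rewrite -lee_fin /radial_mass -(EFin_Rintegral _ ri) // -(EFin_Rintegral _ fi) //.
  apply: ge0_subset_integral => //; first exact: measurable_int fi.
    by move=> x; rewrite /= in_itv /= => /andP[x0 _]; rewrite lee_fin fge.
  by move=> x; rewrite /= !in_itv /= => /andP[-> /le_lt_trans]; apply.
set alpha := (_ - _) / (2 * t + 3).
have alphaE : 2 - n.+1%:R / tau = alpha.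
  by rewrite /alpha -tau2 /tau; field; rewrite !gt_eqF //; lra.
have alpha0 : 0 < alpha by rewrite -alphaE subr_gt0 ltr_pdivrMr.
have growth r : 0 < r < 1 -> profile u 0 - profile u r <=
    lambda * gamma tau n.+1 * A `^ (2 / t) * r `^ alpha.
  have -> : A `^ (2 / t) = K `^ tau^-1.
    by rewrite /K -powRrM; congr (_ `^ _); rewrite -tau2; field; rewrite !gt_eqF.
  by rewrite -alphaE; exact: profile_growth.
have gamma0 : 0 <= gamma tau n.+1.
  case: (n) Ntau => [|[|k]] h /=.
  - by rewrite divr_ge0 //; lra.
  - by rewrite divr_ge0 //; lra.
  - by rewrite divr_ge0 ?powR_ge0 // !mulr_ge0 ?powR_ge0 // subr_ge0 ler_nat.
have lambda_le : lambda <= 4 * lambda1 / 27.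
  have [_ _ h1 h2 _] := su.
  have [/smooth_onP/(_ 2) Cu _ _ _ _] := su; exact: eigenvalue_lower_bound hlambda Cu h1 h2 ev1.
set a := 1 - _; set b := _ / 27 * _.
have a_ge : 1 - profile u 0 <= a by rewrite lerD2l lerN2; exact: (Linfty_norm_profile hlambda su st).
(* At r = 0 the power vanishes because alpha > 0, and the bound is a_ge. *)
have D_ge r : 0 <= r < 1 -> 1 - profile u r <= a + b * r `^ alpha.
  move=> /andP[]; rewrite le_eqVlt => /orP[/eqP <- _|r0 r1].
    by rewrite powR0 ?gt_eqF // mulr0 addr0.
  have := growth r (introT andP (conj r0 r1)).
  have : lambda * gamma tau n.+1 * A `^ (2 / t) * r `^ alpha <= b * r `^ alpha.
    rewrite ler_wpM2r ?powR_ge0 // /b ler_wpM2r ?powR_ge0 //.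
    by rewrite -[_ * _ / 27]mulrAC ler_wpM2r.
  lra.
have mF : measurable_fun [set: R] (fun r => r ^+ n / (a + b * r `^ alpha) `^ (2 * t + 3)).
  apply: measurable_funM; first exact: exprn_measurable.
  rewrite (_ : (fun r => _) = (fun y => y `^ (- (2 * t + 3))) \o (fun r => a + b * r `^ alpha)).
    apply: measurableT_comp; first exact: measurable_powR.
    apply: measurable_funD; first exact: measurable_cst.
    by apply: measurable_funM; [exact: measurable_cst|exact: measurable_powR].
  by apply/funext => r /=; rewrite powRN.
rewrite -(@integral_itv_bndo_bndc R); last by apply/measurable_EFinP; exact: measurable_funTS mF.
apply: (@le_trans _ _ (\int[@lebesgue_measure R]_(r in `[0%R, 1%R[) (radial_density u tau r)%:E)%E).
  apply: ge0_le_integral => //.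
  - move=> r; rewrite /= in_itv /= => /andP[r0 r1].
    by rewrite lee_fin mulr_ge0 ?exprn_ge0 ?invr_ge0 ?powR_ge0.
  - by apply/measurable_EFinP; exact: measurable_funTS mF.
  - exact: measurable_int fi.
  - move=> r; rewrite /= in_itv /= => /andP[r0 r1]; rewrite lee_fin.
    rewrite /radial_density tau2 -[X in _ * X <= _]powRN ler_wpM2l ?exprn_ge0 //.
    have /andP[_ U1] := profile_ge0_lt1 su (introT andP (conj (lt_le_trans (@ltrN10 R) r0) r1)).
    apply: ler_powRN; [lra|by rewrite subr_gt0|].
    by apply: D_ge; rewrite r0.
by rewrite EFin_Rintegral // lee_fin.
Qed.
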